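(* Let $\mu$ be a finite non-negative Borel measure on $\mathbb T$ and $n\in\mathbb N$. Then $\mathcal H_{\mu,n}\cap\mathrm{Mult}(\mathcal H_{\sigma,n-1})$ is an algebra under pointwise multiplication.
   Context: $\mathbb D$ is the open unit disc, $\mathbb T$ the unit circle, $dA$ normalized area measure on $\mathbb D$, $\sigma$ normalized arc-length measure on $\mathbb T$, $\mathcal O(\mathbb D)$ the holomorphic functions on $\mathbb D$, $H^2$ the Hardy space. $P_\mu(z)=\int_{\mathbb T}\frac{1-|z|^2}{|z-\zeta|^2}d\mu(\zeta)$. For $n\ge1$, $D_{\mu,n}(f)=\frac{1}{n!(n-1)!}\int_{\mathbb D}|f^{(n)}(z)|^2P_\mu(z)(1-|z|^2)^{n-1}dA(z)$. If $\mu\neq0$, $\mathcal H_{\mu,n}=\{f\in\mathcal O(\mathbb D):D_{\mu,n}(f)<\infty\}$; if $\mu=0$, $\mathcal H_{\mu,n}:=H^2$. For $f=\sum_k a_kz^k$ and $j\ge0$, $D_{\sigma,j}(f)=\sum_{k\ge j}\binom{k}{j}|a_k|^2$ and $\mathcal H_{\sigma,j}=\{f:D_{\sigma,j}(f)<\infty\}$ (so $\mathcal H_{\sigma,0}=H^2$). For a space $\mathcal H\subseteq\mathcal O(\mathbb D)$, $\mathrm{Mult}(\mathcal H)=\{\varphi\in\mathcal O(\mathbb D):\varphi f\in\mathcal H\text{ for all }f\in\mathcal H\}$. *)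

(* Defs.v *)
From HB Require Import structures.
From mathcomp Require Import all_boot all_order all_algebra.
From mathcomp Require Import all_classical all_reals all_analysis.
From mathcomp Require Import complex.
Set Implicit Arguments. Unset Strict Implicit. Unset Printing Implicit Defensive.
Import Order.TTheory GRing.Theory Num.Theory.
Import numFieldNormedType.Exports.
Local Open Scope classical_set_scope.
Local Open Scope ring_scope.

Section Defs.
Variable R : realType.
Local Notation C := (R[i]).

Definition sqmod (w : C) : R := (complex.Re w) ^+ 2 + (complex.Im w) ^+ 2.

Definition toC (p : (R * R)%type) : C := @Complex R p.1 p.2.

Definition discR : set (R * R) := [set p | p.1 ^+ 2 + p.2 ^+ 2 < 1].
Definition circleR : set (R * R) := [set p | p.1 ^+ 2 + p.2 ^+ 2 = 1].

(* f is holomorphic on the open unit disc: complex differentiable at every z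
   with |z| < 1 (R[i] is a numFieldType, so [derivable f z 1] is the complex
   derivative with h -> 0 in C). *)
Definition holo (f : C -> C) : Prop :=
  forall z : C, `|z| < 1 -> derivable (f : C^o -> C^o) z 1.

Definition cder (n : nat) (f : C -> C) : C -> C := derive1n n (f : C^o -> C^o).

Definition coef (f : C -> C) (k : nat) : C := cder k f 0 / (k`!)%:R.

Definition Dsig (j : nat) (f : C -> C) : \bar R :=
  (\sum_(j <= k <oo) (('C(k, j))%:R * sqmod (coef f k))%:E)%E.

Definition Hsig (j : nat) (f : C -> C) : Prop := holo f /\ (Dsig j f < +oo)%E.

Definition H2 (f : C -> C) : Prop := Hsig 0 f.

(* Poisson integral of mu (a measure on R x R carried by the unit circle) *)
Definition Poisson (mu : {measure set (R * R)%type -> \bar R}) (z : C) : \bar R :=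
  (\int[mu]_(p in circleR) ((1 - sqmod z) / sqmod (z - toC p))%:E)%E.

(* D_{mu,n}(f), dA = dx dy / pi on the disc *)
Definition Dmu (mu : {measure set (R * R)%type -> \bar R}) (n : nat) (f : C -> C)
  : \bar R :=
  (((n`! * (n.-1)`!)%:R)^-1%:E *
   ((pi : R)^-1%:E *
    \int[(@lebesgue_measure R \x @lebesgue_measure R)%E]_(p in discR)
       ((sqmod (cder n f (toC p)) * (1 - sqmod (toC p)) ^+ n.-1)%:E
          * Poisson mu (toC p))))%E.

Definition mu_zero (mu : {measure set (R * R)%type -> \bar R}) : Prop :=
  forall A, measurable A -> mu A = 0%E.

Definition Hmu (mu : {measure set (R * R)%type -> \bar R}) (n : nat) (f : C -> C)
  : Prop :=
  holo f /\ (mu_zero mu -> H2 f) /\ (~ mu_zero mu -> (Dmu mu n f < +oo)%E).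

Definition Mult (H : (C -> C) -> Prop) (phi : C -> C) : Prop :=
  holo phi /\ forall f, H f -> H (fun z => phi z * f z).

Definition is_algebra (A : (C -> C) -> Prop) : Prop :=
  A (fun _ => 1) /\
  (forall f g, A f -> A g -> A (fun z => f z + g z)) /\
  (forall (c : C) f, A f -> A (fun z => c * f z)) /\
  (forall f g, A f -> A g -> A (fun z => f z * g z)).

End Defs.

(* Main.v *)
(** A function f = sum a_k z^k belongs to H_{mu,n} iff the local energies
    E(a, l) = sum_k k!/(k+n+1)! |sum_(i <= k) (i+n)!/i! a_(i+n) l^i|^2
    are mu-integrable over the circle: apply Parseval for the weight (1 - |z|^2)^n to
    f^(n)(z) / (z - l), whose square modulus carries the Poisson kernel at l, and then Tonelli.

    Fix l on the circle and put j = n - 1. A telescoping identity (a local Douglas formula) shows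
    that E(a, l) < oo iff, for some number al, the tails t_k = al - sum_(i <= k) a_i l^i satisfy
    sum_k C(k, j) |t_k|^2 < oo, with comparable bounds; then l^-(k+1) t_k are the coefficients of
    F = (f - al) / (z - l), and al is the radial limit of f at l.

    A multiplier f of H_{sigma,j} acts boundedly (uniform boundedness), hence is bounded on the
    disc, and so |al| is bounded independently of l. From
    (f g - al be) / (z - l) = f G + be F, where G = (g - be) / (z - l),
    one gets E(f g, l) <= K1 + K2 E(f, l) + K3 E(g, l) with constants independent of l, and
    integration against mu finishes the proof. *)

Require Import Defs.
From HB Require Import structures.
From mathcomp Require Import all_boot all_order all_algebra.
From mathcomp Require Import all_classical all_reals all_analysis.
From mathcomp Require Import complex.
From mathcomp Require Import measurable_realfun.
From mathcomp Require Import ring lra zify.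
Set Implicit Arguments. Unset Strict Implicit. Unset Printing Implicit Defensive.
Import Order.TTheory GRing.Theory Num.Theory.
Import numFieldNormedType.Exports.
Local Open Scope classical_set_scope.
Local Open Scope ring_scope.
Import Normc.

(** * Complex derivatives and power series *)

Section Modulus.
Variable R : realType.
Local Notation C := R[i].
Implicit Types (z w : C) (x : R).

(** Multiplication by f must be estimated on G = (g - be) / (z - l) for all l of the circle at once:
    a constant depending on l would not survive the integration against mu. Therefore the multiplier
    property is first turned into one inequality between weighted norms of coefficient sequences,
    valid for every sequence. The Douglas formula makes E(g, l) comparable with the norm of G in
    H_{sigma,j}, and that inequality then controls f G by E(g, l). The same constant bounds |f|^2 on
    the disc, hence |al|^2, so that all constants come from f and g alone. The weight C(k, j) is
    blind to the indices k < j. Adding 1 to it gives a norm on the same space, at the price of the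
    first j tails, which are bounded through |al| and end up in K1. When mu = 0 the condition is
    membership in H^2, and it comes from the multiplier side: f = f 1 lies in H_{sigma,j}, which is
    contained in H^2. *)

Lemma normCE z : `|z| = (normc z)%:C%C.
Proof. by case: z. Qed.

Lemma normc_sq z : normc z ^+ 2 = sqmod z.
Proof. by case: z => a b; rewrite /normc /sqmod /= sqr_sqrtr ?addr_ge0 ?sqr_ge0. Qed.

Lemma normc_ge0 z : 0 <= normc z.
Proof. by case: z => a b; exact: sqrtr_ge0. Qed.
Hint Resolve normc_ge0 : core.

Lemma normcD z w : normc (z + w) <= normc z + normc w.
Proof. exact: le_normcD. Qed.

Lemma normcB z w : normc (z - w) = normc (w - z).
Proof. by rewrite -normcN opprB. Qed.

Lemma normcX z n : normc (z ^+ n) = normc z ^+ n.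
Proof. by elim: n => [|n IH]; [exact: normc1|rewrite !exprS normcM IH]. Qed.

Lemma normc_eq0 z : (normc z == 0) = (z == 0).
Proof.
by apply/eqP/eqP => [/eq0_normc//|->]; exact: normc0.
Qed.

Lemma normc_gt0 z : (0 < normc z) = (z != 0).
Proof. by rewrite lt_neqAle normc_ge0 andbT eq_sym normc_eq0. Qed.

Lemma normc_real x : normc x%:C%C = `|x|.
Proof. by rewrite /normc /= expr0n /= addr0 sqrtr_sqr. Qed.

Lemma normc_nat n : normc (n%:R : C) = n%:R.
Proof. by have := normc_real n%:R; rewrite rmorph_nat ger0_norm. Qed.

Lemma normc_sum (I : Type) (r : seq I) (P : pred I) (F : I -> C) :
  normc (\sum_(i <- r | P i) F i) <= \sum_(i <- r | P i) normc (F i).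
Proof.
elim/big_ind2: _ => //; first by rewrite normc0.
by move=> x1 x2 y1 y2 h1 h2; apply: le_trans (normcD _ _) (lerD h1 h2).
Qed.

Lemma normc_Re z : `|complex.Re z| <= normc z.
Proof. by case: z => a b; rewrite /normc /= -[`|a|]sqrtr_sqr ler_sqrt ?addr_ge0 ?sqr_ge0// lerDl sqr_ge0. Qed.

Lemma normc_Im z : `|complex.Im z| <= normc z.
Proof. by case: z => a b; rewrite /normc /= -[`|b|]sqrtr_sqr ler_sqrt ?addr_ge0 ?sqr_ge0// lerDr sqr_ge0. Qed.

Lemma normc_le z : normc z <= `|complex.Re z| + `|complex.Im z|.
Proof.
rewrite -ler_sqr ?nnegrE ?addr_ge0 // normc_sq /sqmod sqrrD !real_normK ?num_real //.
by rewrite addrAC lerDl mulrn_wge0 // mulr_ge0.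
Qed.

Lemma sqmodM z w : sqmod (z * w) = sqmod z * sqmod w.
Proof. by rewrite -!normc_sq normcM exprMn. Qed.

Lemma sqmod_ge0 z : 0 <= sqmod z.
Proof. by rewrite -normc_sq sqr_ge0. Qed.

Lemma sqmodD_le z w : sqmod (z + w) <= 2 * (sqmod z + sqmod w).
Proof.
rewrite -!normc_sq (le_trans (y := (normc z + normc w) ^+ 2)) //.
  by rewrite ler_sqr ?nnegrE ?addr_ge0 // normcD.
have := sqr_ge0 (normc z - normc w); nra.
Qed.

(** The remainder is measured by the real-valued [normc], so that all estimates are real
    inequalities; the form without division also covers h = 0. *)
Definition cderiv (f : C -> C) z l := forall e : R, 0 < e -> exists2 d : R, 0 < d &
  forall h, normc h < d -> normc (f (z + h) - f z - l * h) <= e * normc h.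

Lemma cgt0P (e : C) : 0 < e -> exists2 x : R, 0 < x & e = x%:C%C.
Proof. by case: e => a b; rewrite ltcE /= => /andP[/eqP -> a0]; exists a. Qed.

Lemma cderivP (f : C -> C) z l :
  cderiv f z l <-> is_derive (z : C^o) (1 : C^o) (f : C^o -> C^o) (l : C^o).
Proof.
have key (h : C) : h != 0 -> f (z + h) - f z - l * h =
    (h^-1 *: ((f (h *: (1 : C^o) + z) : C^o) - f z) - l) * h.
  move=> h0; rewrite mulrBl /GRing.scale /= mulr1 (addrC h) mulrAC mulVf //.
  by rewrite mul1r.
have aux : cderiv f z l <->
   (fun h : C^o => h^-1 *: ((f (h *: (1 : C^o) + z) : C^o) - f z)) @ (0 : C^o)^' --> (l : C^o).
  split=> [fl|fl].
  - apply/cvgrPdist_le => /= e /cgt0P[x x0 ->].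
    have [d d0 fd] := fl _ x0; exists d%:C%C => /=; first by rewrite ltcR.
    move=> h /=; rewrite sub0r normrN normCE ltcR => hd h0.
    have := fd h hd; rewrite key // normcM ler_pM2r ?normc_gt0 // => fh.
    by rewrite normCE lecR normcB.
  - move=> e e0; move/cvgrPdist_le: fl => /(_ e%:C%C); rewrite ltcR => /(_ e0)[/= d].
    case/cgt0P => x x0 -> fd; exists x => // h hx.
    have [->|h0] := eqVneq h 0; first by rewrite addr0 mulr0 subr0 subrr normc0 mulr0.
    have := fd h; rewrite /= sub0r normrN normCE ltcR => /(_ hx h0).
    by rewrite normCE lecR key // normcM ler_pM2r ?normc_gt0 // normcB.
split => [/aux fl|[dv dl]].
  apply: DeriveDef; first by apply/cvg_ex; exists l.
  exact: cvg_lim fl.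
by apply/aux; rewrite -dl; exact: dv.
Qed.

Lemma cderiv_derive1 (f : C -> C) z l : cderiv f z l ->
  derive1 (f : C^o -> C^o) z = l.
Proof. by move=> /cderivP fl; rewrite derive1E; exact: derive_val. Qed.

Lemma derivable_cderiv (f : C -> C) z : derivable (f : C^o -> C^o) z 1 ->
  cderiv f z (derive1 (f : C^o -> C^o) z).
Proof. by move=> df; apply/cderivP; rewrite derive1E; exact: derivableP. Qed.

Lemma cderiv_derivable (f : C -> C) z l : cderiv f z l ->
  derivable (f : C^o -> C^o) z 1.
Proof. by move=> /cderivP[]. Qed.

Lemma cderiv_continuous (f : C -> C) z l : cderiv f z l ->
  forall e : R, 0 < e -> exists2 d : R, 0 < d &
    forall w, normc (w - z) < d -> normc (f w - f z) < e.
Proof.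
move=> fl e e0; have [d d0 fd] := fl 1 ltr01.
have nl : 0 < normc l + 1 by rewrite ltr_wpDl.
exists (Num.min d (e / (normc l + 1))); first by rewrite lt_min d0 divr_gt0.
move=> w; rewrite lt_min => /andP[wd we]; have := fd _ wd.
rewrite (addrC z) subrK => H.
have := normcD (f w - f z - l * (w - z)) (l * (w - z)).
rewrite subrK normcM => H1; apply: le_lt_trans (le_trans H1 (lerD H (lexx _))) _.
rewrite mul1r -{1}[normc (w - z)]mul1r -mulrDl addrC mulrC.
by rewrite -ltr_pdivlMr.
Qed.

End Modulus.
#[export] Hint Resolve normc_ge0 sqmod_ge0 : core.

(** * Convergent complex series *)

Section CSum.
Variable R : realType.
Local Notation C := R[i].
Implicit Types (z w l : C) (u v : nat -> C).

(** A relation, so that sums can be combined without choosing limits. Convergence is that of the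
    ordered partial sums, not absolute. *)
Definition csum u l := forall e : R, 0 < e -> exists N0 : nat, forall N, (N0 <= N)%N ->
  normc (\sum_(k < N) u k - l) <= e.

Lemma csum_eq u v l : (forall k, u k = v k) -> csum u l -> csum v l.
Proof. by move=> uv; have -> : v = u by apply/funext => k. Qed.

Lemma csumD u v l m : csum u l -> csum v m -> csum (fun k => u k + v k) (l + m).
Proof.
move=> ul vm e e0; have e2 : 0 < e / 2 by lra.
have [N1 h1] := ul _ e2; have [N2 h2] := vm _ e2.
exists (maxn N1 N2) => N; rewrite geq_max => /andP[a b].
rewrite big_split /= opprD addrACA (le_trans (normcD _ _)) //.
by rewrite (splitr e) lerD ?h1 ?h2.
Qed.

Lemma csumZ u l c : csum u l -> csum (fun k => c * u k) (c * l).
Proof.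
move=> ul e e0; have c1 : 0 < normc c + 1 by rewrite ltr_wpDl.
have [N1 h1] := ul (e / (normc c + 1)) ltac:(by rewrite divr_gt0).
exists N1 => N NN; rewrite -mulr_sumr -mulrBr normcM.
rewrite (le_trans (ler_wpM2l _ (h1 _ NN))) // mulrCA ger_pMr //.
by rewrite ler_pdivrMr // mul1r lerDl.
Qed.

Lemma csumN u l : csum u l -> csum (fun k => - u k) (- l).
Proof.
by move=> /(csumZ (-1)); rewrite mulN1r; apply: csum_eq => k; rewrite mulN1r.
Qed.

Lemma csumB u v l m : csum u l -> csum v m -> csum (fun k => u k - v k) (l - m).
Proof. by move=> ul /csumN; exact: csumD. Qed.

Lemma csum_le u l (M : R) : csum u l ->
  (forall N, \sum_(k < N) normc (u k) <= M) -> normc l <= M.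
Proof.
move=> ul uM; apply/ler_addgt0Pr => e e0; have [N h] := ul _ e0.
rewrite -(subrK (\sum_(k < N) u k) l) (le_trans (normcD _ _)) // addrC.
apply: lerD; last by rewrite normcB h.
exact: le_trans (normc_sum _ _ _) _.
Qed.

Lemma csum_uniq u l m : csum u l -> csum u m -> l = m.
Proof.
move=> ul um; have := csumB ul um => h; apply/eqP; rewrite -subr_eq0 -normc_eq0.
rewrite eq_le normc_ge0 andbT; apply: (csum_le h) => N.
by rewrite big1 // => k _; rewrite subrr normc0.
Qed.

Lemma csum_unS u l : csum (fun k => u k.+1) l -> csum u (u 0%N + l).
Proof.
move=> ul e e0; have [N0 h] := ul e e0; exists N0.+1 => -[//|N] NN.
by rewrite big_ord_recl /= opprD addrACA subrr add0r h.
Qed.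

Lemma csum_term u l : csum u l -> exists M : R, forall k, normc (u k) <= M.
Proof.
move=> ul; have [N0 h] := ul 1 ltr01.
exists (2 + \sum_(i < N0) normc (u i)) => k.
have [kN|Nk] := ltnP k N0.
  by rewrite (bigD1 (Ordinal kN)) //= addrCA lerDl addr_ge0 // sumr_ge0.
have -> : u k = (\sum_(i < k.+1) u i - l) - (\sum_(i < k) u i - l).
  by rewrite big_ord_recr /= opprB addrA subrK addrC addKr.
rewrite (le_trans (normcD _ _)) // normcN ler_wpDr // ?sumr_ge0 //.
apply: (le_trans (lerD (h _ _) (h _ Nk))) => //; exact: leq_trans Nk _.
Qed.

Lemma real_sum_cvg (x y : nat -> R) (M : R) : (forall k, `|x k| <= y k) ->
  (forall N, \sum_(k < N) y k <= M) -> exists s : R, series x @ \oo --> s.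
Proof.
move=> xy yM; have cy : cvgn (series y).
  apply: nondecreasing_is_cvgn.
    move=> m n mn; rewrite /series /= (big_cat_nat (leq0n _) mn) /=.
    by rewrite lerDl sumr_ge0 // => i _; exact: le_trans (xy i).
  by exists M => _ [n _ <-]; rewrite /series /= big_mkord.
have cx : cvgn (series x).
  have y0 k : 0 <= y k by exact: le_trans (normr_ge0 _) (xy k).
  by apply: normed_cvg; apply: series_le_cvg cy => /=.
by exists (limn (series x)).
Qed.

Lemma asum_csum u (M : R) : (forall N, \sum_(k < N) normc (u k) <= M) ->
  exists l, csum u l.
Proof.
move=> uM.
have [a ha] := real_sum_cvg (fun k => normc_Re (u k)) uM.
have [b hb] := real_sum_cvg (fun k => normc_Im (u k)) uM.
exists (Complex a b) => e e0; have e2 : 0 < e / 2 by lra.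
move/cvgrPdist_le : ha => /(_ _ e2)[N1 _ h1].
move/cvgrPdist_le : hb => /(_ _ e2)[N2 _ h2].
exists (maxn N1 N2) => N; rewrite geq_max => /andP[n1 n2].
rewrite (le_trans (normc_le _)) // (splitr e) lerD //.
- have := h1 N n1; rewrite distrC /series /= big_mkord; congr (`|_| <= _).
  rewrite !raddfB /=; congr (_ - _); by rewrite (@raddf_sum _ _ (@complex.Re R)).
- have := h2 N n2; rewrite distrC /series /= big_mkord; congr (`|_| <= _).
  rewrite !raddfB /=; congr (_ - _); by rewrite (@raddf_sum _ _ (@complex.Im R)).
Qed.

End CSum.

Lemma geom_bound (R : realType) (q : R) N : 0 <= q -> q < 1 ->
  \sum_(k < N) q ^+ k <= (1 - q)^-1.
Proof.
move=> q0 q1; have q1' : 0 < 1 - q by rewrite subr_gt0.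
rewrite -(ler_pM2r q1') mulVf ?gt_eqF // mulrC -opprB mulNr -subrX1 opprB.
by rewrite gerBl exprn_ge0.
Qed.

(** * Power series on the unit disc and their derivatives *)

Section PowerSeries.
Variable R : realType.
Local Notation C := R[i].
Implicit Types (z w l : C) (a b : nat -> C) (f g : C -> C).

Definition has_ps f a := forall z, normc z < 1 -> csum (fun k => a k * z ^+ k) (f z).

(** Abel's lemma: the terms are bounded at a radius s strictly between r and 1, and the ratio r / s
    gives a geometric majorant. *)
Lemma has_ps_abs f a r : has_ps f a -> 0 <= r -> r < 1 ->
  exists M : R, forall N, \sum_(k < N) normc (a k) * r ^+ k <= M.
Proof.
move=> fa r0 r1; pose s := (1 + r) / 2.
have s0 : 0 < s by rewrite /s; lra.
have s1 : s < 1 by rewrite /s; lra.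
have rs : r < s by rewrite /s; lra.
have ns : normc (s%:C%C : C) = s by rewrite normc_real ger0_norm // ltW.
have [M hM] := csum_term (fa s%:C%C ltac:(by rewrite ns)).
have M0 : 0 <= M by exact: le_trans (hM 0%N).
exists (M * (1 - r / s)^-1) => N.
apply: (@le_trans _ _ (M * \sum_(k < N) (r / s) ^+ k)); last first.
  apply: ler_wpM2l => //; apply: geom_bound; first by rewrite divr_ge0 // ltW.
  by rewrite ltr_pdivrMr // mul1r.
rewrite mulr_sumr ler_sum // => k _.
have := hM k; rewrite normcM normcX ns => h.
rewrite expr_div_n mulrA mulrAC; apply: ler_wpM2r; first by rewrite exprn_ge0.
by rewrite ler_pdivlMr // exprn_gt0.
Qed.

Definition psum a z : C := xget 0 [set l : C | csum (fun k => a k * z ^+ k) l].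

Definition summable_ps a := forall r : R, 0 <= r -> r < 1 ->
  exists M : R, forall N, \sum_(k < N) normc (a k) * r ^+ k <= M.

Lemma psumP a : summable_ps a -> has_ps (psum a) a.
Proof.
move=> sa z z1; have [M hM] := sa _ (normc_ge0 z) z1.
have [|l ?] := @asum_csum R (fun k => a k * z ^+ k) M; last by apply: (@xgetPex C 0 [set l : C | csum (fun k => a k * z ^+ k) l]); exists l.
by move=> N; under eq_bigr do rewrite normcM normcX.
Qed.

Definition dps a k : C := a k.+1 *+ k.+1.

(** The second-order remainder of s ^ k, a majorant for its complex counterpart. At k = 0 the
    truncated exponent [k.-1] does no harm, its term being taken zero times. *)
Let brn (s d : R) k := (s + d) ^+ k - s ^+ k - s ^+ k.-1 * d *+ k.

Let brnS s d k : brn s d k.+1 = (s + d) * brn s d k + s ^+ k.-1 * d ^+ 2 *+ k.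
Proof.
rewrite /brn; case: k => [|k]; first by rewrite /=; ring.
by rewrite !succnK !exprS !mulrS; ring.
Qed.

Let brn_ge0 s d k : 0 <= s -> 0 <= d -> 0 <= brn s d k.
Proof.
move=> s0 d0; elim: k => [|k IH]; first by rewrite /brn !expr0 mulr0n subrr subr0.
rewrite brnS addr_ge0 //; first by apply: mulr_ge0 => //; exact: addr_ge0.
by rewrite mulrn_wge0 // mulr_ge0 ?exprn_ge0.
Qed.

Let brn_le s d k : 0 <= s -> 0 <= d -> brn s d k <= (s + d) ^+ k.
Proof.
move=> s0 d0; rewrite /brn -addrA gerDl -opprD oppr_le0.
by rewrite addr_ge0 ?exprn_ge0 // mulrn_wge0 // mulr_ge0 ?exprn_ge0.
Qed.

(** The complex remainder obeys the recursion of [brnS], with |z + h| <= |z| + d and with |h|^2 in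
    place of d^2; the factor |h|^2 / d^2 makes up for the latter. *)
Let crn_le z h k d : 0 < d -> normc h <= d ->
  normc ((z + h) ^+ k - z ^+ k - z ^+ k.-1 * h *+ k) <=
  normc h ^+ 2 / d ^+ 2 * brn (normc z) d k.
Proof.
move=> d0 hd; have d2 : 0 < d ^+ 2 by rewrite exprn_gt0.
elim: k => [|k IH].
  rewrite !expr0 mulr0n subrr subr0 normc0; apply: mulr_ge0.
    by rewrite divr_ge0 ?exprn_ge0 // ltW.
  exact: brn_ge0 (normc_ge0 z) (ltW d0).
have -> : (z + h) ^+ k.+1 - z ^+ k.+1 - z ^+ k * h *+ k.+1 =
   (z + h) * ((z + h) ^+ k - z ^+ k - z ^+ k.-1 * h *+ k) + z ^+ k.-1 * h ^+ 2 *+ k.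
  case: k {IH} => [|k]; first by rewrite /=; ring.
  by rewrite !succnK !exprS !mulrS; ring.
rewrite (le_trans (normcD _ _)) // brnS [leRHS]mulrDr lerD //.
  rewrite normcM mulrCA; apply: ler_pM => //.
  by rewrite (le_trans (normcD _ _)) // lerD2l.
rewrite -[z ^+ _ * _ *+ k]mulr_natr -[normc z ^+ _ * _ *+ k]mulr_natr !normcM !normcX normc_nat; move: (normc z ^+ k.-1) => s.
by rewrite [leRHS](_ : _ = s * normc h ^+ 2 * k%:R) //; field; rewrite gt_eqF.
Qed.

(** Nonnegativity of [brn] gives (k + 1) s^k d <= (s + d)^(k + 1): a margin d in the radius pays for
    the factor produced by differentiation. *)
Let dps_abs a s d M : 0 <= s -> 0 < d ->
  (forall N, \sum_(k < N) normc (a k) * (s + d) ^+ k <= M) ->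
  forall N, \sum_(k < N) normc (dps a k) * s ^+ k <= M / d.
Proof.
move=> s0 d0 aM N; rewrite ler_pdivlMr //.
apply: le_trans (aM N.+1); rewrite big_ord_recl /= mulr_suml ler_wpDl ?mulr_ge0 //.
apply: ler_sum => k _; rewrite /dps -mulr_natr normcM normc_nat -!mulrA ler_wpM2l //.
have := brn_ge0 k.+1 s0 (ltW d0); rewrite /brn /= -addrA -opprD subr_ge0.
by apply: le_trans; rewrite mulr_natl ler_wpDl ?exprn_ge0.
Qed.

Lemma summable_dps a : summable_ps a -> summable_ps (dps a).
Proof.
move=> sa r r0 r1; pose d := (1 - r) / 2.
have d0 : 0 < d by rewrite /d; lra.
have [M hM] : exists M : R, forall N, \sum_(k < N) normc (a k) * (r + d) ^+ k <= M.
  by apply: sa; rewrite /d; lra.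
by exists (M / d); exact: dps_abs hM.
Qed.

Lemma has_ps_summable f a : has_ps f a -> summable_ps a.
Proof. by move=> fa r; exact: has_ps_abs fa. Qed.

(** The remainders of the single terms are dominated by |h|^2 / d^2 times a summable majorant at the
    radius |z| + d, so the total remainder is of order |h|^2. *)
Lemma has_ps_cderiv f a z : has_ps f a -> normc z < 1 ->
  cderiv f z (psum (dps a) z).
Proof.
move=> fa z1; have sa := has_ps_summable fa.
have [d d0 zd] : exists2 d, 0 < d & normc z + d < 1.
  by exists ((1 - normc z) / 2); lra.
have [M hM] : exists M : R, forall N, \sum_(k < N) normc (a k) * (normc z + d) ^+ k <= M.
  exact: sa (addr_ge0 (normc_ge0 z) (ltW d0)) zd.
have M0 : 0 <= M by have := hM 0%N; rewrite big_ord0.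
have key h : normc h <= d -> normc (f (z + h) - f z - psum (dps a) z * h) <=
    normc h ^+ 2 / d ^+ 2 * M.
  move=> hd; have zh : normc (z + h) < 1.
    by rewrite (le_lt_trans (normcD _ _)) // (le_lt_trans (y := normc z + d)) ?lerD2l.
  have H : csum (fun k => a k * ((z + h) ^+ k - z ^+ k - z ^+ k.-1 * h *+ k))
      (f (z + h) - f z - psum (dps a) z * h).
    have H1 := csumB (fa _ zh) (fa _ z1).
    have H2 := psumP (summable_dps sa) z1.
    have H3 : csum (fun k => a k * (z ^+ k.-1 * h *+ k)) (psum (dps a) z * h).
      have := csumZ h H2; rewrite mulrC => H3.
      have := @csum_unS _ (fun k => a k * (z ^+ k.-1 * h *+ k)) (psum (dps a) z * h).
      rewrite mulr0n mulr0 add0r; apply; apply: csum_eq H3 => k /=.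
      by rewrite /dps !mulrnAl !mulrnAr; congr (_ *+ _); ring.
    by apply: csum_eq (csumB H1 H3) => k; rewrite !mulrBr.
  apply: (csum_le H) => N.
  apply: (@le_trans _ _ (normc h ^+ 2 / d ^+ 2 * \sum_(k < N) normc (a k) * (normc z + d) ^+ k)).
    rewrite mulr_sumr ler_sum // => k _; rewrite normcM mulrCA ler_wpM2l //.
    apply: le_trans (crn_le _ _ d0 hd) _; apply: ler_wpM2l.
      by rewrite divr_ge0 ?exprn_ge0 // ltW.
    exact: brn_le (normc_ge0 z) (ltW d0).
  by rewrite ler_wpM2l ?divr_ge0 ?exprn_ge0 // ltW.
move=> e e0; exists (Num.min d (e * d ^+ 2 / (M + 1))).
  by rewrite lt_min d0 divr_gt0 ?mulr_gt0 ?exprn_gt0 //; lra.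
move=> h; rewrite lt_min => /andP[/ltW hd]; rewrite ltr_pdivlMr ?ltr_wpDl // => /ltW he.
rewrite (le_trans (key h hd)) // mulrAC ler_pdivrMr ?exprn_gt0 //.
have := ler_wpM2l (normc_ge0 h) he; have := sqr_ge0 (normc h); nra.
Qed.

Lemma has_ps_derive1 f a : has_ps f a ->
  has_ps (derive1 (f : C^o -> C^o)) (dps a).
Proof.
move=> fa z z1; rewrite (cderiv_derive1 (has_ps_cderiv fa z1)).
exact: psumP (summable_dps (has_ps_summable fa)) _ z1.
Qed.

Lemma has_ps_cder f a n : has_ps f a -> has_ps (cder n f) (iter n dps a).
Proof. by move=> fa; elim: n => [//|n IH]; exact: has_ps_derive1 IH. Qed.

Lemma iter_dps a n k : iter n dps a k = a (k + n)%N *+ ((k + n) ^_ n).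
Proof.
elim: n k => [|n IH] k; first by rewrite addn0 ffactn0 mulr1n.
rewrite /= /dps IH addSnnS -mulrnA; congr (_ *+ _).
rewrite -addSnnS.
rewrite ffactnSr addSn subSn ?leq_addl // addnK //.
Qed.

Lemma has_ps0 f a : has_ps f a -> f 0 = a 0%N.
Proof.
move=> fa; have f0 : csum (fun k => a k * 0 ^+ k) (f 0) by apply: fa; rewrite normc0.
apply: csum_uniq f0 _ => e e0; exists 1%N => -[//|N] _.
rewrite big_ord_recl /= expr0 mulr1 big1 ?addr0 ?subrr ?normc0 ?ltW // => i _.
by rewrite expr0n mulr0.
Qed.

Lemma has_ps_coef f a : has_ps f a -> coef f = a.
Proof.
move=> fa; apply/funext => k; rewrite /coef (has_ps0 (has_ps_cder k fa)).
by rewrite iter_dps add0n ffactnn -[a k *+ _]mulr_natr mulfK // pnatr_eq0 -lt0n fact_gt0.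
Qed.

Lemma disc_normc z : (`|z| < 1) = (normc z < 1).
Proof. by rewrite normCE -ltcR. Qed.

Lemma has_ps_holo f a : has_ps f a -> holo f.
Proof.
by move=> fa z; rewrite disc_normc => z1; exact: cderiv_derivable (has_ps_cderiv fa z1).
Qed.

Lemma has_ps_eq f g a : has_ps f a -> (forall z, normc z < 1 -> f z = g z) -> has_ps g a.
Proof. by move=> fa fg z z1; rewrite -fg //; exact: fa. Qed.

Lemma has_psD f g a b : has_ps f a -> has_ps g b ->
  has_ps (fun z => f z + g z) (fun k => a k + b k).
Proof.
by move=> fa gb z z1; apply: csum_eq (csumD (fa z z1) (gb z z1)) => k; rewrite mulrDl.
Qed.

Lemma has_psZ f a c : has_ps f a -> has_ps (fun z => c * f z) (fun k => c * a k).
Proof.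
by move=> fa z z1; apply: csum_eq (csumZ c (fa z z1)) => k; rewrite mulrA.
Qed.

Lemma has_ps_cst c : has_ps (fun=> c) (fun k => if k == 0%N then c else 0).
Proof.
move=> z _ e e0; exists 1%N => -[//|N] _; rewrite big_ord_recl /= expr0 mulr1.
by rewrite big1 ?addr0 ?subrr ?normc0 ?ltW // => i _; rewrite mul0r.
Qed.

End PowerSeries.

(** * Holomorphic functions are power series *)

Section Paths.
Variable R : realType.
Local Notation C := R[i].
Local Notation re := (@complex.Re R).
Local Notation im := (@complex.Im R).
Implicit Types (phi psi Phi Psi : R -> C) (x y : R).

Lemma re_sub (z w : C) : re (z - w) = re z - re w.
Proof. by case: z => a b; case: w. Qed.
Lemma im_sub (z w : C) : im (z - w) = im z - im w.
Proof. by case: z => a b; case: w. Qed.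
Lemma re_mulr (z : C) x : re (z * x%:C%C) = re z * x.
Proof. by case: z => a b /=; rewrite mulr0 subr0. Qed.
Lemma im_mulr (z : C) x : im (z * x%:C%C) = im z * x.
Proof. by case: z => a b /=; rewrite mulr0 add0r. Qed.

Lemma real_is_deriveP (f : R -> R) x l : is_derive x 1 f l <->
  forall e : R, 0 < e -> exists2 d : R, 0 < d &
    forall h, `|h| < d -> `|f (x + h) - f x - l * h| <= e * `|h|.
Proof.
have key (h : R) : h != 0 -> f (x + h) - f x - l * h =
    (h^-1 *: (f (h *: (1 : R) + x) - f x) - l) * h.
  move=> h0; rewrite mulrBl /GRing.scale /= mulr1 (addrC h) mulrAC mulVf //.
  by rewrite mul1r.
have aux : (forall e : R, 0 < e -> exists2 d : R, 0 < d &
    forall h, `|h| < d -> `|f (x + h) - f x - l * h| <= e * `|h|) <->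
   (fun h : R => h^-1 *: (f (h *: (1 : R) + x) - f x)) @ (0 : R)^' --> l.
  split=> [fl|fl].
  - apply/cvgrPdist_le => /= e e0.
    have [d d0 fd] := fl _ e0; exists d => //= h /=; rewrite sub0r normrN => hd h0.
    have := fd h hd; rewrite key // normrM ler_pM2r ?normr_gt0 // => fh.
    by rewrite distrC.
  - move=> e e0; move/cvgrPdist_le: fl => /(_ e e0)[/= d d0 fd].
    exists d => // h hx.
    have [->|h0] := eqVneq h 0; first by rewrite addr0 mulr0 subr0 subrr normr0 mulr0.
    have := fd h; rewrite /= sub0r normrN => /(_ hx h0).
    by rewrite key // normrM ler_pM2r ?normr_gt0 // distrC.
split => [[dv dl]|/aux fl].
  by apply/aux; rewrite -dl; exact: dv.
apply: DeriveDef; first by apply/cvg_ex; exists l.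
exact: cvg_lim fl.
Qed.

Definition rderiv Phi x (l : C) := forall e : R, 0 < e -> exists2 d : R, 0 < d &
  forall h : R, `|h| < d -> normc (Phi (x + h) - Phi x - l * h%:C%C) <= e * `|h|.

Lemma rderivP Phi x l : rderiv Phi x l <->
  is_derive x 1 (fun t => re (Phi t)) (re l) /\ is_derive x 1 (fun t => im (Phi t)) (im l).
Proof.
split=> [Pl|[/real_is_deriveP rl /real_is_deriveP il]].
- split; apply/real_is_deriveP => e e0; have [d d0 hd] := Pl e e0; exists d => // h hh.
  + by rewrite (le_trans _ (hd h hh)) // -re_mulr -!re_sub normc_Re.
  + by rewrite (le_trans _ (hd h hh)) // -im_mulr -!im_sub normc_Im.
- move=> e e0; have e2 : 0 < e / 2 by lra.
  have [d1 d10 h1] := rl _ e2; have [d2 d20 h2] := il _ e2.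
  exists (Num.min d1 d2); first by rewrite lt_min d10.
  move=> h; rewrite lt_min => /andP[/h1 a /h2 b].
  rewrite (le_trans (normc_le _)) // !re_sub !im_sub re_mulr im_mulr.
  by rewrite (splitr e) mulrDl lerD.
Qed.

Lemma rderiv_cst c x : rderiv (fun=> c) x 0.
Proof.
by move=> e e0; exists 1 => // h _; rewrite mul0r subr0 subrr normc0 mulr_ge0 // ltW.
Qed.

Lemma rderivD Phi Psi x l m : rderiv Phi x l -> rderiv Psi x m ->
  rderiv (fun t => Phi t + Psi t) x (l + m).
Proof.
move=> hl hm e e0; have e2 : 0 < e / 2 by lra.
have [d1 d10 h1] := hl _ e2; have [d2 d20 h2] := hm _ e2.
exists (Num.min d1 d2); first by rewrite lt_min d10.
move=> h; rewrite lt_min => /andP[/h1 a /h2 b].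
have -> : Phi (x + h) + Psi (x + h) - (Phi x + Psi x) - (l + m) * h%:C%C =
  (Phi (x + h) - Phi x - l * h%:C%C) + (Psi (x + h) - Psi x - m * h%:C%C) by ring.
by rewrite (le_trans (normcD _ _)) // (splitr e) mulrDl lerD.
Qed.

Lemma rderivZ c Phi x l : rderiv Phi x l -> rderiv (fun t => c * Phi t) x (c * l).
Proof.
move=> hl e e0; have c1 : 0 < normc c + 1 by rewrite ltr_wpDl.
have [d d0 hd] := hl (e / (normc c + 1)) ltac:(by rewrite divr_gt0).
exists d => // h hh; rewrite -mulrA -!mulrBr normcM.
rewrite (le_trans (ler_wpM2l _ (hd h hh))) // mulrA ler_wpM2r //.
by rewrite mulrCA ger_pMr // ler_pdivrMr // mul1r lerDl.
Qed.

Lemma rderivB Phi Psi x l m : rderiv Phi x l -> rderiv Psi x m ->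
  rderiv (fun t => Phi t - Psi t) x (l - m).
Proof.
move=> hl /(rderivZ (-1)) hm; have := rderivD hl hm; rewrite mulN1r.
by congr (rderiv _ _ _); apply/funext => t; rewrite mulN1r.
Qed.

Lemma rderiv_lip Phi x l : rderiv Phi x l -> exists2 d : R, 0 < d &
  forall h : R, `|h| < d -> normc (Phi (x + h) - Phi x) <= (normc l + 1) * `|h|.
Proof.
move=> hl; have [d d0 hd] := hl 1 ltr01; exists d => // h hh.
rewrite -(subrK (l * h%:C%C) (Phi _ - _)) (le_trans (normcD _ _)) // mulrDl addrC.
by rewrite lerD ?hd // normcM normc_real.
Qed.

Lemma rderiv_comp (f : C -> C) Phi x l m : cderiv f (Phi x) l -> rderiv Phi x m ->
  rderiv (fun t => f (Phi t)) x (l * m).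
Proof.
move=> fl hm e e0.
have [d1 d10 h1] := rderiv_lip hm.
have m1 : 0 < normc m + 1 by rewrite ltr_wpDl.
have l1 : 0 < normc l + 1 by rewrite ltr_wpDl.
have [d2 d20 h2] := fl (e / 2 / (normc m + 1)) ltac:(by rewrite !divr_gt0).
have [d3 d30 h3] := hm (e / 2 / (normc l + 1)) ltac:(by rewrite !divr_gt0).
exists (Num.min d1 (Num.min d3 (d2 / (normc m + 1)))).
  by rewrite !lt_min d10 d30 divr_gt0.
move=> h; rewrite !lt_min => /andP[hd1 /andP[hd3]]; rewrite ltr_pdivlMr // => hd2.
set k := Phi (x + h) - Phi x.
have kd : normc k <= (normc m + 1) * `|h| by exact: h1.
have := h2 k ltac:(by rewrite (le_lt_trans kd) // mulrC).
rewrite [Phi x + k](_ : _ = Phi (x + h)) => [H2|]; last by rewrite /k addrC subrK.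
have := h3 h hd3; rewrite -/k => H3.
have -> : f (Phi (x + h)) - f (Phi x) - l * m * h%:C%C =
  (f (Phi (x + h)) - f (Phi x) - l * k) + l * (k - m * h%:C%C) by ring.
rewrite (le_trans (normcD _ _)) // (splitr e) mulrDl lerD //.
  apply: (le_trans H2); apply: (le_trans (ler_wpM2l _ kd)).
    by rewrite !divr_ge0 // ltW.
  rewrite [leLHS](_ : _ = e / 2 * `|h|) //.
  by field; rewrite gt_eqF.
rewrite normcM (le_trans (ler_wpM2l _ H3)) // mulrA ler_wpM2r //.
by rewrite mulrCA ger_pMr ?divr_gt0 // ler_pdivrMr // mul1r lerDl.
Qed.

Definition ccont phi x := forall e : R, 0 < e -> exists2 d : R, 0 < d &
  forall y, `|y - x| < d -> normc (phi y - phi x) < e.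

(** The mean value theorem is applied to the real and the imaginary part separately, whence the
    factor 2. *)
Lemma mean_value_bound Phi phi (a b M : R) : a <= b ->
  (forall x, a <= x <= b -> rderiv Phi x (phi x)) ->
  (forall x, a <= x <= b -> normc (phi x) <= M) ->
  normc (Phi b - Phi a) <= 2 * M * (b - a).
Proof.
move=> ab hP hM.
have aux (f df : R -> R) : (forall x, a <= x <= b -> is_derive x 1 f (df x)) ->
    (forall x, a <= x <= b -> `|df x| <= M) -> `|f b - f a| <= M * (b - a).
  move=> hf hdf; have [||c cab ->] := @MVT_segment _ f df a b ab.
    by move=> x; rewrite in_itv /= => /andP[/ltW ax /ltW xb]; apply: hf; rewrite ax.
    apply: derivable_within_continuous => x; rewrite in_itv /= => xab.
    by have [] := hf x xab.
  rewrite normrM (ger0_norm (x := b - a)) ?subr_ge0 // ler_wpM2r ?subr_ge0 //.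
  by apply: hdf; rewrite in_itv /= in cab.
rewrite (le_trans (normc_le _)) // re_sub im_sub -mulrA mulr_natl mulr2n lerD //.
- apply: (aux (fun x => re (Phi x)) (fun x => re (phi x))) => x xab; first by case/rderivP: (hP x xab).
  exact: le_trans (normc_Re _) (hM x xab).
- apply: (aux (fun x => im (Phi x)) (fun x => im (phi x))) => x xab; first by case/rderivP: (hP x xab).
  exact: le_trans (normc_Im _) (hM x xab).
Qed.

Lemma real_antiderivative (f : R -> R) : continuous f ->
  exists F : R -> R, forall x, 0 <= x <= 1 -> is_derive x 1 F (f x).
Proof.
(* The integral starts at -1 and the fundamental theorem is used up to 2, which makes 0 and 1
   interior points with two-sided derivatives. *)
move=> cf; exists (fun x => \int[@lebesgue_measure R]_(t in `[-1, x]) f t)%R => x /andP[x0 x1].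
have [] := @continuous_FTC1_closed R f (-1) x 2.
- by rewrite (le_lt_trans x1) // ltr1n.
- apply: continuous_compact_integrable; first exact: segment_compact.
  exact: continuous_subspaceT.
- by rewrite (lt_le_trans _ x0) // ltrN10.
- exact: cf.
by move=> dF Fx; apply: DeriveDef => //; rewrite -derive1E.
Qed.

Lemma antiderivative phi : (forall x, ccont phi x) ->
  exists Phi, forall x, 0 <= x <= 1 -> rderiv Phi x (phi x).
Proof.
move=> cp.
have [|F hF] := @real_antiderivative (fun x => re (phi x)).
  move=> x; apply/cvgrPdist_lt => e e0; have [d d0 hd] := cp x e e0.
  exists d => //= y /=; rewrite distrC => /hd; rewrite -re_sub; apply: le_lt_trans.
  by rewrite !re_sub distrC -re_sub normc_Re.
have [|G hG] := @real_antiderivative (fun x => im (phi x)).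
  move=> x; apply/cvgrPdist_lt => e e0; have [d d0 hd] := cp x e e0.
  exists d => //= y /=; rewrite distrC => /hd; rewrite -im_sub; apply: le_lt_trans.
  by rewrite !im_sub distrC -im_sub normc_Im.
exists (fun x => Complex (F x) (G x)) => x x01; apply/rderivP; split; first exact: hF.
exact: hG.
Qed.

End Paths.

(** * Goursat's theorem on a parametrised square *)

Section Goursat.
Variable R : realType.
Local Notation C := R[i].
Implicit Types (x y s : R).

Lemma nested_corner (x s : nat -> R) : (forall n, 0 <= s n) ->
  (forall n, x n <= x n.+1) -> (forall n, x n.+1 + s n.+1 <= x n + s n) ->
  exists c, forall n, x n <= c <= x n + s n.
Proof.
move=> s0 xm sm.
have xle n m : (n <= m)%N -> x n <= x m.
  by move=> nm; apply: (homo_leq (@lexx _ R) (@le_trans _ R) xm).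
have sle n m : (n <= m)%N -> x m + s m <= x n + s n.
  move=> nm; apply: (homo_leq (f := fun k => x k + s k) (r := fun a b => b <= a)) nm => //.
  by move=> a b c ab /le_trans; apply.
have ub n m : x m <= x n + s n.
  have [mn|nm] := leqP m n; first by rewrite (le_trans (xle _ _ mn)) // lerDl.
  by rewrite (le_trans _ (sle _ _ (ltnW nm))) // lerDl.
exists (sup (range x)) => n; apply/andP; split.
  by apply: ub_le_sup; [exists (x 0%N + s 0%N) => _ [m _ <-]|exists n].
by apply: ge_sup; [exists (x 0%N), 0%N|move=> _ [m _ <-]].
Qed.

(** Goursat's bisection for an abstract additive function of squares: if |J| = c > 0 on the unit
    square, some quarter of each chosen square of side s keeps |J| >= c (s / 2)^2, and so on down to
    a point. *)
Lemma nested_squares (J : R -> R -> R -> C) :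
  (forall x y s, J x y s = J x y (s / 2) + J (x + s / 2) y (s / 2) +
     J x (y + s / 2) (s / 2) + J (x + s / 2) (y + s / 2) (s / 2)) ->
  (forall x0 y0 e, 0 < e -> 0 <= x0 <= 1 -> 0 <= y0 <= 1 -> exists2 d : R, 0 < d &
     forall x y s, 0 <= x <= x0 -> x0 <= x + s <= 1 -> 0 <= y <= y0 -> y0 <= y + s <= 1 ->
       0 < s < d -> normc (J x y s) <= e * s ^+ 2) ->
  J 0 0 1 = 0.
Proof.
move=> Jadd Jloc; apply/eqP; rewrite -normc_eq0; apply/eqP.
set c := normc _; have : 0 <= c by exact: normc_ge0.
rewrite le_eqVlt => /orP[/eqP <-//|c0]; exfalso.
pose P (p : R * R * R) := c * p.2 ^+ 2 <= normc (J p.1.1 p.1.2 p.2).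
(* The hypotheses on [p] stand under the existential so that [choice] yields a total map; (0, 0, 0)
   is a dummy for the vacuous cases. *)
have step (p : R * R * R) : exists q : R * R * R, 0 <= p.2 -> P p ->
    [/\ P q, q.2 = p.2 / 2, p.1.1 <= q.1.1 <= p.1.1 + p.2 / 2 &
      p.1.2 <= q.1.2 <= p.1.2 + p.2 / 2].
  case: p => -[x y] s /=; rewrite /P /=.
  have [s0|s0] := leP 0 s; last by exists (0, 0, 0) => s0'; lra.
  set h := s / 2; have h0 : 0 <= h by rewrite /h; lra.
  have sh : s = h + h by rewrite /h; lra.
  have [n1|n1] := leP (c * h ^+ 2) (normc (J x y h)).
    by exists (x, y, h) => /= _ _; rewrite !lexx !lerDl h0.
  have [n2|n2] := leP (c * h ^+ 2) (normc (J (x + h) y h)).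
    by exists (x + h, y, h) => /= _ _; rewrite !lexx !lerDl h0.
  have [n3|n3] := leP (c * h ^+ 2) (normc (J x (y + h) h)).
    by exists (x, y + h, h) => /= _ _; rewrite !lexx !lerDl h0.
  have [n4|n4] := leP (c * h ^+ 2) (normc (J (x + h) (y + h) h)).
    by exists (x + h, y + h, h) => /= _ _; rewrite !lexx !lerDl h0.
  exists (0, 0, 0) => _ H; exfalso; move: H; apply/negP; rewrite -ltNge Jadd -/h.
  apply: (le_lt_trans (normcD _ _)); rewrite (_ : c * s ^+ 2 =
     c * h ^+ 2 + c * h ^+ 2 + c * h ^+ 2 + c * h ^+ 2); last by rewrite sh; ring.
  apply: ltrD => //; apply: (le_lt_trans (normcD _ _)); apply: ltrD => //.
  by apply: (le_lt_trans (normcD _ _)); apply: ltrD.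
have [F hF] := choice step.
pose S n := iter n F (0, 0, 1); pose s n : R := (S n).2.
pose x n : R := (S n).1.1; pose y n : R := (S n).1.2.
have SS n : S n.+1 = F (S n) by [].
have inv n : 0 < s n /\ P (S n).
  elim: n => [|n [s0 Pn]]; first by rewrite /s /P /= expr1n mulr1.
  by have [? e _ _] := hF (S n) (ltW s0) Pn; rewrite /s SS e divr_gt0.
have sS n : s n.+1 = s n / 2 by have [s0 Pn] := inv n; have [_ ? _ _] := hF (S n) (ltW s0) Pn.
have s0 n : 0 <= s n by have [/ltW] := inv n.
have xS n : x n <= x n.+1 <= x n + s n / 2.
  by have [_ Pn] := inv n; have [_ _ ? _] := hF (S n) (s0 n) Pn.
have yS n : y n <= y n.+1 <= y n + s n / 2.
  by have [_ Pn] := inv n; have [_ _ _ ?] := hF (S n) (s0 n) Pn.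
have [x0 hx0] : exists c, forall n, x n <= c <= x n + s n.
  apply: nested_corner => // n; first by case/andP: (xS n).
  by rewrite sS; have := xS n; lra.
have [y0 hy0] : exists c, forall n, y n <= c <= y n + s n.
  apply: nested_corner => // n; first by case/andP: (yS n).
  by rewrite sS; have := yS n; lra.
have xb n : 0 <= x n /\ x n + s n <= 1.
  elim: n => [|n [IH1 IH2]]; first by rewrite /x /s /=; lra.
  by rewrite sS; have := xS n; lra.
have yb n : 0 <= y n /\ y n + s n <= 1.
  elim: n => [|n [IH1 IH2]]; first by rewrite /y /s /=; lra.
  by rewrite sS; have := yS n; lra.
have x01 : 0 <= x0 <= 1 by have := hx0 0%N; rewrite /x /s /=; lra.
have y01 : 0 <= y0 <= 1 by have := hy0 0%N; rewrite /y /s /=; lra.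
(* Around the limit point the local bound with c / 2 contradicts |J| >= c s^2. *)
have [d d0 hd] := Jloc x0 y0 (c / 2) ltac:(lra) x01 y01.
have sE n : s n = 2^-1 ^+ n.
  by elim: n => [|n IH]; [rewrite expr0|rewrite sS IH exprSr].
have [n sd] : exists n, s n < d.
  have := @cvg_expr R 2^-1; rewrite ger0_norm ?invr_ge0 // => /(_ ltac:(lra)).
  move=> /cvgrPdist_lt /(_ _ d0)[n _ hn]; exists n; have := hn n (leqnn n).
  by rewrite /= sub0r normrN ger0_norm -?sE.
have [sn Pn] := inv n.
have := hd (x n) (y n) (s n); have [? ?] := xb n; have [? ?] := yb n.
have /andP[a b] := hx0 n; have /andP[a' b'] := hy0 n.
move=> H; have {H} := H ltac:(by apply/andP) ltac:(by apply/andP) ltac:(by apply/andP)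
  ltac:(by apply/andP) ltac:(by apply/andP).
move: Pn; rewrite /P -/(x n) -/(y n) -/(s n) => /le_trans H /H.
have : 0 < c * s n ^+ 2 by rewrite mulr_gt0 // exprn_gt0.
lra.
Qed.

(* Cauchy's theorem on the image under [P] of the unit square: [X] and [Y] are antiderivatives of the
   pulled-back form along horizontal and vertical segments, so their increments are the contour
   integrals along the sides. *)
Lemma goursat_square (P Px Py : R -> R -> C) (G : C -> C) (X Y : R -> R -> C) (B : R) :
  0 < B ->
  (forall x y, rderiv (fun t => P t y) x (Px x y)) ->
  (forall x y, rderiv (fun t => P x t) y (Py x y)) ->
  (forall x y, 0 <= x <= 1 -> 0 <= y <= 1 -> normc (Px x y) <= B) ->
  (forall x y, 0 <= x <= 1 -> 0 <= y <= 1 -> normc (Py x y) <= B) ->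
  (forall x y, 0 <= x <= 1 -> 0 <= y <= 1 -> exists m, cderiv G (P x y) m) ->
  (forall x y, 0 <= x <= 1 -> 0 <= y <= 1 -> rderiv (X y) x (G (P x y) * Px x y)) ->
  (forall x y, 0 <= x <= 1 -> 0 <= y <= 1 -> rderiv (Y x) y (G (P x y) * Py x y)) ->
  (X 0 1 - X 0 0) + (Y 1 1 - Y 1 0) - (X 1 1 - X 1 0) - (Y 0 1 - Y 0 0) = 0.
Proof.
move=> B0 hPx hPy bPx bPy hG hX hY.
pose J x y s := (X y (x + s) - X y x) + (Y (x + s) (y + s) - Y (x + s) y)
  - (X (y + s) (x + s) - X (y + s) x) - (Y x (y + s) - Y x y).
suff: J 0 0 1 = 0 by rewrite /J !add0r.
apply: nested_squares => [x y s|x0 y0 e e0 x01 y01].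
  rewrite /J; have -> : s = s / 2 + s / 2 by lra.
  by rewrite [(s / 2 + s / 2) / 2](_ : _ = s / 2) ?addrA; [ring|lra].
have [m hm] := hG _ _ x01 y01; set w0 := P x0 y0 in hm.
(* A primitive of the affine approximation of [G] at [w0]. Its increments cancel around the closed
   contour, so subtracting them leaves only the integral of the first-order remainder of [G]. *)
pose L w : C := G w0 * w + m / 2 * (w - w0) ^+ 2.
have hL w : cderiv L w (G w0 + m * (w - w0)).
  have c1 : 0 < normc (m / 2) + 1 by have := normc_ge0 (m / 2); lra.
  move=> e1 e10; exists (e1 / (normc (m / 2) + 1)); first by rewrite divr_gt0.
  move=> h; rewrite ltr_pdivlMr // => he.
  have -> : L (w + h) - L w - (G w0 + m * (w - w0)) * h = m / 2 * h ^+ 2.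
    by rewrite /L; field.
  rewrite normcM normcX; move: (normc_ge0 h) (normc_ge0 (m / 2)) he.
  move: (normc h) (normc (m / 2)) => a b a0 b0 he.
  by rewrite expr2 mulrA ler_wpM2r //; nra.
(* On each side the remainder is at most e' 4 B s, the speed at most B, and the mean value bound
   costs 2: this makes 8 e' B^2 s^2 = (e / 4) s^2 per side. *)
have B2 : 0 < 32 * B ^+ 2 by rewrite mulr_gt0 // exprn_gt0.
pose e' := e / (32 * B ^+ 2); have e'0 : 0 < e' by rewrite divr_gt0.
have [d d0 hd] := hm _ e'0.
exists (d / (4 * B)); first by rewrite divr_gt0 // mulr_gt0.
move=> x y s /andP[x_0 xx0] /andP[x0s xs1] /andP[y_0 yy0] /andP[y0s ys1] /andP[s0].
rewrite ltr_pdivlMr ?mulr_gt0 // => sd.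
have mv (Phi phi : R -> C) (M : R) a b : 0 <= M -> 0 <= a <= 1 -> 0 <= b <= 1 ->
    (forall x, 0 <= x <= 1 -> rderiv Phi x (phi x)) ->
    (forall x, 0 <= x <= 1 -> normc (phi x) <= M) ->
    normc (Phi b - Phi a) <= 2 * M * `|b - a|.
  move=> M0 a01 b01 h1 h2; wlog ab : a b a01 b01 / a <= b.
    move=> H; have [ab|/ltW ba] := leP a b; first exact: H.
    by rewrite normcB distrC; exact: H.
  rewrite ger0_norm ?subr_ge0 //; apply: (mean_value_bound (phi := phi)) => // t tab.
    by apply: h1; lra.
  by apply: h2; lra.
have near u v : x <= u <= x + s -> y <= v <= y + s ->
    normc (G (P u v) - G w0 - m * (P u v - w0)) <= e' * (4 * B * s).
  move=> us vs; have u01 : 0 <= u <= 1 by lra.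
  have v01 : 0 <= v <= 1 by lra.
  have H : normc (P u v - w0) <= 4 * B * s.
    have -> : P u v - w0 = (P u v - P x0 v) + (P x0 v - P x0 y0) by rewrite /w0; ring.
    have H1 := mv (fun t => P t v) (fun t => Px t v) B x0 u (ltW B0) x01 u01
      (fun t _ => hPx t v) (fun t h => bPx t v h v01).
    have H2 := mv (fun t => P x0 t) (fun t => Py x0 t) B y0 v (ltW B0) y01 v01
      (fun t _ => hPy x0 t) (fun t h => bPy x0 t x01 h).
    rewrite (le_trans (normcD _ _)) // (_ : 4 * B * s = 2 * B * s + 2 * B * s); last by ring.
    have B2' : 0 <= 2 * B by lra.
    apply: lerD.
      by apply: (le_trans H1); apply: ler_wpM2l => //; rewrite ler_norml; lra.
    by apply: (le_trans H2); apply: ler_wpM2l => //; rewrite ler_norml; lra.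
  have := hd (P u v - w0); rewrite (addrC w0) subrK => hd'.
  apply: (le_trans (hd' _)); first by rewrite (le_lt_trans H) // mulrC.
  by rewrite ler_wpM2l // ltW.
have side (Phi : R -> C) (p : R -> C) (p' : R -> C) a :
    0 <= a -> a + s <= 1 ->
    (forall t, a <= t <= a + s -> rderiv Phi t (G (p t) * p' t)) ->
    (forall t, rderiv p t (p' t)) ->
    (forall t, a <= t <= a + s -> normc (p' t) <= B) ->
    (forall t, a <= t <= a + s -> normc (G (p t) - G w0 - m * (p t - w0)) <= e' * (4 * B * s)) ->
    normc ((Phi (a + s) - L (p (a + s))) - (Phi a - L (p a))) <= e / 4 * s ^+ 2.
  move=> a0 as1 h1 h2 h3 h4.
  have -> : e / 4 * s ^+ 2 = 2 * (e' * (4 * B * s) * B) * (a + s - a).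
    by rewrite /e'; field; rewrite gt_eqF.
  apply: (mean_value_bound (Phi := fun t => Phi t - L (p t))
    (phi := fun t => (G (p t) - G w0 - m * (p t - w0)) * p' t)).
  - by rewrite lerDl ltW.
  - move=> t tas; have := rderivB (h1 t tas) (rderiv_comp (hL (p t)) (h2 t)).
    by congr rderiv; ring.
  - by move=> t tas; rewrite normcM ler_pM // ?h3 ?h4.
have -> : J x y s =
  ((X y (x + s) - L (P (x + s) y)) - (X y x - L (P x y))) +
  ((Y (x + s) (y + s) - L (P (x + s) (y + s))) - (Y (x + s) y - L (P (x + s) y))) -
  ((X (y + s) (x + s) - L (P (x + s) (y + s))) - (X (y + s) x - L (P x (y + s)))) -
  ((Y x (y + s) - L (P x (y + s))) - (Y x y - L (P x y))) by rewrite /J; ring.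
rewrite (_ : e * s ^+ 2 = e / 4 * s ^+ 2 + e / 4 * s ^+ 2 + e / 4 * s ^+ 2 + e / 4 * s ^+ 2); last by field.
apply: (le_trans (normcD _ _)); rewrite normcN; apply: lerD; last first.
  apply: (side (Y x) (fun t => P x t) (fun t => Py x t)) => // t ty.
  - by apply: hY; lra.
  - by apply: bPy; lra.
  - by apply: near; lra.
apply: (le_trans (normcD _ _)); rewrite normcN; apply: lerD; last first.
  apply: (side (X (y + s)) (fun t => P t (y + s)) (fun t => Px t (y + s))) => // t ty.
  - by apply: hX; lra.
  - by apply: bPx; lra.
  - by apply: near; lra.
apply: (le_trans (normcD _ _)); apply: lerD.
  apply: (side (X y) (fun t => P t y) (fun t => Px t y)) => // t ty.
  - by apply: hX; lra.
  - by apply: bPx; lra.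
  - by apply: near; lra.
apply: (side (Y (x + s)) (fun t => P (x + s) t) (fun t => Py (x + s) t)) => // t ty.
- by apply: hY; lra.
- by apply: bPy; lra.
- by apply: near; lra.
Qed.

End Goursat.

(** * Integrals over [0, 1] and the parametrised circle *)

Section Cauchy.
Variable R : realType.
Local Notation C := R[i].
Implicit Types (x y s : R) (f g : C -> C) (z w : C).

Lemma cderivX n z : cderiv (fun w : C => w ^+ n) z (n%:R * z ^+ n.-1).
Proof.
apply/cderivP; have := @is_deriveX _ _ (fun w : C^o => w) n (z : C^o) 1 1 (is_derive_id _ _).
rewrite /GRing.scale /= mulr1; congr (is_derive _ _ _ _).
by apply/funext => w; rewrite exprfctE.
Qed.

Definition cdiff f z := exists l, cderiv f z l.

Lemma cdiffP f z : cdiff f z <-> derivable (f : C^o -> C^o) z 1.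
Proof.
split=> [[l]|df]; first exact: cderiv_derivable.
by exists (derive1 (f : C^o -> C^o) z); exact: derivable_cderiv.
Qed.

Lemma cdiffM f g z : cdiff f z -> cdiff g z -> cdiff (fun w => f w * g w) z.
Proof.
move=> /cdiffP df /cdiffP dg; apply/cdiffP.
have := @derivableM C C^o (f : C^o -> C) (g : C^o -> C) (z : C^o) 1 df dg; rewrite mulrfctE; exact.
Qed.

Lemma cdiffB f g z : cdiff f z -> cdiff g z -> cdiff (fun w => f w - g w) z.
Proof.
move=> /cdiffP df /cdiffP dg; apply/cdiffP.
by have := @derivableB _ _ _ (f : C^o -> C^o) (g : C^o -> C^o) (z : C^o) 1 df dg; rewrite addrfctE opprfctE.
Qed.

Lemma cdiffV f z : f z != 0 -> cdiff f z -> cdiff (fun w => (f w)^-1) z.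
Proof.
move=> f0 /cdiffP df; apply/cdiffP.
exact: (@derivableV _ _ (f : C^o -> C) (z : C^o) 1 f0 df).
Qed.

Lemma cdiff_cst c z : cdiff (fun=> c) z.
Proof. by apply/cdiffP; exact: derivable_cst. Qed.

Lemma cdiff_id z : cdiff id z.
Proof. by apply/cdiffP; exact: derivable_id. Qed.

Lemma rderiv_ccont (phi : R -> C) x l : rderiv phi x l -> ccont phi x.
Proof.
move=> /rderiv_lip[d d0 hd] e e0; have l1 : 0 < normc l + 1 by rewrite ltr_wpDl.
exists (Num.min d (e / (normc l + 1))); first by rewrite lt_min d0 divr_gt0.
move=> y; rewrite lt_min => /andP[/hd]; rewrite (addrC x) subrK => h.
by rewrite ltr_pdivlMr // mulrC; exact: le_lt_trans.
Qed.

Lemma ccont_comp f (phi : R -> C) x : cdiff f (phi x) -> ccont phi x ->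
  ccont (fun t => f (phi t)) x.
Proof.
move=> [l /cderiv_continuous hf] hp e e0; have [d d0 hd] := hf e e0.
have [d' d'0 hd'] := hp d d0; exists d' => // y /hd'; exact: hd.
Qed.

Lemma ccontM (phi psi : R -> C) x : ccont phi x -> ccont psi x ->
  ccont (fun t => phi t * psi t) x.
Proof.
move=> hp hq e e0; have p1 : 0 < normc (phi x) + 1 by rewrite ltr_wpDl.
have q1 : 0 < normc (psi x) + 1 by rewrite ltr_wpDl.
pose e1 := Num.min 1 (e / 2 / (normc (psi x) + 1)).
have e10 : 0 < e1 by rewrite lt_min ltr01 !divr_gt0.
have [d d0 hd] := hp _ e10.
have [d' d'0 hd'] := hq (e / 2 / (normc (phi x) + 1)) ltac:(by rewrite !divr_gt0).
exists (Num.min d d'); first by rewrite lt_min d0.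
move=> y; rewrite lt_min => /andP[/hd a /hd' b].
have -> : phi y * psi y - phi x * psi x =
  (phi y - phi x) * psi x + phi y * (psi y - psi x) by ring.
move: a; rewrite lt_min => /andP[a1 a2].
rewrite (le_lt_trans (normcD _ _)) // (splitr e) !normcM ltr_leD //.
- move: a2; rewrite ltr_pdivlMr // => a2; apply: le_lt_trans a2.
  by have := normc_ge0 (phi y - phi x); lra.
- have : normc (phi y) <= normc (phi x) + 1.
    by rewrite -(subrK (phi x) (phi y)) (le_trans (normcD _ _)) // addrC lerD2l ltW.
  move=> a3; apply: le_trans (ler_pM _ _ a3 (ltW b)) _ => //.
  by rewrite mulrC divfK // gt_eqF.
Qed.

(* Integration over [0, 1], encoded by the increment of an antiderivative. *)
Definition isint (phi : R -> C) l := exists2 Phi : R -> C,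
  forall y, 0 <= y <= 1 -> rderiv Phi y (phi y) & l = Phi 1 - Phi 0.

Lemma isint_ex phi : (forall y, ccont phi y) -> exists l, isint phi l.
Proof. by move=> /antiderivative[Phi hPhi]; exists (Phi 1 - Phi 0), Phi. Qed.

Lemma isint_eq phi psi l : (forall y, 0 <= y <= 1 -> phi y = psi y) ->
  isint phi l -> isint psi l.
Proof. by move=> e [Phi h ->]; exists Phi => // y yb; rewrite -e //; exact: h. Qed.

Lemma isintD phi psi l m : isint phi l -> isint psi m ->
  isint (fun y => phi y + psi y) (l + m).
Proof.
move=> [Phi h ->] [Psi k ->]; exists (fun y => Phi y + Psi y); last by ring.
by move=> y yb; apply: rderivD; [exact: h|exact: k].
Qed.

Lemma isintZ c phi l : isint phi l -> isint (fun y => c * phi y) (c * l).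
Proof.
move=> [Phi h ->]; exists (fun y => c * Phi y); last by ring.
by move=> y yb; apply: rderivZ; exact: h.
Qed.

Lemma isintB phi psi l m : isint phi l -> isint psi m ->
  isint (fun y => phi y - psi y) (l - m).
Proof.
move=> hl hm; have := isintD hl (isintZ (-1) hm).
by rewrite mulN1r; apply: isint_eq => y _; rewrite mulN1r.
Qed.

Lemma isint_sum (phi : nat -> R -> C) (l : nat -> C) N : (forall k, isint (phi k) (l k)) ->
  isint (fun y => \sum_(k < N) phi k y) (\sum_(k < N) l k).
Proof.
move=> h; elim: N => [|N IH].
  exists (fun=> 0); last by rewrite big_ord0 subrr.
  by move=> y _; rewrite big_ord0; exact: rderiv_cst.
rewrite big_ord_recr /=; apply: isint_eq (isintD IH (h N)) => y _.
by rewrite big_ord_recr.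
Qed.

Lemma isint_bound phi l M : isint phi l -> (forall y, 0 <= y <= 1 -> normc (phi y) <= M) ->
  normc l <= 2 * M.
Proof.
by move=> [Phi h ->] hM; rewrite (le_trans (mean_value_bound _ h hM)) // subr0 mulr1.
Qed.

Lemma isint_uniq phi l m : isint phi l -> isint phi m -> l = m.
Proof.
move=> hl hm; apply/eqP; rewrite -subr_eq0 -normc_eq0 eq_le normc_ge0 andbT.
have := isint_bound (M := 0) (isintB hl hm); rewrite mulr0; apply => y _.
by rewrite subrr normc0.
Qed.

(* e^(2 i pi y), so that [0, 1] parametrises the circle. *)
Definition cis y : C := Complex (cos (pi *+ 2 * y)) (sin (pi *+ 2 * y)).
Definition twopii : C := Complex 0 (pi *+ 2).

Lemma cis0 : cis 0 = 1.
Proof. by rewrite /cis mulr0 cos0 sin0. Qed.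

Lemma cis1 : cis 1 = 1.
Proof. by rewrite /cis mulr1 cos2pi sin2pi. Qed.

Lemma normc_cis y : normc (cis y) = 1.
Proof. by rewrite /cis /normc cos2Dsin2 sqrtr1. Qed.

Lemma cisN y : cis y * cis (- y) = 1.
Proof.
apply/eqP; rewrite eq_complex /cis /= mulrN cosN sinN.
by rewrite mulrN opprK -!expr2 cos2Dsin2 eqxx mulrN (mulrC (cos _)) addNr eqxx.
Qed.

Lemma rderiv_cis y : rderiv cis y (twopii * cis y).
Proof.
apply/rderivP; rewrite /cis /=; split.
- rewrite mul0r sub0r; apply: is_derive_eq.
  by rewrite /GRing.scale /= mulr1 mulrC mulrN.
- rewrite mul0r add0r; apply: is_derive_eq.
  by rewrite /GRing.scale /= mulr1 mulrC.
Qed.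

Lemma rderiv_cisN y : rderiv (fun t => cis (- t)) y (- twopii * cis (- y)).
Proof.
apply/rderivP; rewrite /cis /=; split.
- apply: is_derive_eq.
  by rewrite /GRing.scale /= !mulrN !mulr1; ring.
- apply: is_derive_eq.
  by rewrite /GRing.scale /= !mulrN !mulr1; ring.
Qed.

Lemma rderiv_id y : rderiv (fun t => t%:C%C) y 1.
Proof.
move=> e e0; exists 1 => // h _.
rewrite (_ : _ - _ - _ = 0) ?normc0 ?mulr_ge0 ?(ltW e0) //.
by rewrite rmorphD; ring.
Qed.

Lemma twopii_neq0 : twopii != 0.
Proof.
by rewrite eq_complex /= negb_and (gt_eqF (x := pi *+ 2)) ?orbT // mulrn_wgt0 // pi_gt0.
Qed.

(** For a positive exponent the primitive is a multiple of the same power of [cis (- t)], which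
    takes equal values at 0 and 1. This computes the Taylor coefficients of the constant 1 in
    [cauchy_series]. *)
Lemma isint_cisX k : isint (fun y => cis (- y) ^+ k) (k == 0%N)%:R.
Proof.
case: k => [|k].
  exists (fun t => t%:C%C); last by rewrite subr0.
  by move=> y _; rewrite expr0; exact: rderiv_id.
pose c : C := - (k.+1%:R * twopii)^-1.
exists (fun t => c * cis (- t) ^+ k.+1).
  move=> y _; have := rderivZ c (rderiv_comp (cderivX k.+1 _) (rderiv_cisN y)).
  congr rderiv; rewrite /c /= exprS; field.
  by rewrite twopii_neq0 addrC natr1 pnatr_eq0.
have cN1 : cis (- 1) = 1 by have := cisN 1; rewrite cis1 mul1r.
by rewrite cN1 oppr0 cis0 subrr.
Qed.

End Cauchy.

Section CauchyFormula.
Variable R : realType.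
Local Notation C := R[i].
Implicit Types (x y s r : R) (f g : C -> C) (z w : C).

(** Clamping to [0, 1] is a contraction; it extends a path on [0, 1] continuously to the whole line,
    where [antiderivative] asks for continuity. *)
Lemma clamp_lip x y : `|Num.max 0 (Num.min y 1) - Num.max 0 (Num.min x 1)| <= `|y - x|.
Proof.
wlog xy : x y / x <= y.
  move=> H; have [xy|/ltW yx] := leP x y; first exact: H.
  by rewrite distrC [leRHS]distrC; exact: H.
rewrite [leRHS]ger0_norm ?subr_ge0 // ler_norml.
by case: (leP x 1) => ?; case: (leP y 1) => ?;
  repeat (match goal with |- context [Num.max 0 ?a] => case: (leP 0 a) => ? end); lra.
Qed.

Lemma clamp01 x : 0 <= Num.max 0 (Num.min x 1) <= 1.
Proof. by case: (leP x 1) => ?; [case: (leP 0 x) => ?|case: (leP 0 1) => ?]; lra. Qed.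

Lemma clamp_id x : 0 <= x <= 1 -> Num.max 0 (Num.min x 1) = x.
Proof. by case/andP => x0 x1; rewrite (min_idPl x1) (max_idPr x0). Qed.

Lemma ccont_clamp (phi : R -> C) : (forall x, 0 <= x <= 1 -> ccont phi x) ->
  forall x, ccont (fun t => phi (Num.max 0 (Num.min t 1))) x.
Proof.
move=> h x e e0; have [d d0 hd] := h _ (clamp01 x) e e0.
by exists d => // y yd; apply: hd; exact: le_lt_trans (clamp_lip _ _) yd.
Qed.

Lemma antiderivative01 (phi : R -> C) : (forall x, 0 <= x <= 1 -> ccont phi x) ->
  exists Phi, forall x, 0 <= x <= 1 -> rderiv Phi x (phi x).
Proof.
move=> /ccont_clamp/antiderivative[Phi h]; exists Phi => x x01.
by have := h x x01; rewrite clamp_id.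
Qed.

(* The map (t, y) |-> z + t (r cis y - z), for eps <= t <= 1, carries the circle of radius r to a small
   curve around z. *)
Lemma circle_shrink (G : C -> C) z r (eps M : R) l :
  normc z < r -> r < 1 -> 0 < eps < 1 ->
  (forall w, w != z -> normc w < 1 -> cdiff G w) ->
  isint (fun y => G (r%:C%C * cis y) * (r%:C%C * cis y)) l ->
  (forall w, 0 < normc (w - z) < eps * 2 -> normc (G w) <= M) ->
  normc l <= 2 * (M * eps).
Proof.
move=> zr r1 /andP[e0 e1] dG [Phi hPhi ->] GM.
have r0 : 0 < r by rewrite (le_lt_trans _ zr).
have nr : normc (r%:C%C : C) = r by rewrite normc_real gtr0_norm.
pose tau x : R := eps + (1 - eps) * x.
pose P x y : C := z + (tau x)%:C%C * (r%:C%C * cis y - z).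
pose Px x y : C := (1 - eps)%:C%C * (r%:C%C * cis y - z).
pose Py x y : C := (tau x)%:C%C * r%:C%C * twopii R * cis y.
have tau01 x : 0 <= x <= 1 -> eps <= tau x <= 1 by rewrite /tau; nra.
have hPx x y : rderiv (fun t => P t y) x (Px x y).
  have := rderivD (rderiv_cst (P 0 y) x) (rderivZ (Px x y) (rderiv_id x)).
  rewrite mulr1 add0r; congr rderiv; apply/funext => t.
  by rewrite /P /Px /tau mulr0 addr0 !rmorphD rmorphM /= rmorphB /=; ring.
have hPy x y : rderiv (fun t => P x t) y (Py x y).
  have := rderivD (rderiv_cst (z - (tau x)%:C%C * z) y)
    (rderivZ ((tau x)%:C%C * r%:C%C) (rderiv_cis y)).
  rewrite add0r /Py -!mulrA; congr rderiv; apply/funext => t.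
  by rewrite /P; ring.
have wz y : 0 < normc (r%:C%C * cis y - z).
  have := normcD (r%:C%C * cis y - z) z; rewrite subrK normcM normc_cis mulr1 nr.
  by move=> ?; lra.
have wz2 y : normc (r%:C%C * cis y - z) <= 2.
  by rewrite (le_trans (normcD _ _)) // normcN normcM normc_cis mulr1 nr; lra.
have PG x y : 0 <= x <= 1 -> cdiff G (P x y).
  move=> /tau01/andP[t0 t1]; apply: dG.
    rewrite -subr_eq0 /P addrC addKr mulf_neq0 // -normc_eq0.
      by rewrite normc_real normr_eq0 gt_eqF // (lt_le_trans e0).
    by rewrite gt_eqF.
  have -> : P x y = (1 - tau x)%:C%C * z + (tau x)%:C%C * (r%:C%C * cis y).
    by rewrite /P rmorphB; ring.
  rewrite (le_lt_trans (normcD _ _)) // !normcM normc_cis nr mulr1 !normc_real.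
  rewrite !ger0_norm ?subr_ge0 ?(le_trans (ltW e0)) //.
  by have := normc_ge0 z; nra.
have /choice[X hX] y : exists Phi, forall x, 0 <= x <= 1 -> rderiv Phi x (G (P x y) * Px x y).
  apply: (@antiderivative01 (fun x => G (P x y) * Px x y)) => x x01.
  apply: ccontM; last exact: rderiv_ccont (rderiv_cst _ _).
  by apply: (@ccont_comp _ G (fun t => P t y)); [exact: PG|exact: rderiv_ccont (hPx x y)].
have /choice[Y hY] x : exists Phi, 0 <= x <= 1 -> forall y, 0 <= y <= 1 ->
    rderiv Phi y (G (P x y) * Py x y).
  have [x01|x01] := pselect (0 <= x <= 1); last by exists (fun=> 0).
  have [F hF] : exists Phi, forall y, 0 <= y <= 1 -> rderiv Phi y (G (P x y) * Py x y).
    apply: (@antiderivative01 (fun y => G (P x y) * Py x y)) => y y01.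
    apply: ccontM.
      by apply: (@ccont_comp _ G (P x)); [exact: PG|exact: rderiv_ccont (hPy x y)].
    have := rderivZ ((tau x)%:C%C * r%:C%C * twopii R) (rderiv_cis y).
    exact: rderiv_ccont.
  by exists F.
pose k := normc (twopii R); have k0 : 0 <= k by exact: normc_ge0.
have e0' : 0 <= eps by exact: ltW.
(* The speed of [P] is at most 2 in x and at most k = |2 i pi| in y. *)
have := @goursat_square R P Px Py G X Y (2 + k) ltac:(lra) hPx hPy.
have z01 : 0 <= (0 : R) <= 1 by rewrite lexx ler01.
have o01 : 0 <= (1 : R) <= 1 by rewrite lexx ler01.
(* The sides y = 0 and y = 1 are the same segment because [cis] has period 1. The primitives [X 0]
   and [X 1] were chosen independently, so only their increments agree. *)
have X01 : X 0 1 - X 0 0 = X 1 1 - X 1 0.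
  apply/eqP; rewrite -subr_eq0 -normc_eq0 eq_le normc_ge0 andbT.
  have -> : X 0 1 - X 0 0 - (X 1 1 - X 1 0) = (X 0 1 - X 1 1) - (X 0 0 - X 1 0) by ring.
  have := @mean_value_bound R (fun t => X 0 t - X 1 t) (fun=> 0) 0 1 0 ler01.
  rewrite mulr0 mul0r; apply; last by move=> *; rewrite normc0.
  move=> x x01; have := rderivB (hX 0 x x01) (hX 1 x x01).
  by rewrite /P /Px cis0 cis1 subrr.
(* At x = 1 the curve is the circle itself, with velocity 2 i pi w at the point w. *)
have Y1 : Y 1 1 - Y 1 0 = twopii R * (Phi 1 - Phi 0).
  apply: (@isint_uniq R (fun y => G (P 1 y) * Py 1 y)); first by exists (Y 1) => //; exact: hY.
  have : isint (fun y => G (r%:C%C * cis y) * (r%:C%C * cis y)) (Phi 1 - Phi 0) by exists Phi.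
  move/(isintZ (twopii R)); apply: isint_eq => y _.
  have t1 : tau 1 = 1 by rewrite /tau; ring.
  by rewrite /P /Py t1 mul1r [z + _]addrC subrK; ring.
have Y0 : normc (Y 0 1 - Y 0 0) <= 2 * (M * (eps * k)).
  apply: (@isint_bound R (fun y => G (P 0 y) * Py 0 y)); first by exists (Y 0) => //; exact: hY.
  move=> y _; rewrite normcM; apply: ler_pM => //.
    apply: GM; rewrite /P /tau mulr0 addr0 addrC addKr normcM normc_real ger0_norm //.
    rewrite mulr_gt0 ?wz //=.
    have : normc (r%:C%C * cis y - z) < 2.
      by rewrite (le_lt_trans (normcD _ _)) // normcN normcM normc_cis mulr1 nr; lra.
    by rewrite ltr_pM2l.
  rewrite /Py /tau mulr0 addr0 !normcM normc_cis nr normc_real mulr1 ger0_norm // -mulrA.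
  by rewrite -/k; apply: ler_wpM2l => //; nra.
rewrite X01 => H.
have {H} : Y 1 1 - Y 1 0 = Y 0 1 - Y 0 0.
  apply/eqP; rewrite -subr_eq0; apply/eqP; rewrite -[RHS]H; first by ring.
  - move=> x y x01 y01; rewrite /Px normcM normc_real ger0_norm ?subr_ge0 ?ltW //.
    by have := wz2 y; have := normc_ge0 (r%:C%C * cis y - z); nra.
  - move=> x y /tau01/andP[t0 t1] y01; have t0' : 0 <= tau x by exact: le_trans t0.
    rewrite /Py !normcM normc_cis nr normc_real mulr1 -/k ger0_norm //.
    have tr : tau x * r <= 1 by rewrite mulr_ile1 // ltW.
    by have := ler_wpM2r k0 tr; lra.
  - by move=> x y x01 y01; exact: PG.
  - by move=> x y x01 y01; exact: hX.
  - by move=> x y x01 y01; exact: hY.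
rewrite Y1 => H; move: Y0; rewrite -H normcM -/k => H1.
have kp : 0 < k by rewrite normc_gt0 twopii_neq0.
by rewrite -(ler_pM2l kp) (le_trans H1) // [leRHS](_ : _ = 2 * (M * (eps * k))) //; ring.
Qed.

End CauchyFormula.

(** * Cauchy's formula and Taylor expansion *)

Section CauchySeries.
Variable R : realType.
Local Notation C := R[i].
Implicit Types (x y s r : R) (f g : C -> C) (z w : C).

Lemma holoP f : holo f <-> forall z, normc z < 1 -> cdiff f z.
Proof.
split=> h z; first by rewrite -disc_normc => /h/cdiffP.
by rewrite disc_normc => /h/cdiffP.
Qed.

Lemma circle_int_ex (F : C -> C) r : 0 < r -> r < 1 ->
  (forall w, normc w = r -> cdiff F w) -> exists l, isint (fun y => F (r%:C%C * cis y)) l.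
Proof.
move=> r0 r1 dF; apply: isint_ex => y.
apply: (@ccont_comp _ F (fun t => r%:C%C * cis t)).
  by apply: dF; rewrite normcM normc_cis mulr1 normc_real gtr0_norm.
exact: rderiv_ccont (rderivZ _ (rderiv_cis y)).
Qed.

(** The difference quotient is bounded near z because f is differentiable there, so [circle_shrink]
    bounds the integral by a multiple of an arbitrarily small eps. The last factor w of the
    integrand comes from dw = 2 i pi w dy. *)
Lemma circle_quotient f z r : holo f -> normc z < r -> r < 1 ->
  isint (fun y => (f (r%:C%C * cis y) - f z) / (r%:C%C * cis y - z) * (r%:C%C * cis y)) 0.
Proof.
move=> /holoP hf zr r1; have r0 : 0 < r by rewrite (le_lt_trans _ zr).
pose G w := (f w - f z) / (w - z).
have dG w : w != z -> normc w < 1 -> cdiff G w.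
  move=> wz w1; apply: cdiffM; first by apply: cdiffB; [exact: hf|exact: cdiff_cst].
  apply: cdiffV; first by rewrite subr_eq0.
  by apply: cdiffB; [exact: cdiff_id|exact: cdiff_cst].
have [l hl] : exists l, isint (fun y => G (r%:C%C * cis y) * (r%:C%C * cis y)) l.
  apply: (@circle_int_ex (fun w => G w * w)) => // w wr.
  apply: cdiffM; last exact: cdiff_id.
  apply: dG; last by rewrite wr.
  by apply/eqP => wz; move: zr; rewrite -wz wr ltxx.
suff -> : 0 = l by [].
have [m hm] := hf z (lt_trans zr r1).
have [d d0 hd] := hm 1 ltr01.
pose M := normc m + 1; have M0 : 0 < M by rewrite ltr_wpDl.
have GM w : 0 < normc (w - z) < d -> normc (G w) <= M.
  case/andP => wz wd; have := hd (w - z) wd; rewrite (addrC z) subrK mul1r => H.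
  rewrite /G normcM normcV ler_pdivrMr //.
  rewrite -(subrK (m * (w - z)) (f w - f z)) (le_trans (normcD _ _)) //.
  by rewrite /M mulrDl mul1r addrC normcM lerD2l.
apply/esym/eqP; rewrite -normc_eq0 eq_le normc_ge0 andbT leNgt; apply/negP => l0.
(* The three terms give 2 eps <= d, eps < 1 and 2 M eps <= |l| / 2; the last contradicts |l| <= 2 M
   eps. *)
pose eps := Num.min (d / 2) (Num.min (1 / 2) (normc l / (4 * M))).
have e0 : 0 < eps by rewrite !lt_min !divr_gt0 ?mulr_gt0.
have e1 : eps <= 1 / 2 by rewrite /eps !ge_min lexx orbT.
have ed : eps <= d / 2 by rewrite /eps ge_min lexx.
have el : eps * (4 * M) <= normc l by rewrite -ler_pdivlMr ?mulr_gt0 // /eps !ge_min lexx !orbT.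
have : normc l <= 2 * (M * eps).
  apply: (@circle_shrink R G z r eps M l) => //; first by rewrite e0; lra.
  by move=> w /andP[w0 we]; apply: GM; rewrite w0; lra.
by lra.
Qed.

Lemma normc_dist z w : `|normc z - normc w| <= normc (z - w).
Proof.
have := normcD (z - w) w; have := normcD (w - z) z; rewrite !subrK (normcB w).
by rewrite ler_norml; lra.
Qed.

Lemma circle_bounded f r : holo f -> 0 < r -> r < 1 ->
  exists2 M : R, 0 <= M & forall y, 0 <= y <= 1 -> normc (f (r%:C%C * cis y)) <= M.
Proof.
move=> /holoP hf r0 r1.
have cf y : ccont (fun t => f (r%:C%C * cis t)) y.
  apply: (@ccont_comp _ f (fun t => r%:C%C * cis t)).
    by apply: hf; rewrite normcM normc_cis mulr1 normc_real gtr0_norm.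
  exact: rderiv_ccont (rderivZ _ (rderiv_cis y)).
have [|c _ hc] := @EVT_max R (fun t => normc (f (r%:C%C * cis t))) 0 1 ler01.
  apply: continuous_subspaceT => y; apply/cvgrPdist_lt => e e0.
  have [d d0 hd] := cf y e e0; exists d => //= t; rewrite /= distrC => /hd.
  by apply: le_lt_trans; rewrite distrC normc_dist.
exists (normc (f (r%:C%C * cis c))); first exact: normc_ge0.
by move=> y y01; apply: hc; rewrite in_itv.
Qed.

Lemma kernel_expand z w N : w != 0 -> w != z ->
  w / (w - z) = \sum_(k < N) z ^+ k * w^-1 ^+ k + (z / w) ^+ N * (w / (w - z)).
Proof.
move=> w0 wz; have wz0 : w - z != 0 by rewrite subr_eq0.
elim: N => [|N IH]; first by rewrite big_ord0 add0r expr0 mul1r.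
rewrite {1}IH big_ord_recr /= -addrA; congr (_ + _).
rewrite -exprMn exprSr -mulrA -[X in _ = X + _]mulr1 -mulrDr; congr (_ * _).
by field; rewrite w0 wz0.
Qed.

(** Integrating [kernel_expand] against f gives a series for the Cauchy integral of f; by
    [circle_quotient] this integral is f z times the Cauchy integral of 1. *)
Lemma cauchy_series f r : holo f -> 0 < r -> r < 1 ->
  exists c : nat -> C, forall z, normc z < r -> csum (fun k => c k * z ^+ k) (f z).
Proof.
move=> hf r0 r1; have hf' := (holoP f).1 hf.
have nr : normc (r%:C%C : C) = r by rewrite normc_real gtr0_norm.
have rC0 : (r%:C%C : C) != 0 by rewrite -normc_eq0 nr gt_eqF.
(* Stated for a general F because it serves twice: for f, and for the constant 1, whose Cauchy
   integral is read off from its own series. *)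
have series F : holo F -> exists2 c : nat -> C,
    (forall k, isint (fun y => F (r%:C%C * cis y) * (r%:C%C * cis y)^-1 ^+ k) (c k)) &
    forall z, normc z < r -> exists2 I, isint (fun y => F (r%:C%C * cis y) *
       ((r%:C%C * cis y) / (r%:C%C * cis y - z))) I & csum (fun k => c k * z ^+ k) I.
  move=> hF; have hF' := (holoP F).1 hF.
  have /choice[c hc] k : exists l, isint (fun y => F (r%:C%C * cis y) * (r%:C%C * cis y)^-1 ^+ k) l.
    apply: (@circle_int_ex (fun w => F w * w^-1 ^+ k)) => // w wr.
    apply: cdiffM; first by apply: hF'; rewrite wr.
    have : cdiff (fun w : C => w^-1) w.
      by apply: (@cdiffV R id); [rewrite -normc_eq0 wr gt_eqF|exact: cdiff_id].
    elim: k => [|k IH] dw; first exact: cdiff_cst.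
    rewrite (_ : (fun w : C => _) = (fun w : C => w^-1 * w^-1 ^+ k)).
      by apply: cdiffM => //; exact: IH.
    by apply/funext => u; rewrite exprS.
  exists c => // z zr.
  have wz y : r%:C%C * cis y != z.
    by apply/eqP => wz; move: zr; rewrite -wz normcM normc_cis mulr1 nr ltxx.
  have w0 y : r%:C%C * cis y != 0 by rewrite -normc_eq0 normcM normc_cis mulr1 nr gt_eqF.
  have [I hI] : exists I, isint (fun y => F (r%:C%C * cis y) *
       ((r%:C%C * cis y) / (r%:C%C * cis y - z))) I.
    apply: (@circle_int_ex (fun w => F w * (w / (w - z)))) => // w wr.
    apply: cdiffM; first by apply: hF'; rewrite wr.
    apply: cdiffM; first exact: cdiff_id.
    apply: cdiffV; last by apply: cdiffB; [exact: cdiff_id|exact: cdiff_cst].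
    by rewrite subr_eq0; apply/eqP => wz'; move: zr; rewrite -wz' wr ltxx.
  exists I => // e e0.
  have [M M0 hM] := circle_bounded hF r0 r1.
  have rz : 0 < r - normc z by rewrite subr_gt0.
  pose K := 2 * (M * (r / (r - normc z))) + 1.
  have k0 : 0 <= r / (r - normc z) by rewrite divr_ge0 // ltW.
  have K1 : 0 < K by have := mulr_ge0 M0 k0; rewrite /K; lra.
  pose q := normc z / r; have q0 : 0 <= q by rewrite divr_ge0 // ltW.
  have q1 : q < 1 by rewrite ltr_pdivrMr // mul1r.
  have [N0 hN0] : exists N0 : nat, forall N, (N0 <= N)%N -> q ^+ N < e / K.
    have := @cvg_expr R q; rewrite ger0_norm // => /(_ q1)/cvgrPdist_lt.
    move=> /(_ (e / K) ltac:(by rewrite divr_gt0))[N0 _ hN]; exists N0 => N /hN.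
    by rewrite /= sub0r normrN ger0_norm // exprn_ge0.
  exists N0 => N /hN0; rewrite ltr_pdivlMr // => qN.
  rewrite normcB; apply: le_trans (ltW qN).
  have : isint (fun y => F (r%:C%C * cis y) * ((r%:C%C * cis y) / (r%:C%C * cis y - z)) -
     \sum_(k < N) z ^+ k * (F (r%:C%C * cis y) * (r%:C%C * cis y)^-1 ^+ k))
     (I - \sum_(k < N) c k * z ^+ k).
    rewrite (eq_bigr (fun k : 'I_N => z ^+ k * c k)) => [|k _]; last by rewrite mulrC.
    exact: isintB hI (isint_sum N (fun k => isintZ (z ^+ k) (hc k))).
  move=> /isint_bound h.
  apply: (le_trans (h (M * (q ^+ N * (r / (r - normc z)))) _)); last first.
    rewrite /K mulrDr mulr1 [leLHS](_ : _ = q ^+ N * (2 * (M * (r / (r - normc z))))).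
      by rewrite lerDl exprn_ge0.
    by ring.
  move=> y y01; rewrite (kernel_expand N (w0 y) (wz y)) mulrDr mulr_sumr.
  rewrite (eq_bigr (fun k : 'I_N => z ^+ k * (F (r%:C%C * cis y) * (r%:C%C * cis y)^-1 ^+ k))); last first.
    by move=> k _; ring.
  rewrite addrAC subrr add0r normcM; apply: ler_pM => //; first exact: hM.
  rewrite normcM normcX !normcM !normcV !normcM normc_cis nr mulr1 -/q.
  apply: ler_wpM2l; first exact: exprn_ge0.
  apply: ler_wpM2l; first exact: ltW.
  rewrite lef_pV2 ?posrE //.
    rewrite lerBlDr; have := normcD (r%:C%C * cis y - z) z.
    by rewrite subrK normcM normc_cis nr mulr1.
  by rewrite normc_gt0 subr_eq0.
have [c hc hcs] := series f hf.
exists c => z zr; have [I hI hI'] := hcs z zr.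
have h1 : holo (fun _ : C => 1 : C) by apply/holoP => w _; exact: cdiff_cst.
have [c1 hc1 hcs1] := series _ h1; have [I1 hI1 hI1'] := hcs1 z zr.
have c1E k : c1 k = (if k == 0%N then 1 else 0).
  apply: isint_uniq (hc1 k) _.
  have := isintZ ((r%:C%C : C)^-1 ^+ k) (@isint_cisX R k).
  have -> : (r%:C%C : C)^-1 ^+ k * (k == 0%N)%:R = (if k == 0%N then 1 else 0).
    by case: k => [|k] /=; rewrite ?mulr0 // expr0 mulr1.
  apply: isint_eq => y _; rewrite mul1r -exprMn; congr (_ ^+ _).
  have := cisN y; have cy0 : cis y != 0 by rewrite -normc_eq0 normc_cis oner_eq0.
  by move=> H; apply: (mulfI cy0); rewrite mulrCA H mulr1 invfM mulrCA mulfV // mulr1.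
have I1E : I1 = 1.
  apply: csum_uniq hI1' _; apply: csum_eq (has_ps_cst (1 : C) (z := z) (lt_trans zr r1)) => k.
  by rewrite c1E.
have := isintB (isintB hI (isintZ (f z) hI1)) (circle_quotient hf zr r1).
rewrite I1E mulr1 subr0 => H.
suff -> : f z = I by [].
apply/esym/eqP; rewrite -subr_eq0; apply/eqP.
have z0 : isint (fun=> 0 : C) 0.
  by exists (fun=> 0); [move=> y _; exact: rderiv_cst|rewrite subrr].
by apply: isint_uniq H _; apply: isint_eq z0 => y _; ring.
Qed.

(** The coefficients of [cauchy_series] depend a priori on the radius. Substituting z / 2 turns the
    expansions for two radii into power series on the whole disc, where [has_ps_coef] identifies
    them. *)
Lemma holo_has_ps f : holo f -> has_ps f (coef f).
Proof.
move=> hf; have h0 : 0 < 1 / 2 :> R by lra.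
have h1 : 1 / 2 < 1 :> R by lra.
have ball r : 0 < r -> r < 1 -> exists c : nat -> C, forall z, normc z < r -> csum (fun k => c k * z ^+ k) (f z).
  by move=> r0 r1; exact: cauchy_series.
have [c hc] := ball _ h0 h1.
suff fc : has_ps f c by rewrite (has_ps_coef fc).
move=> z z1; pose r := Num.max (1 / 2) ((1 + normc z) / 2).
have r0 : 0 < r by rewrite lt_max h0.
have r1 : r < 1 by rewrite gt_max h1 /=; lra.
have zr : normc z < r by rewrite lt_max; apply/orP; right; lra.
have [c' hc'] := ball _ r0 r1.
have scale a : (forall z, normc z < 1 / 2 -> csum (fun k => a k * z ^+ k) (f z)) ->
    has_ps (fun w => f ((1 / 2)%:C%C * w)) (fun k => a k * (1 / 2)%:C%C ^+ k).
  move=> ha w w1; have := ha ((1 / 2)%:C%C * w).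
  rewrite normcM normc_real gtr0_norm // => H.
  by apply: csum_eq (H _) => [k|]; [rewrite exprMn mulrA|rewrite gtr_pMr].
have /has_ps_coef e1 := scale _ hc.
have /has_ps_coef e2 : has_ps (fun w => f ((1 / 2)%:C%C * w)) (fun k => c' k * (1 / 2)%:C%C ^+ k).
  by apply: scale => w w2; apply: hc'; rewrite (lt_le_trans w2) // le_max lexx.
apply: csum_eq (hc' z zr) => k; congr (_ * _).
have := congr1 (fun F => F k) (etrans (esym e1) e2) => /= /mulIf -> //.
by rewrite expf_neq0 // -normc_eq0 normc_real normr_eq0 gt_eqF.
Qed.

End CauchySeries.

(** * Coefficients of products *)

Section Products.
Variable R : realType.
Local Notation C := R[i].
Implicit Types (f g : C -> C) (z w : C) (a b c : nat -> C).

Definition conv a b k : C := \sum_(i < k.+1) a i * b (k - i)%N.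

Lemma cderivM f g z l m : cderiv f z l -> cderiv g z m ->
  cderiv (fun w => f w * g w) z (f z * m + l * g z).
Proof.
move=> /cderivP hf /cderivP hg; apply/cderivP.
have := @is_deriveM C C^o (f : C^o -> C) (g : C^o -> C) (z : C^o) 1 l m hf hg.
rewrite mulrfctE /GRing.scale /= (mulrC (g z)); exact.
Qed.

Lemma convS a b k : (conv a b k.+1) *+ k.+1 = conv (dps a) b k + conv a (dps b) k.
Proof.
rewrite /conv -sumrMnl.
rewrite (eq_bigr (fun i : 'I_k.+2 => (a i * b (k.+1 - i)%N) *+ i +
    (a i * b (k.+1 - i)%N) *+ (k.+1 - i))) => [|i _]; last first.
  by rewrite -mulrnDr subnKC // -ltnS.
rewrite big_split /=; congr (_ + _).
  rewrite big_ord_recl /= mulr0n add0r; apply: eq_bigr => i _.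
  by rewrite /dps mulrnAl /bump /= add1n subSS.
rewrite big_ord_recr /= subnn mulr0n addr0; apply: eq_bigr => i _.
by rewrite /dps mulrnAr subSn // -ltnS.
Qed.

Lemma holoM f g : holo f -> holo g -> holo (fun z => f z * g z).
Proof.
move=> /holoP hf /holoP hg; apply/holoP => z z1; apply: cdiffM; [exact: hf|exact: hg].
Qed.

(** No double series is rearranged: f g is holomorphic, hence has an expansion, and its coefficient
    of index k + 1 is found from those of index k of f' g + f g', by induction over all pairs of
    functions. *)
Lemma coefM f g a b k : has_ps f a -> has_ps g b ->
  coef (fun z => f z * g z) k = conv a b k.
Proof.
elim: k f g a b => [|k IH] f g a b fa gb.
  have hfg := holo_has_ps (holoM (has_ps_holo fa) (has_ps_holo gb)).
  rewrite -(has_ps0 hfg) /conv big_ord1 (has_ps0 fa) (has_ps0 gb) //.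
have hfg := holo_has_ps (holoM (has_ps_holo fa) (has_ps_holo gb)).
have fa' := has_ps_derive1 fa; have gb' := has_ps_derive1 gb.
set f' := derive1 _ in fa'; set g' := derive1 _ in gb'.
have h1 := holo_has_ps (holoM (has_ps_holo fa') (has_ps_holo gb)).
have h2 := holo_has_ps (holoM (has_ps_holo fa) (has_ps_holo gb')).
have h3 : has_ps (fun z => f' z * g z + f z * g' z)
    (dps (coef (fun z => f z * g z))).
  apply: has_ps_eq (has_ps_derive1 hfg) _ => z z1.
  rewrite (cderiv_derive1 (cderivM (has_ps_cderiv fa z1) (has_ps_cderiv gb z1))).
  rewrite /f' /g' (cderiv_derive1 (has_ps_cderiv fa z1)).
  by rewrite (cderiv_derive1 (has_ps_cderiv gb z1)) addrC.
have := etrans (esym (has_ps_coef h3)) (has_ps_coef (has_psD h1 h2)).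
move/(congr1 (fun F => F k)); rewrite /= (IH _ _ _ _ fa' gb) (IH _ _ _ _ fa gb').
rewrite -convS /dps => /eqP; rewrite -subr_eq0 -mulrnBl -mulr_natr mulf_eq0.
by rewrite pnatr_eq0 orbF subr_eq0 => /eqP.
Qed.

Lemma has_psM f g a b : has_ps f a -> has_ps g b ->
  has_ps (fun z => f z * g z) (conv a b).
Proof.
move=> fa gb; have := holo_has_ps (holoM (has_ps_holo fa) (has_ps_holo gb)).
by congr has_ps; apply/funext => k; exact: coefM.
Qed.

End Products.

(** * Parseval formula for weighted area integrals *)

Section Lebesgue1.
Variable R : realType.
Local Notation mR := (measurableTypeR R).
Local Notation leb := (@lebesgue_measure R).
Local Open Scope ereal_scope.
Implicit Types (f : mR -> \bar R) (c s : R).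

Lemma measurable_shift c : measurable_fun [set: mR] (fun x : mR => x + c : mR)%R.
Proof. by apply: (@measurable_funD _ mR R). Qed.

Lemma measurable_scale c : measurable_fun [set: mR] (fun x : mR => c * x : mR)%R.
Proof. by apply: (@measurable_funM _ mR R). Qed.

(** Lebesgue measure is determined by its values on half-open intervals. *)
Lemma lebesgue_measure_shift c (A : set mR) : measurable A ->
  pushforward leb (fun x : mR => x + c : mR)%R A = leb A.
Proof.
move=> mA; pose phi := (fun x : mR => x + c : mR)%R.
have := @lebesgue_measure_unique R (pushforward leb phi).
move=> /(_ (measurable_shift c) _ A mA) -> // _ [[a b] _ <-].
rewrite /pushforward /= [X in _ = leb X](_ : _ = `](a - c)%R, (b - c)%R]%classic).
  rewrite !lebesgue_measure_itv /= !lte_fin ltrD2r; case: ifPn => // _.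
  by rewrite -!EFinB; congr EFin; ring.
by apply/seteqP; split=> x /=; rewrite !in_itv /= /phi ltrBlDr lerBrDr.
Qed.

Lemma integral_shift f c : measurable_fun setT f -> (forall x, 0 <= f x) ->
  \int[leb]_x f (x + c)%R = \int[leb]_x f x.
Proof.
move=> mf f0.
rewrite -(@ge0_integral_pushforward _ _ mR mR R _ (measurable_shift c) leb setT f) //.
apply: eq_measure_integral => [|mphi A mA _]; first exact: measurable_shift.
exact: lebesgue_measure_shift.
Qed.

Lemma lebesgue_measure_scale (s : R) (s0 : (0 < s)%R) (A : set mR) : measurable A ->
  s%:E * pushforward leb (fun x : mR => s * x : mR)%R A = leb A.
Proof.
move=> mA; pose phi := (fun x : mR => s * x : mR)%R.
have := @lebesgue_measure_unique R (mscale (NngNum (ltW s0)) (pushforward leb phi)).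
move=> /(_ (measurable_scale s) _ A mA) -> // _ [[a b] _ <-].
rewrite /= /mscale /= /pushforward [X in (_ * leb X)](_ : _ = `](a / s)%R, (b / s)%R]%classic).
  rewrite !lebesgue_measure_itv /= !lte_fin ltr_pM2r ?invr_gt0 //; case: ifPn => ?.
    by rewrite -!EFinB -EFinM; congr EFin; field; rewrite gt_eqF.
  by rewrite mule0.
by apply/seteqP; split=> x /=; rewrite !in_itv /= /phi ltr_pdivrMr // ler_pdivlMr // mulrC.
Qed.

Lemma integral_scale f (s : R) : (0 < s)%R -> measurable_fun setT f -> (forall x, 0 <= f x) ->
  s%:E * \int[leb]_x f (s * x)%R = \int[leb]_x f x.
Proof.
move=> s0 mf f0.
rewrite -(@ge0_integral_pushforward _ _ mR mR R _ (measurable_scale s) leb setT f) //.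
have mphi := measurable_scale s.
rewrite -(@ge0_integral_mscale _ _ _ (pushforward leb (fun x : mR => s * x : mR)%R) setT _ (NngNum (ltW s0)) f) //.
by apply: eq_measure_integral => A mA _; exact: lebesgue_measure_scale.
Qed.

End Lebesgue1.

Section Lebesgue2.
Variable R : realType.
Local Notation mR := (measurableTypeR R).
Local Notation leb := (@lebesgue_measure R).
Local Notation leb2 := (leb \x leb)%E.
Local Open Scope ereal_scope.
Implicit Types (F : mR * mR -> \bar R) (a b c s : R).

Lemma measurable_lin a b : measurable_fun [set: mR * mR] (fun p : mR * mR => a * p.1 + b * p.2 : mR)%R.
Proof.
apply: (@measurable_funD _ (mR * mR)%type R); exact: (@measurable_funM _ (mR * mR)%type R).
Qed.

Lemma measurable_lin2 a b c d :
  measurable_fun [set: mR * mR] (fun p : mR * mR => (a * p.1 + b * p.2, c * p.1 + d * p.2)%R : mR * mR).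
Proof. by apply: measurable_fun_pair; exact: measurable_lin. Qed.

Lemma integral2_shear2 F b : measurable_fun setT F -> (forall p, 0 <= F p) ->
  \int[leb2]_p F (p.1, b * p.1 + p.2)%R = \int[leb2]_p F p.
Proof.
move=> mF F0; rewrite !fubini_tonelli1 //; last first.
  apply: measurableT_comp => //; have := measurable_lin2 1 0 b 1.
  by congr measurable_fun; apply/funext => p; rewrite !mul1r mul0r addr0.
apply: eq_integral => x _; rewrite /fubini_F /=.
rewrite -[RHS](integral_shift (b * x)); [|exact: measurable_fun_pair2|by []].
by apply: eq_integral => y _; rewrite addrC.
Qed.

Lemma integral2_shear1 F a : measurable_fun setT F -> (forall p, 0 <= F p) ->
  \int[leb2]_p F (p.1 + a * p.2, p.2)%R = \int[leb2]_p F p.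
Proof.
move=> mF F0; rewrite !fubini_tonelli2 //; last first.
  apply: measurableT_comp => //; have := measurable_lin2 1 a 0 1.
  by congr measurable_fun; apply/funext => p; rewrite !mul1r mul0r add0r.
apply: eq_integral => y _; rewrite /fubini_G /=.
by rewrite -[RHS](integral_shift (a * y)); [|exact: measurable_fun_pair1|].
Qed.

(* A rotation other than -1 is a product of three shears. *)
Lemma integral2_rotation F c s : (c ^+ 2 + s ^+ 2 = 1)%R -> (c != -1)%R ->
  measurable_fun setT F -> (forall p, 0 <= F p) ->
  \int[leb2]_p F (c * p.1 - s * p.2, s * p.1 + c * p.2)%R = \int[leb2]_p F p.
Proof.
move=> cs c1 mF F0; have c0 : (1 + c != 0)%R by rewrite addrC -subr_eq0 opprK in c1 *.
(* Minus the tangent of half the angle of rotation; this is what excludes c = -1. *)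
pose a := (- s / (1 + c))%R.
rewrite -[RHS](integral2_shear1 a) //.
have m1 : measurable_fun [set: mR * mR] (fun p : mR * mR => F (p.1 + a * p.2, p.2)%R).
  apply: measurableT_comp => //; have := measurable_lin2 1 a 0 1.
  by congr measurable_fun; apply/funext => p; rewrite !mul1r mul0r add0r.
rewrite -[RHS](integral2_shear2 s m1) //.
have m2 : measurable_fun [set: mR * mR]
    (fun p : mR * mR => F (p.1 + a * (s * p.1 + p.2), s * p.1 + p.2)%R).
  have := measurableT_comp m1 (measurable_lin2 1 0 s 1).
  by congr measurable_fun; apply/funext => p /=; rewrite !mul1r mul0r addr0.
rewrite -[RHS](integral2_shear1 a m2) //=.
apply: eq_integral => -[x y] _ /=; congr (F (_, _)).
  have -> : (c = 1 + a * s)%R.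
    by rewrite /a; apply: (mulIf c0); rewrite mulrDl mul1r mulrAC divfK //; nra.
  have -> : (x + a * y + a * (s * (x + a * y) + y) = (1 + a * s) * x + a * (2 + a * s) * y)%R by ring.
  suff -> : (a * (2 + a * s) = - s)%R by rewrite mulNr.
  rewrite /a; apply: (mulIf c0); apply: (mulIf c0).
  rewrite [LHS](_ : _ = - s * (2 * (1 + c) - s * s))%R; last by field.
  have -> : (s * s = 1 - c * c)%R by rewrite -cs; ring.
  by ring.
rewrite mulrDr -addrA; congr (_ + _)%R.
have -> : (c = 1 + s * a)%R.
  by rewrite /a; apply: (mulIf c0); rewrite mulrDl mul1r mulrA divfK //; nra.
by rewrite mulrDl mul1r mulrA addrC.
Qed.

Lemma integral2_scale F s : (0 < s)%R -> measurable_fun setT F -> (forall p, 0 <= F p) ->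
  (s ^+ 2)%:E * \int[leb2]_p F (s * p.1, s * p.2)%R = \int[leb2]_p F p.
Proof.
move=> s0 mF F0.
have m1 : measurable_fun [set: mR * mR] (fun p : mR * mR => F (s * p.1, s * p.2)%R).
  apply: measurableT_comp => //; have := measurable_lin2 s 0 0 s.
  by congr measurable_fun; apply/funext => p; rewrite !mul0r add0r addr0.
have m2 : measurable_fun [set: mR * mR] (fun p : mR * mR => F (p.1, s * p.2)%R).
  apply: measurableT_comp => //; have := measurable_lin2 1 0 0 s.
  by congr measurable_fun; apply/funext => p; rewrite !mul0r add0r addr0 mul1r.
rewrite expr2 EFinM -muleA.
rewrite [in LHS]fubini_tonelli2 // [in RHS]fubini_tonelli1 // -ge0_integralZl //; last first.
- by rewrite lee_fin ltW.
- by move=> x _; apply: integral_ge0.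
- exact: (measurable_fun_fubini_tonelli_G (m1 := leb)).
rewrite -[RHS](_ : \int[leb]_x (s%:E * \int[leb]_y F (x, s * y)%R) = _); last first.
  apply: eq_integral => x _; rewrite /fubini_F /= -[RHS](integral_scale s0) //.
  exact: measurable_fun_pair2.
under eq_integral => y _.
  rewrite /fubini_G /= (integral_scale (f := fun x => F (x, s * y)%R) s0); last 2 first.
  - exact: (@measurable_fun_pair1 _ _ _ _ _ _ (fun p => F (p.1, s * p.2)%R)).
  - by [].
  over.
rewrite ge0_integralZl //; first last.
- by rewrite lee_fin ltW.
- by move=> x _; apply: integral_ge0.
  exact: (measurable_fun_fubini_tonelli_F (m2 := leb) (fun p => F (p.1, s * p.2)%R)).
congr (_ * _); exact/esym/(fubini_tonelli (m1 := leb) (m2 := leb) (fun p => F (p.1, s * p.2)%R)).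
Qed.

End Lebesgue2.

Section Plane.
Variable R : realType.
Local Notation mR := (measurableTypeR R).
Local Notation leb := (@lebesgue_measure R).
Local Open Scope ereal_scope.

(* The canonical sigma-finite structure of a product measure is only found for
   probability factors, hence this alias. *)
Definition plane : set (mR * mR)%type -> \bar R := (leb \x leb).

HB.instance Definition _ := Measure.on plane.

Lemma plane_square (a b : R) : (a <= b)%R ->
  plane (`[a, b]%classic `*` `[a, b]%classic) = ((b - a) ^+ 2)%:E.
Proof.
move=> ab; have ml : leb (`[a, b]%classic : set R) = (b - a)%:E.
  by rewrite lebesgue_measure_itv /= lte_fin; case: ltgtP ab => // -> _; rewrite subrr.
have H := @product_measure1E _ _ mR mR R leb leb (`[a, b]%classic) (`[a, b]%classic)
  (measurable_itv _) (measurable_itv _).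
by apply: (etrans H); rewrite expr2 EFinM; congr (_ * _); exact: ml.
Qed.

Lemma measurable_square (a b : R) :
  measurable (`[a, b]%classic `*` `[a, b]%classic : set (mR * mR)%type).
Proof. by apply: measurableX; exact: measurable_itv. Qed.

Lemma plane_sigma_finite : sigma_finite setT plane.
Proof.
exists (fun n => `[(- n%:R)%R, n%:R]%classic `*` `[(- n%:R)%R, n%:R]%classic).
  apply/seteqP; split=> // -[x y] _.
  exists (Num.trunc (`|x| + `|y|)%R).+1 => //=; rewrite !in_itv /=.
  have := truncnS_gt (`|x| + `|y|)%R; set N := _.+1 => xyN.
  have xN : (`|x| <= N%:R)%R by rewrite ltW // (le_lt_trans _ xyN) // lerDl.
  have yN : (`|y| <= N%:R)%R by rewrite ltW // (le_lt_trans _ xyN) // lerDr.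
  by move: xN yN; rewrite !ler_norml.
move=> n; split; first exact: measurable_square.
by rewrite plane_square ?ltry // (le_trans (y := 0%R)) // oppr_le0.
Qed.

HB.instance Definition _ := Measure_isSigmaFinite.Build _ _ _ plane plane_sigma_finite.

Lemma plane_scale (F : mR * mR -> \bar R) (s : R) : (0 < s)%R ->
  measurable_fun setT F -> (forall p, 0 <= F p) ->
  (s ^+ 2)%:E * \int[plane]_p F (s * p.1, s * p.2)%R = \int[plane]_p F p.
Proof. exact: integral2_scale. Qed.

Lemma plane_rotation (F : mR * mR -> \bar R) (c s : R) : (c ^+ 2 + s ^+ 2 = 1)%R ->
  (c != -1)%R -> measurable_fun setT F -> (forall p, 0 <= F p) ->
  \int[plane]_p F (c * p.1 - s * p.2, s * p.1 + c * p.2)%R = \int[plane]_p F p.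
Proof. exact: integral2_rotation. Qed.

End Plane.

(** * Moments of the unit disc *)

Section Radial.
Variable R : realType.
Local Notation mR := (measurableTypeR R).
Local Notation leb := (@lebesgue_measure R).
Local Notation plane := (@plane R).
Implicit Types (s : R) (p : mR * mR) (k : nat).

Definition sqnorm p : R := p.1 ^+ 2 + p.2 ^+ 2.

Lemma sqnorm_ge0 p : 0 <= sqnorm p.
Proof. by rewrite addr_ge0 ?sqr_ge0. Qed.

Lemma measurable_sqnorm : measurable_fun [set: mR * mR] sqnorm.
Proof.
apply: (@measurable_funD _ (mR * mR)%type R);
  by apply: (@measurable_funX _ (mR * mR)%type R).
Qed.

Definition trunc_pow k s p : R := if sqnorm p < s then sqnorm p ^+ k else 0.

Lemma trunc_pow_ge0 k s p : 0 <= trunc_pow k s p.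
Proof. by rewrite /trunc_pow; case: ifP => // _; rewrite exprn_ge0 // sqnorm_ge0. Qed.

Lemma measurable_trunc_pow k s : measurable_fun [set: mR * mR] (trunc_pow k s).
Proof.
apply: measurable_fun_ifT => //.
  by apply: measurable_fun_ltr => //; exact: measurable_sqnorm.
by apply: (@measurable_funX _ (mR * mR)%type R); exact: measurable_sqnorm.
Qed.

Local Open Scope ereal_scope.
Definition disc_moment k : \bar R := \int[plane]_p (trunc_pow k 1 p)%:E.

(** Here s is a squared radius: the dilation by its square root contributes a factor s for the area
    and s ^ k for the integrand. *)
Lemma trunc_pow_scale k s : (0 < s)%R ->
  \int[plane]_p (trunc_pow k s p)%:E = (s ^+ k.+1)%:E * disc_moment k.
Proof.
move=> s0; have r0 : (0 < Num.sqrt s)%R by rewrite sqrtr_gt0.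
rewrite -(plane_scale r0) /=; last 2 first.
- by apply/measurable_EFinP; exact: measurable_trunc_pow.
- by move=> p; rewrite lee_fin trunc_pow_ge0.
rewrite sqr_sqrtr ?ltW // exprS EFinM -muleA; congr (_ * _).
rewrite -ge0_integralZl //; last 3 first.
- by apply/measurable_EFinP; exact: measurable_trunc_pow.
- by move=> p _; rewrite lee_fin trunc_pow_ge0.
- by rewrite lee_fin exprn_ge0 // ltW.
apply: eq_integral => p _; rewrite -EFinM; congr EFin.
rewrite /trunc_pow /sqnorm /= !exprMn sqr_sqrtr ?ltW // -mulrDr.
rewrite -[X in (_ < X)%R]mulr1 ltr_pM2l //; case: ifP => _; last by rewrite mulr0.
by rewrite exprMn.
Qed.

(** The constant is the area of the disc; the squares [0, 1/2]^2 and [-1, 1]^2 make it positive and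
    finite. *)
Lemma disc_moment0 : exists2 c : R, (0 < c)%R & disc_moment 0 = c%:E.
Proof.
have mr (a b : R) := @measurable_square R a b.
have rect (a b : R) : (a <= b)%R ->
    \int[plane]_p (\1_(`[a, b]%classic `*` `[a, b]%classic : set (mR * mR)) p)%:E = ((b - a) ^+ 2)%:E.
  by move=> ab; rewrite integral_indic // setIT; exact: plane_square.
have mt := measurable_trunc_pow 0 1.
have le1 : disc_moment 0 <= 4%:E.
  rewrite (_ : 4 = (1 - - 1) ^+ 2)%R; last by ring.
  rewrite -rect; last by lra.
  apply: ge0_le_integral => //.
  - by move=> p _; rewrite lee_fin trunc_pow_ge0.
  - exact/measurable_EFinP.
  - by apply/measurable_EFinP; exact: measurable_indic.
  move=> -[x y] _; rewrite lee_fin /trunc_pow expr0; case: ifP => // xy.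
  rewrite indicE mem_set //=; rewrite !in_itv /=; move: xy; rewrite /sqnorm /=.
  by move=> xy; split; apply/andP; split; nra.
have ge1 : (1 / 4)%:E <= disc_moment 0.
  rewrite (_ : 1 / 4 = (1 / 2 - 0) ^+ 2)%R; last by field.
  rewrite -rect; last by lra.
  apply: ge0_le_integral => //.
  - by apply/measurable_EFinP; exact: measurable_indic.
  - exact/measurable_EFinP.
  move=> -[x y] _; rewrite lee_fin indicE; case: (boolP (_ \in _)) => [|_]; last exact: trunc_pow_ge0.
  rewrite inE /= !in_itv /= => -[/andP[x0 x1] /andP[y0 y1]].
  by rewrite /trunc_pow expr0 /sqnorm /= ifT //; nra.
exists (fine (disc_moment 0)).
  by rewrite fine_gt0 // (lt_le_trans _ ge1) ?lte_fin // (le_lt_trans le1) ?ltry.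
rewrite fineK // ge0_fin_numE ?(le_lt_trans le1) ?ltry //.
by rewrite (le_trans _ ge1) // lee_fin.
Qed.

Lemma integral_exprn01 k :
  \int[leb]_x (if (0 <= x <= 1)%R then x ^+ k else 0)%R%:E = (k.+1%:R^-1)%:E :> \bar R.
Proof.
have := @EFin_beta_fun R k.+1 1; rewrite beta_funE /= => h.
rewrite [RHS](_ : _ = (k`!%:R * 0`!%:R / (k.+1 + 1).-1`!%:R)%:E); last first.
  congr EFin; rewrite fact0 mulr1 addn1 /= factS natrM; field.
  by rewrite addrC natr1 !pnatr_eq0 -lt0n fact_gt0.
rewrite h; apply: eq_integral => x _; rewrite patchE; congr EFin.
by rewrite mem_setE in_itv /=; case: ifP => // _; rewrite /XMonemX expr0 mulr1.
Qed.

(** Layer cake in place of polar coordinates: one factor |p|^2 is the integral of ds over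
    [0, |p|^2]. After the exchange, the part of the disc beyond the squared radius s has moment (1 -
    s^(k + 1)) a by homogeneity. The additive form avoids a subtraction of extended reals. *)
Lemma disc_momentS k (a : R) : disc_moment k = a%:E ->
  disc_moment k.+1 + (a * k.+2%:R^-1)%:E = a%:E.
Proof.
move=> ak; have a0 : (0 <= a)%R.
  by rewrite -lee_fin -ak; apply: integral_ge0 => p _; rewrite lee_fin trunc_pow_ge0.
pose h (z : mR * mR * mR) : R :=
  if (0 <= z.2 <= sqnorm z.1)%R then trunc_pow k 1 z.1 else 0%R.
have h0 z : (0 <= h z)%R by rewrite /h; case: ifP => // _; exact: trunc_pow_ge0.
have mh : measurable_fun [set: mR * mR * mR] (EFin \o h).
  apply/measurable_EFinP; apply: measurable_fun_ifT => //.
    apply: measurable_and.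
      by apply: measurable_fun_ler => //.
    apply: measurable_fun_ler => //.
    by apply: measurableT_comp => //; exact: measurable_sqnorm.
  by apply: measurableT_comp => //; exact: measurable_trunc_pow.
have := @fubini_tonelli _ _ (mR * mR)%type mR R plane leb (EFin \o h) mh h0.
have -> : \int[plane]_p \int[leb]_s (h (p, s))%:E = disc_moment k.+1.
  apply: eq_integral => p _; rewrite /h /=.
  have q0 := sqnorm_ge0 p.
  have -> : (trunc_pow k.+1 1 p)%:E = (trunc_pow k 1 p)%:E * (sqnorm p)%:E.
    rewrite -EFinM /trunc_pow; congr EFin; case: ifP => _; last by rewrite mul0r.
    by rewrite exprSr.
  transitivity (\int[leb]_s ((trunc_pow k 1 p)%:E * (\1_(`[0%R, sqnorm p]%classic : set R) s)%:E)).
    apply: eq_integral => s _; rewrite -EFinM indicE mem_setE in_itv /=; congr EFin.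
    by case: ifP => _; rewrite ?mulr1 ?mulr0.
  rewrite ge0_integralZl //; last 2 first.
  - by apply/measurable_EFinP; exact: measurable_indic.
  - by rewrite lee_fin trunc_pow_ge0.
  rewrite integral_indic // setIT; congr (_ * _).
  rewrite [LHS](lebesgue_measure_itv `[0%R, sqnorm p]) /= lte_fin.
  by case: ltgtP q0 => // q1 _; rewrite ?sube0 // -q1.
have -> : \int[leb]_s \int[plane]_p (h (p, s))%:E =
    \int[leb]_s (if 0 <= s <= 1 then (1 - s ^+ k.+1) * a else 0)%R%:E.
  apply: eq_integral => s _; rewrite /h /=.
  case: ifPn => [/andP[s0 s1]|ns]; last first.
    rewrite integral0_eq // => p _; case: ifPn => // /andP[s0 sp]; rewrite /trunc_pow.
    case: ifPn => // p1; case/negP: ns; apply/andP; split=> //.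
    exact: le_trans sp (ltW p1).
  have split_eq : \int[plane]_p (if 0 <= s <= sqnorm p then trunc_pow k 1 p else 0)%R%:E +
      \int[plane]_p (trunc_pow k s p)%:E = a%:E.
    rewrite -ge0_integralD //; last 4 first.
    - by move=> p _; rewrite lee_fin; case: ifP => // _; exact: trunc_pow_ge0.
    - apply/measurable_EFinP; apply: measurable_fun_ifT => //; last exact: measurable_trunc_pow.
      apply: measurable_and; first exact: measurable_cst.
      by apply: measurable_fun_ler => //; exact: measurable_sqnorm.
    - by move=> p _; rewrite lee_fin trunc_pow_ge0.
    - by apply/measurable_EFinP; exact: measurable_trunc_pow.
    rewrite -ak; apply: eq_integral => p _; rewrite -EFinD /trunc_pow; congr EFin.
    case: ifPn => [/andP[_ sp]|]; first by rewrite [(sqnorm p < s)%R]ltNge sp addr0.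
    rewrite s0 /= -ltNge => sp.
    by rewrite add0r sp (lt_le_trans sp).
  (* Homogeneity requires s > 0; at s = 0 the whole disc lies beyond s. *)
  have [s00|sn0] := eqVneq s 0%R.
    rewrite s00 expr0n /= subr0 mul1r -ak; apply: eq_integral => p _.
    by rewrite sqnorm_ge0 lexx.
  move: split_eq; rewrite trunc_pow_scale; last by rewrite lt_neqAle eq_sym sn0.
  rewrite ak -EFinM; set X := (X in X + _ = _) => H.
  transitivity (a%:E - (s ^+ k.+1 * a)%:E); first by rewrite -H addeK.
  by rewrite -EFinB; congr EFin; ring.
move=> ->.
have m01 : measurable_fun [set: mR] (fun s : mR => (0 <= s) && (s <= 1))%R.
  by apply: measurable_and; apply: measurable_fun_ler.
have mpow : measurable_fun [set: mR] (fun s : mR => (if 0 <= s <= 1 then s ^+ k.+1 else 0)%R%:E).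
  by apply/measurable_EFinP; apply: measurable_fun_ifT => //; exact: measurable_funX.
have -> : (a * k.+2%:R^-1)%:E = \int[leb]_s (if 0 <= s <= 1 then s ^+ k.+1 * a else 0)%R%:E.
  rewrite EFinM -integral_exprn01 -ge0_integralZl //; last first.
    by move=> s _; rewrite lee_fin; case: ifP => // /andP[s0 _]; rewrite exprn_ge0.
  by apply: eq_integral => s _; rewrite -EFinM; congr EFin; case: ifP => _; rewrite ?mulr0 // mulrC.
rewrite -ge0_integralD //; last 4 first.
- move=> s _; rewrite lee_fin; case: ifP => // /andP[s0 s1].
  by rewrite mulr_ge0 // subr_ge0 exprn_ile1.
- apply/measurable_EFinP; apply: measurable_fun_ifT => //.
  apply: measurable_funM => //; apply: measurable_funB => //; exact: measurable_funX.
- by move=> s _; rewrite lee_fin; case: ifP => // /andP[s0 _]; rewrite mulr_ge0 // exprn_ge0.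
- apply/measurable_EFinP; apply: measurable_fun_ifT => //.
  by apply: measurable_funM => //; exact: measurable_funX.
transitivity (\int[leb]_s (a%:E * (\1_(`[0%R, 1%R]%classic : set R) s)%:E)).
  apply: eq_integral => s _; rewrite -EFinD -EFinM indicE mem_setE in_itv /=; congr EFin.
  by case: (_ && _); rewrite /= ?mulr1 ?mulr0; ring.
rewrite ge0_integralZl //; last by apply/measurable_EFinP; exact: measurable_indic.
rewrite integral_indic // setIT -[RHS]mule1; congr (_ * _).
by rewrite [LHS](lebesgue_measure_itv `[0%R, 1%R]) /= lte_fin ltr01 sube0.
Qed.

End Radial.

Section Moments.
Variable R : realType.
Local Notation mR := (measurableTypeR R).
Local Notation plane := (@plane R).
Implicit Types (p : mR * mR) (k n : nat).

Definition disc_weight n p : R := if sqnorm p < 1 then (1 - sqnorm p) ^+ n else 0.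

Lemma disc_weight_ge0 n p : 0 <= disc_weight n p.
Proof. by rewrite /disc_weight; case: ifP => // p1; rewrite exprn_ge0 // subr_ge0 ltW. Qed.

Lemma measurable_disc_weight n : measurable_fun [set: mR * mR] (disc_weight n).
Proof.
apply: measurable_fun_ifT => //.
  by apply: measurable_fun_ltr => //; exact: measurable_sqnorm.
apply: (@measurable_funX _ (mR * mR)%type R); apply: measurable_funB => //.
exact: measurable_sqnorm.
Qed.

Lemma measurable_weight_moment k n :
  measurable_fun [set: mR * mR] (fun p => sqnorm p ^+ k * disc_weight n p).
Proof.
apply: measurable_funM; last exact: measurable_disc_weight.
by apply: (@measurable_funX _ (mR * mR)%type R); exact: measurable_sqnorm.
Qed.

Lemma weight_moment_ge0 k n p : 0 <= sqnorm p ^+ k * disc_weight n p.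
Proof. by rewrite mulr_ge0 ?disc_weight_ge0 // exprn_ge0 // sqnorm_ge0. Qed.

Local Open Scope ereal_scope.

(** These are Beta integrals. Splitting off one factor 1 - |p|^2 expresses the moment (k, n + 1) as
    the difference of the moments (k, n) and (k + 1, n); the case n = 0 comes from
    [disc_momentS]. *)
Lemma weight_momentE : exists2 c : R, (0 < c)%R & forall k n,
  \int[plane]_p (sqnorm p ^+ k * disc_weight n p)%:E =
  (c * (k`!%:R * n`!%:R / (k + n).+1`!%:R))%:E.
Proof.
have [c c0 hc] := disc_moment0 R; exists c => // k n; elim: n k => [|n IH] k.
  transitivity (disc_moment R k).
    apply: eq_integral => p _; congr EFin; rewrite /disc_weight /trunc_pow expr0.
    by case: ifP; rewrite ?mulr1 ?mulr0.
  rewrite (_ : c * _ = c * k.+1%:R^-1)%R; last first.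
    rewrite addn0 fact0 mulr1 factS natrM; field.
    by rewrite addrC natr1 !pnatr_eq0 -!lt0n !fact_gt0.
  elim: k => [|k IH]; first by rewrite hc invr1 mulr1.
  have H := disc_momentS IH.
  have -> : disc_moment R k.+1 = (c * k.+1%:R^-1)%:E - (c * k.+1%:R^-1 / k.+2%:R)%:E.
    by rewrite -{1}H addeK.
  rewrite -EFinB; congr EFin; field.
  by rewrite !(addrC _ k%:R) natr1 -natrD !pnatr_eq0 !addnS.
have H : \int[plane]_p (sqnorm p ^+ k * disc_weight n.+1 p)%:E +
    \int[plane]_p (sqnorm p ^+ k.+1 * disc_weight n p)%:E =
    \int[plane]_p (sqnorm p ^+ k * disc_weight n p)%:E.
  rewrite -ge0_integralD //; last 4 first.
  - by move=> p _; rewrite lee_fin weight_moment_ge0.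
  - by apply/measurable_EFinP; exact: measurable_weight_moment.
  - by move=> p _; rewrite lee_fin weight_moment_ge0.
  - by apply/measurable_EFinP; exact: measurable_weight_moment.
  apply: eq_integral => p _; rewrite -EFinD; congr EFin; rewrite /disc_weight.
  by case: ifP => _; rewrite ?mulr0 ?addr0 // !exprS; ring.
rewrite !IH in H; set X := \int[_]_p _ in H *.
have -> : X = (c * (k`!%:R * n`!%:R / (k + n).+1`!%:R))%:E -
     (c * (k.+1`!%:R * n`!%:R / (k.+1 + n).+1`!%:R))%:E by rewrite -H addeK.
rewrite -EFinB; congr EFin; rewrite addSn addnS !factS !natrM.
have f0 m : (m`!%:R != 0 :> R)%R by rewrite pnatr_eq0 -lt0n fact_gt0.
field; rewrite !(addrC _ (k%:R + n%:R)%R) f0.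
by rewrite -!natrD natr1 !pnatr_eq0 !addnS.
Qed.

End Moments.

(** * Averages over roots of unity *)

Section DiscreteParseval.
Variable R : realType.
Local Notation C := R[i].
Implicit Types (z w : C) (b : nat -> C).

Lemma cisD (x y : R) : cis (x + y) = cis x * cis y.
Proof.
apply/eqP; rewrite eq_complex /cis /= mulrDr cosD sinD.
by apply/andP; split; apply/eqP; ring.
Qed.

Lemma cis_natr (x : R) k : cis x ^+ k = cis (x * k%:R).
Proof.
elim: k => [|k IH]; first by rewrite mulr0 cis0.
by rewrite exprS IH -cisD -natr1 mulrDr mulr1 addrC.
Qed.

Lemma cis_neq1 (x : R) : 0 < x < 1 -> cis x != 1.
Proof.
case/andP => x0 x1; apply/eqP => /(congr1 (@complex.Re R)) /=.
rewrite (_ : pi *+ 2 * x = (pi * x) *+ 2); last by rewrite mulrnAl.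
rewrite cos_mulr2n => h.
have : 0 < sin (pi * x).
  apply: sin_gt0_pi; rewrite mulr_gt0 ?pi_gt0 //=.
  by rewrite -[ltRHS]mulr1 ltr_pM2l // pi_gt0.
have := cos2Dsin2 (pi * x); move: h; set c := cos _; set s := sin _.
move=> h1 h2 s0; have : 0 < s ^+ 2 by rewrite exprn_gt0.
by move: h1; rewrite mulr2n; lra.
Qed.

Lemma cis_conj x : conjc (cis x : C) = cis (- x).
Proof. by rewrite /cis /= mulrN cosN sinN. Qed.

Lemma sqmodE z : (sqmod z)%:C%C = z * conjc z.
Proof.
case: z => x y; apply/eqP; rewrite eq_complex /sqmod /=.
by rewrite !mulrN opprK -!expr2 (mulrC y) addNr !eqxx.
Qed.

(** Expanding the squares leaves geometric sums whose ratio is the (k - l)-th power of a primitive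
    N-th root of unity; they vanish for k != l because both indices lie below N. *)
Lemma discrete_parseval N b : (0 < N)%N ->
  \sum_(j < N) sqmod (\sum_(k < N) b k * (cis (N%:R^-1 : R) ^+ j) ^+ k) =
  N%:R * \sum_(k < N) sqmod (b k).
Proof.
move=> N0; apply: complexI.
have NR : (N%:R : R) != 0 by rewrite pnatr_eq0 -lt0n.
set zt := cis _.
have ztN : zt ^+ N = 1 by rewrite cis_natr mulVf // cis1.
have ztc : zt * conjc zt = 1 by rewrite cis_conj cisN.
have orth (k l : 'I_N) : \sum_(j < N) (zt ^+ j) ^+ k * conjc ((zt ^+ j) ^+ l) = (N%:R *+ (k == l) : C).
  have -> : \sum_(j < N) (zt ^+ j) ^+ k * conjc ((zt ^+ j) ^+ l) =
      \sum_(j < N) (zt ^+ k * conjc zt ^+ l) ^+ j.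
    apply: eq_bigr => j _; rewrite !rmorphXn /= exprMn -!exprM.
    by rewrite (mulnC j) (mulnC j).
  have [<-|kl] := eqVneq k l.
    rewrite -exprMn ztc expr1n; under eq_bigr do rewrite expr1n.
    by rewrite sumr_const card_ord.
  set q := _ * _.
  have q1 : q != 1.
    rewrite /q cis_conj !cis_natr -cisD.
    have [lk|] := ltnP l k.
      have -> : N%:R^-1 * k%:R + - N%:R^-1 * l%:R = (k - l)%:R / N%:R :> R.
        by rewrite natrB ?(ltnW lk) // mulNr -mulrBr mulrC.
      apply: cis_neq1; rewrite divr_gt0 ?ltr0n ?subn_gt0 //=.
      rewrite ltr_pdivrMr ?ltr0n // mul1r ltr_nat.
      by rewrite (leq_ltn_trans (leq_subr _ _)).
    rewrite leq_eqVlt => /orP[/eqP kl'|lk]; first by case/eqP: kl; exact: val_inj.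
    have -> : N%:R^-1 * k%:R + - N%:R^-1 * l%:R = - ((l - k)%:R / N%:R) :> R.
      by rewrite natrB ?(ltnW lk) // mulNr -mulrBr mulrC -mulNr opprB.
    apply/eqP => H; have := cisN ((l - k)%:R / N%:R : R); rewrite H mulr1.
    apply/eqP; apply: cis_neq1; rewrite divr_gt0 ?ltr0n ?subn_gt0 //=.
    rewrite ltr_pdivrMr ?ltr0n // mul1r ltr_nat.
    by rewrite (leq_ltn_trans (leq_subr _ _)).
  have qN : q ^+ N = 1.
    have ztcN : conjc zt ^+ N = 1 by rewrite -rmorphXn ztN rmorph1.
    by rewrite /q exprMn -!exprM !(mulnC _ N) !exprM ztN ztcN !expr1n mulr1.
  apply/eqP; rewrite mulr0n -(mulrI_eq0 _ (x := q - 1)); last first.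
    by apply/lregP; rewrite subr_eq0.
  by rewrite -subrX1 qN subrr.
rewrite rmorphM rmorph_sum rmorph_nat rmorph_sum /=.
under eq_bigr do rewrite sqmodE rmorph_sum /= big_distrlr /=.
rewrite exchange_big mulr_sumr /=; apply: eq_bigr => k _.
rewrite exchange_big /= sqmodE.
rewrite (eq_bigr (fun l : 'I_N => b k * conjc (b l) * (N%:R *+ (k == l)))); last first.
  move=> l _; rewrite -orth mulr_sumr; apply: eq_bigr => j _.
  by rewrite !rmorphM /=; ring.
rewrite (bigD1 k) //= eqxx mulr1n big1 ?addr0; first by rewrite mulrC.
by move=> l lk; rewrite eq_sym (negbTE lk) mulr0n mulr0.
Qed.

End DiscreteParseval.

Section Tails.
Variable R : realType.
Local Notation C := R[i].

Lemma sum_tail (y : nat -> R) (M e : R) : (forall k, 0 <= y k) ->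
  (forall N, \sum_(k < N) y k <= M) -> 0 < e ->
  exists N0, forall N N', (N0 <= N)%N -> (N <= N')%N ->
    \sum_(k < N') y k - \sum_(k < N) y k <= e.
Proof.
move=> y0 yM e0; have [s hs] := @real_sum_cvg R y y M (fun k => ltac:(by rewrite ger0_norm)) yM.
have ub N : \sum_(k < N) y k <= s.
  have <- : limn (series y) = s by apply: cvg_lim.
  have := @nondecreasing_cvgn_le R (series y); rewrite /series /= => /(_ _ _ N).
  rewrite big_mkord; apply; last by apply: cvgP hs.
  by move=> m n mn; rewrite (big_cat_nat (leq0n _) mn) /= lerDl sumr_ge0.
move/cvgrPdist_le : hs => /(_ e e0)[N0 _ hN]; exists N0 => N N' NN _.
have := hN N NN; rewrite /series /= big_mkord ger0_norm ?subr_ge0 ?ub // => h.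
by apply: le_trans h; rewrite lerD2r ub.
Qed.

Lemma csum_tail (u : nat -> C) l N (e : R) : csum u l ->
  (forall N', (N <= N')%N -> \sum_(k < N') normc (u k) - \sum_(k < N) normc (u k) <= e) ->
  normc (l - \sum_(k < N) u k) <= e.
Proof.
move=> ul he; apply/ler_addgt0Pr => d d0; have [N0 h] := ul d d0.
pose N' := maxn N N0.
have -> : l - \sum_(k < N) u k =
  (\sum_(k < N') u k - \sum_(k < N) u k) - (\sum_(k < N') u k - l) by ring.
rewrite (le_trans (normcD _ _)) // normcN lerD ?h ?leq_maxr //.
apply: le_trans (he N' (leq_maxl _ _)).
rewrite -!(big_mkord xpredT u) -!(big_mkord xpredT (fun k => normc (u k))).
rewrite !(big_cat_nat (leq0n N) (leq_maxl N N0)) /= [X in normc X]addrAC subrr add0r.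
by rewrite [leRHS]addrAC subrr add0r normc_sum.
Qed.

Lemma sqmod_dist (z w : C) (B e : R) : normc z <= B -> normc w <= B -> normc (z - w) <= e ->
  `|sqmod z - sqmod w| <= 2 * B * e.
Proof.
move=> zB wB zw; rewrite -!normc_sq subr_sqr normrM.
have d : `|normc z - normc w| <= e.
  apply: le_trans zw; have := normcD (z - w) w; have := normcD (w - z) z.
  by rewrite !subrK (normcB w) ler_norml; lra.
rewrite mulrC; apply: ler_pM => //.
have s0 : 0 <= normc z + normc w by exact: addr_ge0.
by rewrite (ger0_norm s0); lra.
Qed.
End Tails.

Section Parseval.
Variable R : realType.
Local Notation C := R[i].
Local Notation mR := (measurableTypeR R).
Local Notation plane := (@plane R).
Implicit Types (p : mR * mR) (k n N : nat) (u : C -> C) (a : nat -> C).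

Definition cmeas (phi : mR * mR -> C) :=
  measurable_fun [set: mR * mR] (fun p => complex.Re (phi p) : R) /\
  measurable_fun [set: mR * mR] (fun p => complex.Im (phi p) : R).

Lemma cmeas_cst c : cmeas (fun=> c).
Proof. by split; exact: measurable_cst. Qed.

Lemma cmeas_toC : cmeas (@toC R).
Proof. by split; [exact: measurable_fst|exact: measurable_snd]. Qed.

Lemma cmeasD phi psi : cmeas phi -> cmeas psi -> cmeas (fun p => phi p + psi p).
Proof.
move=> [a b] [c d]; split.
  have := measurable_funD a c; congr measurable_fun; apply/funext => p /=.
  by case: (phi p) => ? ?; case: (psi p).
have := measurable_funD b d; congr measurable_fun; apply/funext => p /=.
by case: (phi p) => ? ?; case: (psi p).
Qed.

Lemma cmeasM phi psi : cmeas phi -> cmeas psi -> cmeas (fun p => phi p * psi p).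
Proof.
move=> [a b] [c d]; split.
  have := measurable_funB (measurable_funM a c) (measurable_funM b d).
  congr measurable_fun; apply/funext => p /=.
  by case: (phi p) => ? ?; case: (psi p).
have := measurable_funD (measurable_funM a d) (measurable_funM b c).
congr measurable_fun; apply/funext => p /=.
by case: (phi p) => ? ?; case: (psi p).
Qed.

Lemma cmeas_poly a w N : cmeas (fun p => \sum_(k < N) a k * (w * toC p) ^+ k).
Proof.
have X k : cmeas (fun p => (w * toC p) ^+ k).
  elim: k => [|k IH]; first by under eq_fun do rewrite expr0; exact: cmeas_cst.
  under eq_fun do rewrite exprS.
  by apply: cmeasM => //; apply: cmeasM; [exact: cmeas_cst|exact: cmeas_toC].
elim: N => [|N IH]; first by under eq_fun do rewrite big_ord0; exact: cmeas_cst.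
under eq_fun do rewrite big_ord_recr.
by apply: cmeasD => //; apply: cmeasM; [exact: cmeas_cst|exact: X].
Qed.

Lemma measurable_sqmod phi : cmeas phi -> measurable_fun [set: mR * mR] (fun p => sqmod (phi p)).
Proof.
move=> [a b]; apply: (@measurable_funD _ (mR * mR)%type R);
  exact: (@measurable_funX _ (mR * mR)%type R).
Qed.

Lemma sqmod_toC p : sqmod (toC p) = sqnorm p. Proof. by []. Qed.

Lemma normc_toC p : sqnorm p < 1 -> normc (toC p) < 1.
Proof.
rewrite -sqmod_toC -normc_sq => h.
by rewrite -(ltr_pXn2r (n := 2)) ?nnegrE // expr1n.
Qed.

(** The same N0 serves all rotations w z; averages over N-th roots of unity need this uniformity, as
    the points themselves move with N. *)
Lemma has_ps_approx u a z (e : R) : has_ps u a -> normc z < 1 -> 0 < e ->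
  exists N0, forall N w, (N0 <= N)%N -> normc w = 1 ->
    `|sqmod (u (w * z)) - sqmod (\sum_(k < N) a k * (w * z) ^+ k)| <= e.
Proof.
move=> ua z1 e0; have [B hB] := has_ps_abs ua (normc_ge0 z) z1.
have B0 : 0 <= B by have := hB 0%N; rewrite big_ord0.
have e' : 0 < e / (2 * (B + 1)) by rewrite divr_gt0 //; lra.
have [N0 hN0] := @sum_tail R (fun k => normc (a k) * normc z ^+ k) B _
  (fun k => mulr_ge0 (normc_ge0 _) (exprn_ge0 _ (normc_ge0 _))) hB e'.
exists N0 => N w NN w1.
have nwz : normc (w * z) = normc z by rewrite normcM w1 mul1r.
have term k : normc (a k * (w * z) ^+ k) = normc (a k) * normc z ^+ k.
  by rewrite normcM normcX nwz.
have cu := ua (w * z) ltac:(by rewrite nwz).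
have -> : e = 2 * (B + 1) * (e / (2 * (B + 1))) by field; lra.
apply: sqmod_dist.
- rewrite (le_trans (y := B)) ?lerDl //; apply: (csum_le cu) => N'.
  by under eq_bigr do rewrite term.
- rewrite (le_trans (normc_sum _ _ _)) // (le_trans (y := B)) ?lerDl //.
  by under eq_bigr do rewrite term.
- apply: (csum_tail cu) => N' NN'; under eq_bigr do rewrite term.
  by under [X in _ - X]eq_bigr do rewrite term; exact: hN0.
Qed.

End Parseval.

Section Parseval.
Variable R : realType.
Local Notation C := R[i].
Local Notation mR := (measurableTypeR R).
Local Notation plane := (@plane R).
Implicit Types (p : mR * mR) (k n N : nat) (u : C -> C) (a : nat -> C).

Local Open Scope ereal_scope.

(** Outside the disc [u] is arbitrary, but there the weight vanishes; inside, u is a limit of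
    polynomials. *)
Lemma measurable_series_disc u a n : has_ps u a ->
  measurable_fun [set: mR * mR] (fun p => sqmod (u (toC p)) * disc_weight n p)%R.
Proof.
move=> ua; apply: (@measurable_fun_cvg _ (mR * mR)%type R setT
  (fun N p => sqmod (\sum_(k < N) a k * (1 * toC p) ^+ k)%R * disc_weight n p)%R) => [N|p _].
  apply: measurable_funM; last exact: measurable_disc_weight.
  by apply: measurable_sqmod; exact: cmeas_poly.
rewrite /disc_weight; case: ifP => p1; last first.
  by under eq_fun do rewrite mulr0; rewrite mulr0; exact: cvg_cst.
apply: cvgMr_tmp; apply/cvgrPdist_le => e e0.
have [N0 h] := has_ps_approx ua (normc_toC p1) e0.
exists N0 => // N /= NN; have := h N 1%R NN (normc1 R).
by rewrite [in X in (`|X - _| <= _)%R]mul1r.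
Qed.

Lemma weighted_ge0 (w : C) n p : (0 <= sqmod w * disc_weight n p)%R.
Proof. by rewrite mulr_ge0 ?sqmod_ge0 ?disc_weight_ge0. Qed.

Lemma rotation_integral (h : C -> C) n N j : odd N ->
  measurable_fun [set: mR * mR] (fun p => sqmod (h (toC p)) * disc_weight n p)%R ->
  \int[plane]_p (sqmod (h (cis (N%:R^-1 : R) ^+ j * toC p)) * disc_weight n p)%R%:E =
  \int[plane]_p (sqmod (h (toC p)) * disc_weight n p)%R%:E.
Proof.
move=> oN mh; set z := (cis _ ^+ j)%R.
have N0 : (N != 0)%N by apply: contraTneq oN => ->.
have zN : (z ^+ N = 1)%R.
  by rewrite -exprM mulnC exprM cis_natr mulVf ?cis1 ?expr1n // pnatr_eq0.
have nz : normc z = 1%R by rewrite normcX normc_cis expr1n.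
have cs : (complex.Re z ^+ 2 + complex.Im z ^+ 2 = 1)%R.
  by have := normc_sq z; rewrite nz expr1n.
(* An N-th root of unity with N odd is never -1, the one rotation that is not a product of
   shears. *)
have c1 : (complex.Re z != -1)%R.
  apply/eqP => c1; move: cs; rewrite c1 sqrrN expr1n => /eqP.
  rewrite -subr_eq0 addrAC subrr add0r expf_eq0 /= => /eqP s0.
  have zE : z = (-1)%R.
    by apply/eqP; rewrite eq_complex c1 s0 /= oppr0 !eqxx.
  move: zN; rewrite zE -signr_odd oN expr1 => /eqP.
  by rewrite eq_sym -subr_eq0 opprK (_ : 1 + 1 = 2%:R)%R // pnatr_eq0.
have zC p : toC (complex.Re z * p.1 - complex.Im z * p.2,
    complex.Im z * p.1 + complex.Re z * p.2)%R = (z * toC p)%R.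
  clearbody z; case: z {zN nz cs c1} => x y; apply/eqP; rewrite eq_complex /toC /=.
  by apply/andP; split; apply/eqP; ring.
have sq p : sqnorm (complex.Re z * p.1 - complex.Im z * p.2,
    complex.Im z * p.1 + complex.Re z * p.2)%R = sqnorm p.
  by rewrite -sqmod_toC zC sqmodM -normc_sq nz expr1n mul1r sqmod_toC.
rewrite -[RHS](plane_rotation cs c1) /=; last 2 first.
- exact/measurable_EFinP.
- move=> p; rewrite lee_fin; exact: weighted_ge0.
by apply: eq_integral => p _; rewrite zC /disc_weight sq.
Qed.

(* Averages over N-th roots of unity replace polar coordinates: by the discrete Parseval identity they
   eliminate the angle from |u|^2 as N tends to infinity. *)
Lemma average_integral (h : C -> C) n N : odd N ->
  (forall w : C, normc w = 1%R ->
    measurable_fun [set: mR * mR] (fun p => sqmod (h (w * toC p)) * disc_weight n p)%R) ->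
  \int[plane]_p ((N%:R^-1 * \sum_(j < N) sqmod (h (cis (N%:R^-1 : R) ^+ j * toC p))) *
     disc_weight n p)%R%:E =
  \int[plane]_p (sqmod (h (toC p)) * disc_weight n p)%R%:E.
Proof.
move=> oN mh; have N0 : (0 < N)%N by case: (N) oN.
have mh1 : measurable_fun [set: mR * mR] (fun p => sqmod (h (toC p)) * disc_weight n p)%R.
  by have := mh 1%R (normc1 R); under eq_fun do rewrite mul1r.
pose F (j : 'I_N) p := (N%:R^-1 * (sqmod (h (cis (N%:R^-1 : R) ^+ j * toC p)) * disc_weight n p))%R%:E.
rewrite (eq_integral (fun p => \sum_(j < N) F j p)); last first.
  move=> p _; rewrite /F sumEFin; congr EFin; rewrite -mulr_sumr -mulr_suml mulrA //.
rewrite ge0_integral_sum //; last 2 first.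
- move=> j; apply/measurable_EFinP; apply: measurable_funM => //.
  by apply: mh; rewrite normcX normc_cis expr1n.
- by move=> j p _; rewrite lee_fin mulr_ge0 ?weighted_ge0 // invr_ge0.
rewrite (eq_bigr (fun j : 'I_N => (N%:R^-1)%:E *
    \int[plane]_p (sqmod (h (toC p)) * disc_weight n p)%R%:E)); last first.
  move=> j _; rewrite -(rotation_integral j oN mh1) -ge0_integralZl //.
  - by apply/measurable_EFinP; apply: mh; rewrite normcX normc_cis expr1n.
  - by move=> p _; rewrite lee_fin; exact: weighted_ge0.
rewrite -ge0_sume_distrl; last by move=> j _; rewrite lee_fin invr_ge0.
have -> : \sum_(i < N) (N%:R^-1)%:E = 1%:E :> \bar R.
  rewrite sumEFin sumr_const card_ord -(mulr_natl (N%:R^-1 : R)%R N) mulfV //.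
  by rewrite pnatr_eq0 -lt0n.
by rewrite mul1e.
Qed.

Lemma partial_average a (z : C) N : (0 < N)%N ->
  (N%:R^-1 * \sum_(j < N) sqmod (\sum_(k < N) a k * (cis (N%:R^-1 : R) ^+ j * z) ^+ k) =
   \sum_(k < N) sqmod (a k) * sqmod z ^+ k)%R.
Proof.
move=> N0; rewrite (eq_bigr (fun j : 'I_N =>
   sqmod (\sum_(k < N) (a k * z ^+ k) * (cis (N%:R^-1 : R) ^+ j) ^+ k)%R)) => [|j _]; last first.
  by congr sqmod; apply: eq_bigr => k _; rewrite exprMn; ring.
rewrite (discrete_parseval (fun k => a k * z ^+ k)%R N0) mulrA mulVf ?mul1r; last by rewrite pnatr_eq0 -lt0n.
by apply: eq_bigr => k _; rewrite sqmodM -!normc_sq normcX -!exprM mulnC.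
Qed.

Lemma limn_einf_le (x : (\bar R)^nat) c : (forall n, x n <= c) -> limn_einf x <= c.
Proof.
move=> xc; rewrite limn_einf_lim; apply: lime_le; first exact: is_cvg_einfs.
near=> n; apply: le_trans (xc n); apply: ereal_inf_lbound.
by exists n => //=.
Unshelve. all: by end_near. Qed.

Lemma disc_weight_le1 n p : (disc_weight n p <= 1)%R.
Proof.
rewrite /disc_weight; case: ifP => // p1.
by rewrite exprn_ile1 // ?subr_ge0 ?(ltW p1) // gerBl sqnorm_ge0.
Qed.

(** Both inequalities are obtained from Fatou's lemma, which also covers infinite values. *)
Theorem disc_parseval u a n : has_ps u a ->
  \int[plane]_p (sqmod (u (toC p)) * disc_weight n p)%R%:E =
  \sum_(k <oo) (sqmod (a k))%:E * \int[plane]_p (sqnorm p ^+ k * disc_weight n p)%R%:E.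
Proof.
move=> ua.
have mu w : normc w = 1%R ->
    measurable_fun [set: mR * mR] (fun p => sqmod (u (w * toC p)) * disc_weight n p)%R.
  move=> w1; apply: (@measurable_series_disc (fun z => u (w * z)%R) (fun k => a k * w ^+ k)%R).
  move=> z z1; apply: csum_eq (ua (w * z)%R _) => [k|]; last by rewrite normcM w1 mul1r.
  by rewrite exprMn mulrA.
have mG : measurable_fun [set: mR * mR] (fun p => sqmod (u (toC p)) * disc_weight n p)%R.
  exact: measurable_series_disc ua.
pose f k p : R := (sqmod (a k) * (sqnorm p ^+ k * disc_weight n p))%R.
have f0 k p : (0 <= f k p)%R by rewrite /f mulr_ge0 ?sqmod_ge0 // weight_moment_ge0.
have mf k : measurable_fun [set: mR * mR] (f k).
  by apply: measurable_funM => //; exact: measurable_weight_moment.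
have -> : \sum_(k <oo) (sqmod (a k))%:E * \int[plane]_p (sqnorm p ^+ k * disc_weight n p)%R%:E =
    \int[plane]_p \sum_(k <oo) (f k p)%:E.
  rewrite integral_nneseries //; last 2 first.
  - by move=> k; exact/measurable_EFinP.
  - by move=> k p _; rewrite lee_fin.
  apply: eq_eseriesr => k _; rewrite /f.
  under [RHS]eq_integral do rewrite EFinM.
  rewrite ge0_integralZl //.
  - by apply/measurable_EFinP; exact: measurable_weight_moment.
  - by move=> p _; rewrite lee_fin weight_moment_ge0.
  - by rewrite lee_fin sqmod_ge0.
pose S N p : R := (\sum_(k < N) f k p)%R.
have Slim p : (S N p)%:E @[N --> \oo] --> \sum_(k <oo) (f k p)%:E.
  have -> : (fun N => (S N p)%:E) = (fun N => \sum_(0 <= k < N) (f k p)%:E).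
    by apply/funext => N; rewrite /S sumEFin big_mkord.
  by apply: is_cvg_nneseries => k _ _; rewrite lee_fin.
pose odds M := M.*2.+1.
have oddsP M : odd (odds M) by rewrite /odds /= odd_double.
have Sav p N : (0 < N)%N -> S N p =
    ((N%:R^-1 * \sum_(j < N) sqmod (\sum_(k < N) a k * (cis (N%:R^-1 : R) ^+ j * toC p) ^+ k)) *
    disc_weight n p)%R.
  move=> N0; rewrite (partial_average a (toC p) N0) mulr_suml; apply: eq_bigr => k _.
  by rewrite /f sqmod_toC mulrA.
have mS N : measurable_fun [set: mR * mR] (fun p => (S N p)%:E).
  by apply/measurable_EFinP; exact: measurable_sum.
have mL : measurable_fun [set: mR * mR] (fun p => \sum_(k <oo) (f k p)%:E).
  by apply: (emeasurable_fun_cvg (fun N p => (S N p)%:E)) => // p _; exact: Slim.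
have mpoly N w : measurable_fun [set: mR * mR]
    (fun p => sqmod (\sum_(k < N) a k * (w * toC p) ^+ k) * disc_weight n p)%R.
  apply: measurable_funM; last exact: measurable_disc_weight.
  by apply: measurable_sqmod; exact: cmeas_poly.
have iS N : odd N -> \int[plane]_p (S N p)%:E =
    \int[plane]_p (sqmod (\sum_(k < N) a k * (1 * toC p) ^+ k) * disc_weight n p)%R%:E.
  move=> oN; have N0 : (0 < N)%N by case: (N) oN.
  have -> : \int[plane]_p (sqmod (\sum_(k < N) a k * (1 * toC p) ^+ k) * disc_weight n p)%R%:E =
      \int[plane]_p (sqmod (\sum_(k < N) a k * toC p ^+ k) * disc_weight n p)%R%:E.
    by apply: eq_integral => p _; under eq_bigr do rewrite mul1r.
  rewrite -(@average_integral (fun z => \sum_(k < N) a k * z ^+ k)%R n N) //.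
  by apply: eq_integral => p _; rewrite Sav.
have Sle N : \int[plane]_p (S N p)%:E <= \int[plane]_p \sum_(k <oo) (f k p)%:E.
  apply: ge0_le_integral => //.
    by move=> p _; rewrite lee_fin sumr_ge0.
  move=> p _; rewrite /S -sumEFin -(big_mkord xpredT (fun k => (f k p)%:E)).
  by apply: nneseries_lim_ge => k _ _; rewrite lee_fin.
have todds : odds M @[M --> \oo] --> \oo.
  by move=> A [N _ hN]; exists N => // M /= NM; apply: hN; rewrite /= /odds; lia.
apply/eqP; rewrite eq_le; apply/andP; split.
(* The polynomials converge to u, and the integral of the squared modulus of each is a partial sum
   of the series. *)
- rewrite (_ : \int[plane]_p (sqmod (u (toC p)) * disc_weight n p)%R%:E =
    \int[plane]_p limn_einf (fun M =>
      (sqmod (\sum_(k < odds M) a k * (1 * toC p) ^+ k) * disc_weight n p)%R%:E)); last first.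
    apply: eq_integral => p _; apply/esym.
    apply: (fun h => (cvg_limn_einf_sup h).1).
    apply: cvg_EFin; first by near=> M.
    apply/cvgrPdist_le => e e0 /=; rewrite /disc_weight; case: ifP => p1; last first.
      by near=> M; rewrite !mulr0 subrr normr0 ltW.
    have w0 : (0 <= (1 - sqnorm p) ^+ n <= 1)%R.
      by have := disc_weight_ge0 n p; have := disc_weight_le1 n p; rewrite /disc_weight p1 => -> ->.
    have [N0 h] := has_ps_approx ua (normc_toC p1) e0.
    exists N0 => // M /= NM; have := h (odds M) 1%R _ (normc1 R).
    rewrite [in X in (`|X - _| <= _)%R]mul1r => /(_ ltac:(rewrite /odds; lia)) H.
    rewrite -mulrBl normrM (ger0_norm (x := (_ ^+ n)%R)); last by case/andP: w0.
    by rewrite -[leRHS]mulr1 ler_pM //; case/andP: w0.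
  apply: le_trans (fatou _ _ _ _) _ => //.
  + by move=> M; exact/measurable_EFinP.
  + by move=> M p _; rewrite lee_fin weighted_ge0.
  by apply: limn_einf_le => M; rewrite -iS.
(* By rotation invariance every average [av M] has the same integral as |u|^2, whereas discrete
   Parseval for the Taylor polynomials makes it converge pointwise to the series. *)
- pose av M p : R := ((odds M)%:R^-1 * (\sum_(j < odds M)
     sqmod (u (cis ((odds M)%:R^-1 : R) ^+ j * toC p))) * disc_weight n p)%R.
  rewrite (_ : \int[plane]_p \sum_(k <oo) (f k p)%:E =
    \int[plane]_p limn_einf (fun M => (av M p)%:E)); last first.
    apply: eq_integral => p _; apply/esym.
    apply: (fun h => (cvg_limn_einf_sup h).1).
    have -> : (fun M => (av M p)%:E) =
        (fun M => (S (odds M) p)%:E) \+ (fun M => (av M p - S (odds M) p)%:E).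
      by apply/funext => M /=; rewrite -EFinD addrC subrK.
    rewrite -[X in _ --> X]adde0; apply: cvgeD; first by rewrite fin_num_adde_defl.
      exact: (cvg_comp _ _ todds (Slim p)).
    apply: cvg_EFin; first by near=> M.
    apply/cvgrPdist_le => e e0 /=; rewrite /av; case: (boolP (sqnorm p < 1)%R) => p1; last first.
      near=> M; rewrite Sav // /disc_weight (negbTE p1) !mulr0 subrr subrr normr0 ltW //.
    have [N0 h] := has_ps_approx ua (normc_toC p1) e0.
    exists N0 => // M /= NM; rewrite sub0r normrN Sav // -mulrBl -mulrBr -sumrB.
    set N := odds M; have N1 : (0 < N%:R :> R)%R by rewrite ltr0n.
    rewrite normrM (ger0_norm (disc_weight_ge0 n p)) -[leRHS]mulr1.
    apply: ler_pM; rewrite ?disc_weight_ge0 ?disc_weight_le1 //.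
    rewrite normrM gtr0_norm ?invr_gt0 // ler_pdivrMl //.
    rewrite (le_trans (ler_norm_sum _ _ _)) // mulr_natl -[X in (_ <= e *+ X)%R]card_ord -sumr_const.
    apply: ler_sum => j _; apply: h; first by rewrite /N /odds; lia.
    by rewrite normcX normc_cis expr1n.
  have mav M : measurable_fun [set: mR * mR] (av M).
    have -> : av M = (fun p => (odds M)%:R^-1 * (\sum_(j < odds M)
        sqmod (u (cis ((odds M)%:R^-1 : R) ^+ j * toC p)) * disc_weight n p))%R.
      by apply/funext => p; rewrite /av -mulr_suml mulrA.
    apply: measurable_funM => //; apply: measurable_sum => j; apply: mu.
    by rewrite normcX normc_cis expr1n.
  apply: le_trans (fatou _ _ _ _) _ => //.
  + by move=> M; exact/measurable_EFinP.
  + move=> M p _; rewrite lee_fin /av mulr_ge0 ?disc_weight_ge0 // mulr_ge0 ?invr_ge0 //.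
    by rewrite sumr_ge0 // => j _; exact: sqmod_ge0.
  by apply: limn_einf_le => M; rewrite (average_integral (oddsP M) mu).
Unshelve. all: by end_near.
Qed.

End Parseval.

(** * Reduction to local energies *)

Section Quotient.
Variable R : realType.
Local Notation C := R[i].
Implicit Types (z l : C) (a h : nat -> C).

Lemma has_ps_geometric l : normc l = 1 ->
  has_ps (fun z => (z - l)^-1) (fun k => - l^-1 ^+ k.+1).
Proof.
move=> l1 z z1; have l0 : l != 0 by rewrite -normc_eq0 l1 oner_eq0.
have zl : z - l != 0 by rewrite subr_eq0; apply/eqP => zl; rewrite zl l1 ltxx in z1.
move=> e e0; have d0 : 0 < e * normc (z - l) by rewrite mulr_gt0 // normc_gt0.
have [N0 hN0] : exists N0 : nat, forall N, (N0 <= N)%N -> normc z ^+ N < e * normc (z - l).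
  have := @cvg_expr R (normc z); rewrite (ger0_norm (normc_ge0 z)) => /(_ z1)/cvgrPdist_lt/(_ _ d0)[N0 _ hN].
  by exists N0 => N /hN; rewrite /= sub0r normrN (ger0_norm (exprn_ge0 N (normc_ge0 z))).
exists N0 => N /hN0 zN.
have -> : \sum_(k < N) - l^-1 ^+ k.+1 * z ^+ k - (z - l)^-1 = - ((z / l) ^+ N / (z - l)).
  elim: N {zN} => [|N IH]; first by rewrite big_ord0 sub0r expr0 mul1r.
  rewrite big_ord_recr /= addrAC IH !exprSr exprMn.
  by field; rewrite l0 zl.
rewrite normcN normcM normcX normcV normcM normcV l1 invr1 mulr1.
by rewrite ler_pdivrMr ?normc_gt0 // ltW.
Qed.

(** Division by z - l turns coefficients into partial sums at the boundary point l. *)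
Lemma has_ps_quotient f h l : normc l = 1 -> has_ps f h ->
  has_ps (fun z => f z / (z - l)) (fun k => - l^-1 ^+ k.+1 * \sum_(i < k.+1) h i * l ^+ i).
Proof.
move=> l1 fh; have l0 : l != 0 by rewrite -normc_eq0 l1 oner_eq0.
have := has_psM fh (has_ps_geometric l1).
congr has_ps; apply/funext => k; rewrite /conv mulr_sumr; apply: eq_bigr => i _.
have ik : (i <= k)%N by rewrite -ltnS.
rewrite mulrN mulNr; congr (- _); rewrite mulrCA; congr (_ * _).
have -> : l^-1 ^+ k.+1 = l^-1 ^+ (k - i).+1 * l^-1 ^+ i by rewrite -exprD addSn subnK.
by rewrite -mulrA -exprMn mulVf // expr1n mulr1.
Qed.

End Quotient.

Section Reduction.
Variable R : realType.
Local Notation C := R[i].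
Local Notation mR := (measurableTypeR R).
Local Notation plane := (@plane R).
Local Open Scope ereal_scope.

(** Up to the factor -l^-(k + 1), of modulus 1 on the circle, the k-th coefficient of f^(n)(z) / (z
    - l). *)
Definition local_coef (a : nat -> C) n l k : C :=
  (\sum_(i < k.+1) (a (i + n)%N *+ (i + n) ^_ n) * l ^+ i)%R.

Definition local_energy (a : nat -> C) n l : \bar R :=
  \sum_(k <oo) (sqmod (local_coef a n l k) * (k`!%:R / (k + n).+1`!%:R))%R%:E.

Lemma measurable_local_energy a n :
  measurable_fun [set: mR * mR] (fun q => local_energy a n (toC q)).
Proof.
have ml k : measurable_fun [set: mR * mR] (fun q => sqmod (local_coef a n (toC q) k) * (k`!%:R / (k + n).+1`!%:R))%R.
  apply: measurable_funM => //; apply: measurable_sqmod.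
  have := @cmeas_poly R (fun i => (a (i + n)%N *+ (i + n) ^_ n))%R 1%R k.+1.
  by congr cmeas; apply/funext => q; rewrite /local_coef; under eq_bigr do rewrite mul1r.
apply: (emeasurable_fun_cvg (fun N q => \sum_(0 <= k < N)
   (sqmod (local_coef a n (toC q) k) * (k`!%:R / (k + n).+1`!%:R))%R%:E)) => [N|q _].
  under eq_fun do rewrite sumEFin; apply/measurable_EFinP.
  by apply: measurable_sum.
by apply: is_cvg_nneseries => k _ _; rewrite lee_fin mulr_ge0 ?sqmod_ge0 // divr_ge0.
Qed.

Lemma measurable_circle : measurable (@circleR R : set (mR * mR)).
Proof.
have := @measurable_sqnorm R measurableT [set 1%R] (measurable_set1 _).
by rewrite setTI.
Qed.

Lemma local_energyE : exists2 c : R, (0 < c)%R & forall f a n l,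
  has_ps f a -> normc l = 1%R ->
  \int[plane]_p (sqmod (cder n f (toC p) / (toC p - l)) * disc_weight n p)%R%:E =
  (c * n`!%:R)%:E * local_energy a n l.
Proof.
have [c c0 hc] := weight_momentE R; exists c => // f a n l fa l1.
have := has_ps_quotient l1 (has_ps_cder n fa) => /(disc_parseval n) ->.
rewrite /local_energy -nneseriesZl; last first.
  by move=> k _; rewrite lee_fin mulr_ge0 ?sqmod_ge0 // divr_ge0.
apply: eq_eseriesr => k _; rewrite hc -!EFinM; congr EFin.
rewrite sqmodM (_ : sqmod _ = 1)%R; last first.
  by rewrite -normc_sq normcN normcX normcV l1 invr1 !expr1n.
rewrite mul1r (_ : (\sum_(i < k.+1) _)%R = local_coef a n l k); first by ring.
by apply: eq_bigr => i _; rewrite iter_dps.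
Qed.

Lemma Dmu_local (mu : {measure set (R * R)%type -> \bar R}) n : (0 < n)%N ->
  mu setT < +oo -> exists2 K : R, (0 < K)%R & forall f a, has_ps f a ->
  Dmu mu n f = K%:E * \int[mu]_(q in @circleR R) local_energy a n (toC q).
Proof.
move=> n0 mufin; have [c c0 hc] := local_energyE.
have f0 m : (0 < m`!%:R :> R)%R by rewrite ltr0n fact_gt0.
exists ((n`! * (n.-1)`!)%:R^-1 * (pi^-1 * (c * n`!%:R)))%R.
  by rewrite !mulr_gt0 ?invr_gt0 ?pi_gt0 // natrM mulr_gt0.
move=> f a fa; rewrite /Dmu !EFinM -!muleA; congr (_ * (_ * _)).
(* [nu] is mu itself, packaged as a finite measure so that Tonelli applies. *)
pose nu := @mfrestr _ _ R setT mu measurableT mufin.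
have nuE D F : \int[nu]_(q in D) F q = \int[mu]_(q in D) F q.
  by apply: eq_measure_integral => A mA _; rewrite /= /mfrestr /mrestr setIT.
rewrite -nuE.
pose A p : R := (sqmod (cder n f (toC p)) * disc_weight n p)%R.
have mA : measurable_fun [set: mR * mR] A by exact: measurable_series_disc (has_ps_cder n fa).
have A0 p : (0 <= A p)%R by exact: weighted_ge0.
(* The kernel 1 / |p - q|^2 as a real power, in which form it is measurable; on nonnegative reals
   the two expressions agree. *)
pose B (z : (mR * mR) * (R * R)) : R := (sqmod (toC z.1 - toC z.2) `^ (-1))%R.
have mB : measurable_fun setT B.
  apply: (measurableT_comp (measurable_powR (-1)%R)).
  have -> : (fun z : (mR * mR) * (R * R) => sqmod (toC z.1 - toC z.2)%R) =
    (fun z => (z.1.1 - z.2.1) ^+ 2 + (z.1.2 - z.2.2) ^+ 2)%R by [].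
  apply: measurable_funD; apply: measurable_funX; apply: measurable_funB.
  - exact: (measurableT_comp (measurable_fst) (measurable_fst)).
  - exact: (measurableT_comp (measurable_fst) (measurable_snd)).
  - exact: (measurableT_comp (measurable_snd) (measurable_fst)).
  - exact: (measurableT_comp (measurable_snd) (measurable_snd)).
have B0 z : (0 <= B z)%R by exact: powR_ge0.
pose I (z : (mR * mR) * (R * R)) : R := \1_(@circleR R) z.2.
have mI : measurable_fun setT I.
  by apply: measurableT_comp => //; apply: measurable_indic; exact: measurable_circle.
pose Phi z : \bar R := (A z.1 * B z * I z)%R%:E.
have mPhi : measurable_fun setT Phi.
  apply/measurable_EFinP; apply: measurable_funM => //; apply: measurable_funM => //.
  exact: measurableT_comp.
have I0 z : (0 <= I z)%R by rewrite /I indicE ler0n.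
have Phi0 z : 0 <= Phi z.
  by rewrite lee_fin; apply: mulr_ge0; [apply: mulr_ge0; [exact: A0|exact: B0]|exact: I0].
have := @fubini_tonelli _ _ (mR * mR)%type (R * R)%type R plane nu Phi mPhi Phi0.
have sqV (w : C) : (sqmod w^-1 = (sqmod w)^-1)%R by rewrite -!normc_sq normcV exprVn.
have IE (G : (R * R)%type -> R) (p : mR * mR) :
    (forall q, circleR q -> (A p * B (p, q) = G q)%R) ->
    \int[nu]_q Phi (p, q) = \int[nu]_(q in @circleR R) (G q)%:E.
  move=> AG; rewrite [RHS]integral_mkcond; apply: eq_integral => q _.
  rewrite patchE /Phi /I /= indicE; case: (boolP (q \in _)) => [|_]; last by rewrite mulr0.
  by rewrite inE mulr1 => /AG ->.
have BE (p : mR * mR) (q : R * R) : B (p, q) = (sqmod (toC p - toC q)%R)^-1%R.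
  by rewrite /B powR_inv1 // sqmod_ge0.
have -> : \int[plane]_p \int[nu]_q Phi (p, q) =
    \int[(@lebesgue_measure R \x @lebesgue_measure R)%E]_(p in @discR R)
       ((sqmod (cder n f (toC p)) * (1 - sqmod (toC p)) ^+ n.-1)%R%:E * Poisson mu (toC p)).
  transitivity (\int[plane]_(p in @discR R)
       ((sqmod (cder n f (toC p)) * (1 - sqmod (toC p)) ^+ n.-1)%R%:E * Poisson mu (toC p))) => //.
  rewrite [RHS]integral_mkcond; apply: eq_integral => p _; rewrite patchE.
  case: (boolP (p \in _)) => [|pD]; last first.
    rewrite integral0_eq // => q _; rewrite /Phi /A /disc_weight /= ifF ?mulr0 ?mul0r //.
    by apply/negbTE; apply: contra pD => ?; rewrite inE.
  rewrite inE /= => p1; have p1' : (sqnorm p < 1)%R by [].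
  have s1 : (0 <= 1 - sqmod (toC p))%R by rewrite subr_ge0 ltW.
  (* The numerator of the Poisson kernel raises the exponent of 1 - |p|^2 from n - 1 to n, for n >
     0. *)
  rewrite (IE (fun q => (sqmod (cder n f (toC p)) * (1 - sqmod (toC p)) ^+ n.-1) *
     ((1 - sqmod (toC p)) / sqmod (toC p - toC q)))%R) => [|q _]; last first.
    rewrite BE /A /disc_weight p1' sqmod_toC -[X in (_ ^+ X)%R](prednK n0) exprSr.
    by rewrite !mulrA.
  rewrite /Poisson -nuE -ge0_integralZl //; last 4 first.
  - exact: measurable_circle.
  - apply/measurable_EFinP; apply: measurable_funTS.
    rewrite (_ : (fun q => _) = (fun q => (1 - sqmod (toC p)) * B (p, q))%R); last first.
      by apply/funext => q; rewrite BE.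
    by apply: measurable_funM => //; exact: measurable_fun_pair2.
  - by move=> q _; rewrite lee_fin divr_ge0 // sqmod_ge0.
  - by rewrite lee_fin mulr_ge0 ?sqmod_ge0 // exprn_ge0.
have -> : \int[nu]_q \int[plane]_p Phi (p, q) =
    (c * n`!%:R)%:E * \int[nu]_(q in @circleR R) local_energy a n (toC q).
  rewrite -ge0_integralZl //; last 4 first.
  - exact: measurable_circle.
  - by apply: measurable_funTS; exact: measurable_local_energy.
  - move=> q _; apply: nneseries_ge0 => k _ _; rewrite lee_fin; apply: mulr_ge0; first exact: sqmod_ge0.
    exact: divr_ge0.
  - by rewrite lee_fin mulr_ge0 // ltW.
  rewrite [RHS]integral_mkcond; apply: eq_integral => q _; rewrite patchE /Phi /I /=.
  rewrite indicE; case: (boolP (q \in _)) => [|_]; last first.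
    by rewrite integral0_eq // => p _; rewrite mulr0.
  rewrite inE => q1; have l1 : normc (toC q) = 1%R.
    by rewrite -[LHS](ger0_norm (normc_ge0 _)) -sqrtr_sqr normc_sq sqmod_toC /sqnorm q1 sqrtr1.
  rewrite -(hc f a n _ fa l1); apply: eq_integral => p _; congr EFin.
  by rewrite mulr1 BE /A sqmodM sqV; ring.
by move=> ->; rewrite EFinM -muleA.
Qed.
End Reduction.

(** * Local Douglas formula *)

Section WeightedCauchySchwarz.
Variable R : realType.
Local Notation C := R[i].

Lemma real_weighted_CS (p x y : nat -> R) N : (forall k, 0 < p k) ->
  (\sum_(k < N) x k * y k) ^+ 2 <=
  (\sum_(k < N) x k ^+ 2 / p k) * (\sum_(k < N) p k * y k ^+ 2).
Proof.
move=> p0; elim: N => [|N IH]; first by rewrite !big_ord0 expr0n mulr0.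
rewrite !big_ord_recr /=; move: IH.
have : 0 <= \sum_(k < N) x k ^+ 2 / p k.
  by rewrite sumr_ge0 // => k _; rewrite divr_ge0 ?sqr_ge0 // ltW.
have : 0 <= \sum_(k < N) p k * y k ^+ 2.
  by rewrite sumr_ge0 // => k _; rewrite mulr_ge0 ?sqr_ge0 // ltW.
move: (\sum_(k < N) _ * _) (\sum_(k < N) _ / _) (\sum_(k < N) _ * _) => S A B.
move: (p N) (p0 N) (x N) (y N) => q q0 u v B0 A0 SAB.
have -> : (A + u ^+ 2 / q) * (B + q * v ^+ 2) =
  A * B + (A * q * v ^+ 2 + u ^+ 2 / q * B) + u ^+ 2 * v ^+ 2 by field; rewrite gt_eqF.
suff : 2 * (S * (u * v)) <= A * q * v ^+ 2 + u ^+ 2 / q * B by nra.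
pose X := A * q * v ^+ 2; pose Y := u ^+ 2 / q * B.
have X0 : 0 <= X by apply: mulr_ge0 (sqr_ge0 _); exact: mulr_ge0 A0 (ltW q0).
have Y0 : 0 <= Y by apply: mulr_ge0 B0; exact: divr_ge0 (sqr_ge0 _) (ltW q0).
have XY : (S * (u * v)) ^+ 2 <= X * Y.
  rewrite exprMn [leRHS](_ : _ = A * B * (u * v) ^+ 2); last by rewrite /X /Y; field; rewrite gt_eqF.
  by rewrite ler_wpM2r // sqr_ge0.
rewrite -/X -/Y; move: XY; move: (S * (u * v)) => Z XY; clearbody X Y.
have [Z0|/ltW Z0] := leP Z 0; first by rewrite (le_trans _ (addr_ge0 X0 Y0)) // pmulr_rle0.
rewrite -(ler_pXn2r (n := 2)) ?nnegrE ?addr_ge0 ?mulr_ge0 //.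
by have := sqr_ge0 (X - Y); nra.
Qed.

Lemma weighted_CS (p : nat -> R) (u v : nat -> C) N : (forall k, 0 < p k) ->
  sqmod (\sum_(k < N) u k * v k) <=
  (\sum_(k < N) sqmod (u k) / p k) * (\sum_(k < N) p k * sqmod (v k)).
Proof.
move=> p0; apply: (@le_trans _ _ ((\sum_(k < N) normc (u k) * normc (v k)) ^+ 2)).
  rewrite -normc_sq ler_sqr ?nnegrE ?normc_ge0 ?sumr_ge0 //.
    by rewrite (le_trans (normc_sum _ _ _)) //; under eq_bigr do rewrite normcM.
  by move=> k _; rewrite mulr_ge0.
apply: (le_trans (@real_weighted_CS p (fun k => normc (u k)) (fun k => normc (v k)) N p0)).
under eq_bigr do rewrite normc_sq.
by under [X in _ * X <= _]eq_bigr do rewrite normc_sq.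
Qed.

Lemma csum_sqmod_le (u : nat -> C) l z (K : R) : csum u l ->
  (exists N0, forall N, (N0 <= N)%N -> sqmod (\sum_(k < N) u k - z) <= K) -> sqmod (l - z) <= K.
Proof.
move=> ul [N0 h]; have K0 : 0 <= K by exact: le_trans (sqmod_ge0 _) (h N0 (leqnn _)).
rewrite -normc_sq -(sqr_sqrtr K0) ler_sqr ?nnegrE ?normc_ge0 ?sqrtr_ge0 //.
apply/ler_addgt0Pr => e e0; have [N1 hN1] := ul e e0; pose N := maxn N0 N1.
have h1 : normc (\sum_(k < N) u k - z) <= Num.sqrt K.
  rewrite -(ler_sqr (x := normc _)) ?nnegrE ?normc_ge0 ?sqrtr_ge0 // normc_sq sqr_sqrtr //.
  by apply: h; rewrite leq_maxl.
have h2 : normc (l - \sum_(k < N) u k) <= e by rewrite normcB hN1 // leq_maxr.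
have := normcD (l - \sum_(k < N) u k) (\sum_(k < N) u k - z).
by rewrite addrA subrK; lra.
Qed.

End WeightedCauchySchwarz.

Section LocalDouglas.
Variable R : realType.
Local Notation C := R[i].
Variables (j : nat).
Implicit Types (be V : nat -> C).

(** [Q k] is the factor that the derivative of order j + 1 puts on the coefficient of index k + j +
    1; [D k] is the weight of the local energy for n = j + 1. *)
Let Q k : R := ((k + j.+1) ^_ j.+1)%:R.
Let D k : R := k`!%:R / (k + j.+1).+1`!%:R.

Let f0 m : 0 < m`!%:R :> R. Proof. by rewrite ltr0n fact_gt0. Qed.

Let Q_gt0 k : 0 < Q k.
Proof. by rewrite ltr0n ffact_gt0 leq_addl. Qed.

Let D_gt0 k : 0 < D k.
Proof. exact: divr_gt0. Qed.

Let QE k : Q k = (k + j.+1)`!%:R / k`!%:R.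
Proof.
apply: (mulIf (lt0r_neq0 (f0 k))); rewrite divfK ?lt0r_neq0 // -natrM; congr (_%:R).
by have := ffact_fact (leq_addl k j.+1); rewrite addnK.
Qed.

Let natD (x y : R) : 0 <= x -> 0 <= y -> (x + 1 != 0) * (x + y + 1 + 1 != 0) * (y + 1 != 0).
Proof. by move=> x0 y0; split; [split|]; rewrite gt_eqF //; lra. Qed.

Let kj k : (((k + j.+1).+1)%:R = k%:R + j%:R + 1 + 1 :> R) * ((k.+1)%:R = k%:R + 1 :> R) *
  ((j.+1)%:R = j%:R + 1 :> R).
Proof. by rewrite addnS -!natr1 natrD. Qed.

Let QS k : Q k.+1 = (k%:R + j%:R + 1 + 1) / (k%:R + 1) * Q k.
Proof.
have [[h1 h2] h3] := natD (ler0n R k) (ler0n R j).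
rewrite !QE addSn !factS !natrM !kj; field.
by rewrite h1 lt0r_neq0.
Qed.

Let Q0 : Q 0 = j.+1`!%:R. Proof. by rewrite /Q add0n ffactnn. Qed.

Let binE k : 'C(k.+1 + j, j)%:R = (k + j.+1)`!%:R / (j`!%:R * k.+1`!%:R) :> R.
Proof.
have := bin_fact (leq_addl k.+1 j); rewrite addnK => h.
have <- : 'C(k.+1 + j, j)%:R * (j`!%:R * k.+1`!%:R) = (k + j.+1)`!%:R :> R.
  by rewrite -!natrM h addSnnS.
by field; rewrite !lt0r_neq0.
Qed.

(** The energy weights telescope, so that the sum of [D k] from m on is at most 1 / ((j + 1)
    Q_m). *)
Let DE k : (j%:R + 1) * D k = (Q k)^-1 - (Q k.+1)^-1.
Proof.
have [[h1 h2] h3] := natD (ler0n R k) (ler0n R j).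
rewrite QS QE /D !factS !natrM !kj; field.
by rewrite h1 h2 !lt0r_neq0.
Qed.

(** One step of the telescoping in [telescope], read with x = S_k and y = be_(k + 1): then x - Q_k y
    = V_k and x + (Q_(k + 1) - Q_k) y = S_(k + 1). *)
Let quad k (x y : R) :
  D k / j`!%:R * (x - Q k * y) ^+ 2 + (x + (Q k.+1 - Q k) * y) ^+ 2 / (j.+1`!%:R * Q k.+1)
  - x ^+ 2 / (j.+1`!%:R * Q k) = 'C(k.+1 + j, j)%:R * y ^+ 2.
Proof.
have [[h1 h2] h3] := natD (ler0n R k) (ler0n R j).
rewrite binE QS QE /D !factS !natrM !kj; field.
by rewrite h1 h2 h3 !lt0r_neq0.
Qed.

Let quadC k (s b : C) :
  D k / j`!%:R * sqmod (s - (Q k)%:C%C * b) +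
  sqmod (s + (Q k.+1 - Q k)%:C%C * b) / (j.+1`!%:R * Q k.+1)
  - sqmod s / (j.+1`!%:R * Q k) = 'C(k.+1 + j, j)%:R * sqmod b.
Proof.
case: s b => s1 s2 [b1 b2]; rewrite /sqmod /= !mul0r !subr0 !addr0.
rewrite [RHS]mulrDr -(quad k s1 b1) -(quad k s2 b2); ring.
Qed.

(** For the V of [telescope], summation by parts makes this Q_0 be_0 plus the sum of (Q_i - Q_(i -
    1)) be_i over 1 <= i <= k. *)
Let S be V k : C := (Q k)%:C%C * be k.+1 + V k.

(* The exact local Douglas formula, with its boundary term. *)
Let telescope be V N :
  (forall k, V k = \sum_(i < k.+1) (Q i)%:C%C * (be i - be i.+1)) ->
  \sum_(k < N) D k / j`!%:R * sqmod (V k) + sqmod (S be V N) / (j.+1`!%:R * Q N) =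
  \sum_(k < N.+1) 'C(k + j, j)%:R * sqmod (be k).
Proof.
move=> hV; have VS k : V k.+1 = V k + (Q k.+1)%:C%C * (be k.+1 - be k.+2).
  by rewrite hV big_ord_recr /= -hV.
elim: N => [|N IH].
  rewrite big_ord0 add0r big_ord1 add0n binn mul1r /S hV big_ord1 /=.
  rewrite (_ : _ + _ = (Q 0)%:C%C * be 0%N); last by ring.
  rewrite sqmodM Q0 (_ : sqmod _ = j.+1`!%:R ^+ 2); last by rewrite /sqmod /= expr0n addr0.
  by field; rewrite lt0r_neq0.
rewrite big_ord_recr /= [RHS]big_ord_recr /= -IH -(quadC N (S be V N)).
have -> : S be V N - (Q N)%:C%C * be N.+1 = V N by rewrite /S addrC addKr.
have -> : S be V N.+1 = S be V N + (Q N.+1 - Q N)%:C%C * be N.+1.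
  by rewrite /S VS rmorphB /=; ring.
by ring.
Qed.

Lemma douglas_le be V N (M : R) :
  (forall k, V k = \sum_(i < k.+1) ((i + j.+1) ^_ j.+1)%:R * (be i - be i.+1)) ->
  (forall N, \sum_(k < N) 'C(k + j, j)%:R * sqmod (be k) <= M) ->
  \sum_(k < N) k`!%:R / (k + j.+1).+1`!%:R * sqmod (V k) <= j`!%:R * M.
Proof.
move=> hV hM; have hV' k : V k = \sum_(i < k.+1) (Q i)%:C%C * (be i - be i.+1).
  by rewrite hV; apply: eq_bigr => i _; rewrite rmorph_nat.
have := hM N.+1; rewrite -(telescope N hV') => h.
rewrite -ler_pdivrMl // mulr_sumr (le_trans _ h) //.
rewrite (eq_bigr (fun k : 'I_N => D k / j`!%:R * sqmod (V k))) => [|k _]; last by rewrite /D; ring.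
by rewrite lerDl divr_ge0 ?sqmod_ge0 // mulr_ge0 // ltW.
Qed.

(* The constant [b0] for which the boundary term of [telescope] disappears in the limit is
   the sum of (1/Q_k - 1/Q_(k+1)) V_k. *)
Lemma douglas_ge (al : nat -> C) V (E : R) :
  (forall k, V k = \sum_(i < k.+1) ((i + j.+1) ^_ j.+1)%:R * al i) ->
  (forall N, \sum_(k < N) k`!%:R / (k + j.+1).+1`!%:R * sqmod (V k) <= E) ->
  exists b0 : C, forall N,
    \sum_(k < N) 'C(k + j, j)%:R * sqmod (b0 - \sum_(i < k) al i) <= E / j`!%:R.
Proof.
move=> hV hE.
have E0 : 0 <= E by have := hE 0%N; rewrite big_ord0.
pose de k : R := (Q k)^-1 - (Q k.+1)^-1.
have de0 k : 0 < de k by rewrite /de -DE mulr_gt0 // ltr_wpDl.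
have sde N m : \sum_(k < m) de (N + k)%N = (Q N)^-1 - (Q (N + m))^-1.
  elim: m => [|m IH]; first by rewrite big_ord0 addn0 subrr.
  by rewrite big_ord_recr /= IH /de addnS; ring.
have sde_le N m : \sum_(k < m) de (N + k)%N <= (Q N)^-1.
  by rewrite sde lerBlDr lerDl invr_ge0 ltW.
have bV0 k : 0 <= D k * sqmod (V k) by apply: mulr_ge0 (sqmod_ge0 _); exact: ltW.
have [b0 hb0] : exists b0, csum (fun k => (de k)%:C%C * V k) b0.
  (* By 2 |V| <= 1 + |V|^2 the terms are at most half of de + (j + 1) D |V|^2, and both parts are
     summable. *)
  apply: (@asum_csum _ _ (((Q 0)^-1 + (j%:R + 1) * E) / 2)) => N.
  apply: (@le_trans _ _ (\sum_(k < N) (de k + (j%:R + 1) * (D k * sqmod (V k))) / 2)).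
    apply: ler_sum => k _; rewrite normcM normc_real (ger0_norm (ltW (de0 k))).
    rewrite mulrA DE -/(de k) -normc_sq ler_pdivlMr //.
    have := mulr_ge0 (ltW (de0 k)) (sqr_ge0 (normc (V k) - 1)); nra.
  rewrite -mulr_suml ler_pM2r ?invr_gt0 // big_split /= -mulr_sumr lerD //.
    by apply: (sde_le 0%N N).
  by rewrite ler_pM2l ?ltr_wpDl // hE.
exists b0 => N; pose be k := b0 - \sum_(i < k) al i.
have hV' k : V k = \sum_(i < k.+1) (Q i)%:C%C * (be i - be i.+1).
  rewrite hV; apply: eq_bigr => i _; rewrite rmorph_nat; congr (_ * _).
  by rewrite /be big_ord_recr /=; ring.
(* With this [b0], S_m is Q_m times the part of the series of [b0] from m on. *)
have SE m : S be V m = (Q m)%:C%C * (b0 - \sum_(k < m) (de k)%:C%C * V k).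
  elim: m => [|m IH].
    have be0 : be 0%N = b0 by rewrite /be big_ord0 subr0.
    by rewrite big_ord0 /S hV' big_ord1 /= be0; ring.
  have qm : (Q m)%:C%C != 0 :> C by rewrite fmorph_eq0 gt_eqF.
  have qm1 : (Q m.+1)%:C%C != 0 :> C by rewrite fmorph_eq0 gt_eqF.
  have e1 : be m.+1 = (b0 - \sum_(k < m) (de k)%:C%C * V k) - V m / (Q m)%:C%C.
    by apply: (mulfI qm); rewrite [RHS]mulrBr -IH /S mulrCA divff // mulr1 addrK.
  have e2 : V m.+1 = V m + (Q m.+1)%:C%C * (be m.+1 - be m.+2).
    by rewrite hV' big_ord_recr /= -hV'.
  rewrite big_ord_recr /= /S e2.
  rewrite (_ : _ + _ = (Q m.+1)%:C%C * be m.+1 + V m); last by ring.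
  rewrite e1 /de rmorphB /= !fmorphV /=; field.
  by rewrite !pnatr_eq0 -!lt0n !ffact_gt0 !leq_addl.
(* The boundary term is at most the energy not yet used, divided by j!. This is Cauchy-Schwarz with
   weights [D]: since de = (j + 1) D, the sum of de^2 / D from m on is at most (j + 1) / Q_m. *)
have Sle m : sqmod (S be V m) / (j.+1`!%:R * Q m) <=
    (E - \sum_(k < m) D k * sqmod (V k)) / j`!%:R.
  have h : sqmod (b0 - \sum_(k < m) (de k)%:C%C * V k) <=
      (j%:R + 1) / Q m * (E - \sum_(k < m) D k * sqmod (V k)).
    apply: (csum_sqmod_le hb0); exists m => M mM.
    rewrite -(subnKC mM) big_split_ord /= addrAC subrr add0r.
    apply: (le_trans (weighted_CS (fun k => (de (m + k)%N)%:C%C) (fun k => V (m + k)%N) (M - m)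
      (fun k => D_gt0 (m + k)))).
    apply: ler_pM.
    - by apply: sumr_ge0 => k _; apply: divr_ge0 (sqmod_ge0 _) _; exact: ltW.
    - by apply: sumr_ge0 => k _; exact: bV0.
    - rewrite (eq_bigr (fun k : 'I__ => (j%:R + 1) * de (m + k)%N)) => [|k _].
        by rewrite -mulr_sumr; apply: ler_wpM2l (sde_le _ _); rewrite addr_ge0.
      rewrite /de -DE /sqmod /= expr0n addr0; field; rewrite lt0r_neq0 //; exact: D_gt0.
    - rewrite lerBrDl; have := hE (m + (M - m))%N; rewrite big_split_ord /=; exact: le_trans.
  rewrite SE sqmodM factS natrM -natr1.
  rewrite (_ : sqmod (Q m)%:C%C = Q m ^+ 2); last by rewrite /sqmod /= expr0n addr0.
  have j1 : 0 < j%:R + 1 :> R by rewrite ltr_wpDl.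
  rewrite ler_pdivrMr; last by apply: mulr_gt0 => //; apply: mulr_gt0.
  apply: (le_trans (ler_wpM2l (sqr_ge0 _) h)); rewrite le_eqVlt; apply/orP; left; apply/eqP.
  by field; rewrite lt0r_neq0 ?f0 // lt0r_neq0 ?Q_gt0.
apply: (@le_trans _ _ (\sum_(k < N.+1) 'C(k + j, j)%:R * sqmod (be k))).
  by rewrite big_ord_recr lerDl mulr_ge0 ?sqmod_ge0.
rewrite -(telescope N hV'); apply: (le_trans (lerD (lexx _) (Sle N))).
rewrite (eq_bigr (fun k : 'I_N => (D k * sqmod (V k)) / j`!%:R)) => [|k _]; last by ring.
by rewrite -mulr_suml -mulrDl addrCA subrr addr0.
Qed.

End LocalDouglas.

(** * Local energies and tails at a boundary point *)

Section BoundaryTails.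
Variable R : realType.
Local Notation C := R[i].
Implicit Types (a : nat -> C) (l : C).

Definition tail (al : C) a l m : C := al - \sum_(i < m.+1) a i * l ^+ i.

(** The bound [local_energy a j.+1 l <= E], phrased through real partial sums. *)
Definition local_le j a l (E : R) := forall N,
  \sum_(k < N) k`!%:R / (k + j.+1).+1`!%:R * sqmod (local_coef a j.+1 l k) <= E.

Let sqmod1 l n : normc l = 1 -> sqmod (l ^+ n) = 1.
Proof. by move=> l1; rewrite -normc_sq normcX l1 !expr1n. Qed.

(** The factor l^(j + 1), of modulus 1, aligns the powers of l with the indices of a. *)
Let local_coefE a j l k : local_coef a j.+1 l k * l ^+ j.+1 =
  \sum_(i < k.+1) ((i + j.+1) ^_ j.+1)%:R * (a (i + j.+1)%N * l ^+ (i + j.+1)).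
Proof.
rewrite /local_coef mulr_suml; apply: eq_bigr => i _.
rewrite exprD -[a _ *+ _]mulr_natl; ring.
Qed.

Let tailE al a l j k : tail al a l (k + j) =
  al - \sum_(i < j.+1) a i * l ^+ i - \sum_(i < k) a (i + j.+1)%N * l ^+ (i + j.+1).
Proof.
rewrite /tail -addnS addnC big_split_ord opprD addrA.
congr (_ - _); apply: eq_bigr => i _.
by rewrite /= addnC.
Qed.

Let local_sqmod a j l k : normc l = 1 ->
  sqmod (local_coef a j.+1 l k * l ^+ j.+1) = sqmod (local_coef a j.+1 l k).
Proof. by move=> l1; rewrite sqmodM sqmod1 // mulr1. Qed.

Lemma local_tail a j l (E : R) : normc l = 1 ->
  local_le j a l E ->
  exists al, forall N, \sum_(k < N) 'C(k + j, j)%:R * sqmod (tail al a l (k + j)) <= E / j`!%:R.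
Proof.
move=> l1 hE; have [N|b0 hb] := @douglas_ge R j (fun i => a (i + j.+1)%N * l ^+ (i + j.+1))
  (fun k => local_coef a j.+1 l k * l ^+ j.+1) E (local_coefE a j l).
  by under eq_bigr do rewrite local_sqmod //.
(* The Douglas formula sees only the coefficients from index j + 1 on; the first j + 1 terms are put
   back. *)
exists (b0 + \sum_(i < j.+1) a i * l ^+ i) => N.
by under eq_bigr do rewrite tailE addrK.
Qed.

Lemma tail_local al a j l (M : R) : normc l = 1 ->
  (forall N, \sum_(k < N) 'C(k + j, j)%:R * sqmod (tail al a l (k + j)) <= M) ->
  local_le j a l (j`!%:R * M).
Proof.
move=> l1 hM N; under eq_bigr do rewrite -local_sqmod //.
apply: (@douglas_le R j (fun k => tail al a l (k + j)) (fun k => local_coef a j.+1 l k * l ^+ j.+1)) => // k.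
rewrite local_coefE; apply: eq_bigr => i _; congr (_ * _).
by rewrite !tailE [\sum_(_ < i.+1) _]big_ord_recr /=; ring.
Qed.

End BoundaryTails.

(** * Bounds for multipliers *)

Section UniformBoundedness.
Variable R : realType.
Local Notation C := R[i].
Implicit Types (a x y z : nat -> C).
Variable w : nat -> R.
Hypothesis w_gt0 : forall k, 0 < w k.

Definition wnorm x N : R := \sum_(k < N) w k * sqmod (x k).

Definition wbounded x := exists M, forall N, wnorm x N <= M.

Lemma wterm_ge0 x k : 0 <= w k * sqmod (x k).
Proof. by apply: mulr_ge0 (sqmod_ge0 _); exact: ltW. Qed.

Lemma wnorm_ge0 x N : 0 <= wnorm x N.
Proof. by apply: sumr_ge0 => k _; exact: wterm_ge0. Qed.

Lemma wnorm_homo x N N' : (N <= N')%N -> wnorm x N <= wnorm x N'.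
Proof.
move=> /subnKC <-; rewrite /wnorm big_split_ord lerDl.
by apply: sumr_ge0 => k _; exact: wterm_ge0.
Qed.

Lemma eq_wnorm x y N : (forall k, (k < N)%N -> x k = y k) -> wnorm x N = wnorm y N.
Proof. by move=> xy; apply: eq_bigr => k _; rewrite xy. Qed.

Lemma wnormD x y N : wnorm (fun k => x k + y k) N <= 2 * (wnorm x N + wnorm y N).
Proof.
rewrite /wnorm -big_split mulr_sumr; apply: ler_sum => k _ /=.
by rewrite -mulrDr mulrCA ler_pM2l // sqmodD_le.
Qed.

Lemma wnormZ (c : C) x N : wnorm (fun k => c * x k) N = sqmod c * wnorm x N.
Proof. by rewrite /wnorm mulr_sumr; apply: eq_bigr => k _; rewrite sqmodM mulrCA. Qed.

Lemma wbounded_finite x K : (forall k, (K <= k)%N -> x k = 0) -> wbounded x.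
Proof.
move=> x0; exists (wnorm x K) => N; apply: (le_trans (wnorm_homo _ (leq_maxr K N))).
rewrite -{1}(subnKC (leq_maxl K N)) /wnorm big_split_ord /= [X in _ + X]big1 ?addr0 // => k _.
by rewrite x0 ?leq_addr // /sqmod /= expr0n addr0 mulr0.
Qed.

Definition cut K x k : C := if (k < K)%N then x k else 0.

Lemma wnorm_cut x K N : wnorm (cut K x) N <= wnorm x K.
Proof.
have -> : wnorm x K = wnorm (cut K x) K by apply: eq_wnorm => k kK; rewrite /cut kK.
have [NK|/ltnW KN] := leqP N K; first exact: wnorm_homo.
rewrite -(subnKC KN) /wnorm big_split_ord /= [X in _ + X]big1 ?addr0 // => k _.
by rewrite /cut ltnNge leq_addr /sqmod /= expr0n addr0 mulr0.
Qed.

(** Causality: the coefficients of a product below N depend only on those of the factors below N,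
    which is why truncated norms can be compared at the same N. *)
Lemma conv_causal a x y k : (forall i, (i <= k)%N -> x i = y i) -> conv a x k = conv a y k.
Proof. by move=> xy; apply: eq_bigr => i _; rewrite xy // leq_subr. Qed.

Lemma convD a x y k : conv a (fun i => x i + y i) k = conv a x k + conv a y k.
Proof. by rewrite /conv -big_split; apply: eq_bigr => i _; rewrite mulrDr. Qed.

Lemma convZ a (c : C) x k : conv a (fun i => c * x i) k = c * conv a x k.
Proof. by rewrite /conv mulr_sumr; apply: eq_bigr => i _; rewrite mulrCA. Qed.

Variable a : nat -> C.
Hypothesis aB : forall x, wbounded x -> wbounded (conv a x).

(** On sequences supported below K the operator is bounded because each unit vector has an image of
    finite norm; the bound depends on K. *)
Let cut_bound K : exists2 B, 0 <= B & forall x N, wnorm (conv a (cut K x)) N <= B * wnorm x K.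
Proof.
elim: K => [|K [B B0 hB]].
  exists 0 => // x N; rewrite mul0r /wnorm big1 // => k _.
  rewrite /conv big1 => [|i _]; last by rewrite /cut ltn0 mulr0.
  by rewrite /sqmod /= expr0n addr0 mulr0.
have [M hM] : wbounded (conv a (fun k => (k == K)%:R)).
  by apply/aB/(@wbounded_finite _ K.+1) => k Kk; rewrite gtn_eqF.
have M0 : 0 <= M := le_trans (wnorm_ge0 _ _) (hM 0%N).
exists (2 * (B + M / w K)) => [|x N].
  by apply: mulr_ge0 => //; apply: addr_ge0 => //; apply: divr_ge0 => //; exact: ltW.
have -> : conv a (cut K.+1 x) =
    (fun k => conv a (cut K x) k + x K * conv a (fun k => (k == K)%:R) k).
  apply: funext => k; rewrite -convZ -convD; apply: conv_causal => i _.
  rewrite /cut ltnS leq_eqVlt; case: eqP => [->|_] /=; first by rewrite ltnn mulr1 add0r.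
  by rewrite mulr0 addr0.
apply: (le_trans (wnormD _ _ _)); rewrite -mulrA ler_pM2l // wnormZ [in leRHS]/wnorm big_ord_recr /=.
rewrite -/(wnorm x K).
have -> : (B + M / w K) * (wnorm x K + w K * sqmod (x K)) =
  (B * wnorm x K + sqmod (x K) * M) + (B * (w K * sqmod (x K)) + M / w K * wnorm x K).
  by field; rewrite gt_eqF.
rewrite -[leLHS]addr0; apply: lerD.
  by apply: lerD => //; apply: ler_wpM2l => //; exact: sqmod_ge0.
apply: addr_ge0; apply: mulr_ge0 => //; [exact: wterm_ge0|exact: divr_ge0 (ltW _)|exact: wnorm_ge0].
Qed.

(** One hump: a finitely supported x is extended beyond K at a cost 2^-i in squared norm, and the
    image of the result has squared norm at least i. *)
Let step (i : nat) x K :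
  (forall C, exists z N, C * wnorm z N < wnorm (conv a z) N) ->
  (forall k, (K <= k)%N -> x k = 0) ->
  exists x' K', [/\ (K < K')%N, (forall k, (k < K)%N -> x' k = x k),
    (forall k, (K' <= k)%N -> x' k = 0), wnorm x' K' <= wnorm x K + 2^-1 ^+ i &
    i%:R <= wnorm (conv a x') K'].
Proof.
move=> unb x0; have [B B0 hB] := cut_bound K.
have [m hm] := aB (wbounded_finite x0).
have m0 : 0 <= m := le_trans (wnorm_ge0 _ _) (hm 0%N).
pose h : R := 2^-1 ^+ i; have h0 : 0 < h by rewrite exprn_gt0 // invr_gt0.
(* The block t z has squared norm h = 2^-i, so its image exceeds 4 (i + m + h B). Of this, m pays
   for the image of the old x and h B for the part of z below K; the 4 comes from two uses of
   [wnormD]. *)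
have [z [N hz]] := unb (4 * (h^-1 * (i%:R + m) + B)).
have zN0 : 0 < wnorm z N.
  rewrite lt_neqAle wnorm_ge0 andbT; apply/eqP => /esym z0.
  have zk0 k : (k < N)%N -> z k = 0.
    move=> kN; have : wnorm z k.+1 <= 0 by rewrite -z0 wnorm_homo.
    rewrite /wnorm big_ord_recr /= -/(wnorm z k) => hk; apply/eqP.
    rewrite -normc_eq0 -sqrf_eq0 normc_sq.
    have := wnorm_ge0 z k; have := wterm_ge0 z k => h1 h2.
    have : w k * sqmod (z k) = 0 by apply/eqP; rewrite eq_le h1; lra.
    by move/eqP; rewrite mulf_eq0 gt_eqF.
  move: hz; rewrite z0 mulr0 /wnorm big1 ?ltxx // => k _.
  rewrite /conv big1 => [|l _]; last first.
    by rewrite zk0 ?mulr0 // (leq_ltn_trans (leq_subr _ _)).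
  by rewrite /sqmod /= expr0n addr0 mulr0.
pose t : R := Num.sqrt (h / wnorm z N).
have t2 : sqmod t%:C%C = h / wnorm z N.
  by rewrite /sqmod /= expr0n addr0 sqr_sqrtr // divr_ge0 // ltW.
pose x' k : C := if (k < K)%N then x k else if (k < N)%N then t%:C%C * z k else 0.
exists x', (maxn N K.+1); split => [|k kK|k||].
- exact: leq_maxr.
- by rewrite /x' kK.
- by rewrite geq_max => /andP[Nk Kk]; rewrite /x' !ltnNge Nk (ltnW Kk).
  rewrite [2^-1 ^+ i](_ : _ = sqmod t%:C%C * wnorm z N); last by rewrite t2 divfK ?gt_eqF.
  rewrite -wnormZ /wnorm (big_ord_widen (maxn N K.+1) (fun k => w k * sqmod (x k)) (ltnW (leq_maxr N K.+1))).
  rewrite (big_ord_widen (maxn N K.+1) (fun k => w k * sqmod (t%:C%C * z k)) (leq_maxl N K.+1)).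
  rewrite [X in X + _]big_mkcond [X in _ + X]big_mkcond -big_split; apply: ler_sum => k _ /=.
  have tz := wterm_ge0 (fun k => t%:C%C * z k) k; rewrite /x'.
  case: ifP => kK; first by rewrite lerDl; case: ifP.
  by case: ifP => kN; rewrite ?add0r // /sqmod /= expr0n !addr0 mulr0.
apply: le_trans (wnorm_homo _ (leq_maxl N K.+1)).
(* Below N one has t z = x' - x + t (z cut at K). *)
have e : wnorm (fun k => t%:C%C * conv a z k) N =
  wnorm (fun k => (conv a x' k + -1 * conv a x k) + t%:C%C * conv a (cut K z) k) N.
  apply: eq_wnorm => k kN; rewrite -!convZ -!convD; apply: conv_causal => l lk.
  rewrite /x' /cut; case: ifP => lK; first by rewrite mulN1r subrr add0r.
  by rewrite (leq_ltn_trans lk kN) x0 1?leqNgt ?lK // !mulr0 !addr0.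
have s1 : sqmod (-1 : C) = 1 by rewrite -normc_sq normcN normc1 expr1n.
have := wnormD (fun k => conv a x' k + -1 * conv a x k) (fun k => t%:C%C * conv a (cut K z) k) N.
have := wnormD (conv a x') (fun k => -1 * conv a x k) N.
rewrite -e !wnormZ s1 mul1r t2 => h1 h2.
have h3 : h / wnorm z N * wnorm (conv a (cut K z)) N <= h * B.
  have -> : wnorm (conv a (cut K z)) N = wnorm (conv a (cut K (cut N z))) N.
    apply: eq_wnorm => k kN; apply: conv_causal => l lk.
    by rewrite /cut (leq_ltn_trans lk kN).
  rewrite -mulrA ler_pM2l // mulrC ler_pdivrMr // (le_trans (hB _ _)) // ler_wpM2l //.
  exact: wnorm_cut.
have h4 : 4 * (i%:R + m + h * B) < h / wnorm z N * wnorm (conv a z) N.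
  rewrite -mulrA -ltr_pdivrMl // mulrC [ltRHS]mulrC ltr_pdivlMr //.
  apply: le_lt_trans hz; rewrite le_eqVlt; apply/orP; left; apply/eqP; field; rewrite gt_eqF //.
have := hm N; have := mulr_ge0 (ltW h0) B0; lra.
Qed.

(* A gliding hump: the blocks of x are disjoint, so that each coordinate of conv a x below K_i only
   sees the first i blocks. *)
Lemma conv_uniform_bound :
  exists2 M : R, 0 <= M & forall z N, wnorm (conv a z) N <= M * wnorm z N.
Proof.
have [[B hB]|unb] := pselect (exists B : R, forall z N, wnorm (conv a z) N <= B * wnorm z N).
  exists `|B| => // z N; apply: (le_trans (hB z N)).
  by rewrite ler_wpM2r ?wnorm_ge0 // ler_norm.
have {}unb (B : R) : exists z N, B * wnorm z N < wnorm (conv a z) N.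
  apply: contra_notP unb => h; exists B => z N; rewrite leNgt; apply/negP => h'.
  by apply: h; exists z, N.
pose P (s : nat * ((nat -> C) * nat)) (s' : (nat -> C) * nat) :=
  (forall k, (s.2.2 <= k)%N -> s.2.1 k = 0) ->
  [/\ (s.2.2 < s'.2)%N, (forall k, (k < s.2.2)%N -> s'.1 k = s.2.1 k),
    (forall k, (s'.2 <= k)%N -> s'.1 k = 0),
    wnorm s'.1 s'.2 <= wnorm s.2.1 s.2.2 + 2^-1 ^+ s.1 & s.1%:R <= wnorm (conv a s'.1) s'.2].
have [F hF] : {F & forall s, P s (F s)}.
  apply: choice => -[i [x K]]; rewrite /P /=.
  have [x0|x0] := pselect (forall k, (K <= k)%N -> x k = 0); last by exists (x, K).
  by have [x' [K' h]] := step i unb x0; exists (x', K').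
pose fix s i := if i is i'.+1 then F (i', s i') else (fun=> 0, 0%N).
have s0 i k : ((s i).2 <= k)%N -> (s i).1 k = 0.
  by elim: i k => [//|i IH] k; have [_ _ + _ _] := hF (i, s i) IH; apply.
have sP i := hF (i, s i) (s0 i).
have sK i : (i <= (s i).2)%N.
  by elim: i => [//|i IH]; have [+ _ _ _ _] := sP i; exact: leq_ltn_trans.
have sKD i m : ((s i).2 <= (s (i + m)%N).2)%N.
  elim: m => [|m IH]; first by rewrite addn0.
  by rewrite addnS; have [/ltnW + _ _ _ _] := sP (i + m)%N; exact: leq_trans.
have sE i m k : (k < (s i).2)%N -> (s (i + m)%N).1 k = (s i).1 k.
  move=> ki; elim: m => [|m IH]; first by rewrite addn0.
  rewrite addnS -IH; have [_ + _ _ _] := sP (i + m)%N; apply.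
  exact: leq_trans (sKD _ _).
(* The limit of the stages: later stages do not change entry k, because k < k + 1 <= K_(k + 1). *)
pose x k := (s k.+1).1 k.
have xE i k : (k < (s i).2)%N -> x k = (s i).1 k.
  move=> ki; rewrite /x; have [ik|/ltnW ki'] := leqP i k.+1.
    by rewrite -(subnKC ik) sE.
  by rewrite -(subnKC ki') sE //; exact: sK.
have x2 i : wnorm (s i).1 (s i).2 <= 2 - 2 * 2^-1 ^+ i.
  elim: i => [|i IH]; first by rewrite /wnorm /= big_ord0 expr0; lra.
  have [_ _ _ + _] := sP i => /= /le_trans; apply.
  rewrite exprS; lra.
have [M hM] : wbounded (conv a x).
  apply: aB; exists 2 => N; apply: (le_trans (wnorm_homo _ (sK N))).
  rewrite (eq_wnorm (xE N)) (le_trans (x2 N)) // gerBl mulr_ge0 // exprn_ge0 //.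
have := archi_boundP (le_trans (wnorm_ge0 _ _) (hM 0%N)); set i := Num.bound _.
rewrite ltNge => /negP[]; have [_ _ _ _ /= hi] := sP i.
apply: le_trans (hM (s i.+1).2); rewrite (le_trans hi) // le_eqVlt; apply/orP; left; apply/eqP.
apply: eq_wnorm => k kN; apply: conv_causal => l lk; rewrite (@xE i.+1) //.
exact: leq_ltn_trans lk kN.
Qed.

End UniformBoundedness.

Section MultiplierBounds.
Variable R : realType.
Local Notation C := R[i].
Implicit Types (a x : nat -> C) (f : C -> C) (l z : C).

(* Testing the multiplier against the reproducing kernel at z. *)
Lemma sup_bound (w : nat -> R) f a (B : R) z : (forall k, 1 <= w k) -> has_ps f a ->
  (forall x N, wnorm w (conv a x) N <= B * wnorm w x N) -> normc z < 1 -> sqmod (f z) <= B.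
Proof.
move=> w1 fa aB z1; have w0 k : 0 < w k by exact: lt_le_trans (w1 k).
(* The coefficients of the kernel at z; [S N] is both its truncated squared norm and its truncated
   value at z. From w >= 1 these coefficients define a power series on the disc. *)
pose x k : C := (w k)^-1%:C%C * (z^* ^+ k)%C.
pose S N := \sum_(k < N) (w k)^-1 * sqmod z ^+ k.
have xS N : wnorm w x N = S N.
  apply: eq_bigr => k _; rewrite sqmodM -!normc_sq normcX normc_real.
  rewrite (_ : normc (z^*)%C = normc z); last by case: z {z1 x S} => u v; rewrite /= sqrrN.
  rewrite ger0_norm ?invr_ge0 ?(ltW (w0 k)) // [in RHS]exprAC; field; rewrite gt_eqF //.
have SE N : \sum_(k < N) x k * z ^+ k = (S N)%:C%C.
  rewrite rmorph_sum; apply: eq_bigr => k _; rewrite /x -mulrA -exprMn rmorphM rmorphXn.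
  congr (_ * _ ^+ _); case: z {z1 x S xS} => u v; rewrite /sqmod /=.
  by apply/eqP; rewrite eq_complex /=; apply/andP; split; apply/eqP; ring.
have S_homo N N' : (N <= N')%N -> S N <= S N'.
  by move=> NN; rewrite -!xS wnorm_homo.
have xps : has_ps (psum x) x.
  apply: psumP => r r0 r1; exists (1 - r)^-1 => N.
  apply: le_trans (geom_bound N r0 r1); apply: ler_sum => k _.
  rewrite ler_piMl ?exprn_ge0 // normcM normc_real normcX.
  rewrite (_ : normc (z^*)%C = normc z); last by case: z {z1 x S xS SE S_homo} => u v; rewrite /= sqrrN.
  rewrite ger0_norm ?invr_ge0 ?(ltW (w0 k)) // mulr_ile1 ?invr_ge0 ?(ltW (w0 k)) ?exprn_ge0 //.
  - exact: normc_ge0.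
  - by rewrite invf_le1.
  - by rewrite exprn_ile1 ?normc_ge0 // ltW.
pose G := psum x z.
have SG N : S N <= normc G.
  apply/ler_addgt0Pr => e e0; have [N1 hN1] := xps z z1 e e0.
  have := hN1 _ (leq_maxr N N1); rewrite SE => h.
  apply: (le_trans (S_homo _ _ (leq_maxl N N1))).
  apply: (le_trans (ler_norm _)); rewrite -normc_real.
  have := normcD ((S (maxn N N1))%:C%C - G) G; rewrite subrK; move: h; rewrite -/G; lra.
have S0 N : 0 <= S N by rewrite -xS wnorm_ge0.
have B0 : 0 <= B.
  have := aB x 1%N; have := wnorm_ge0 w0 (conv a x) 1; rewrite xS /S big_ord1 expr0 mulr1 => h1 h2.
  by have := le_trans h1 h2; rewrite pmulr_lge0 // invr_gt0.
(* By Cauchy-Schwarz the partial sums of f G at z have squared modulus at most S_N times the norm of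
   [conv a x], hence at most B S_N^2; dividing by |G|^2 > 0 then removes the kernel. *)
have h : sqmod (f z * G) <= B * normc G ^+ 2.
  rewrite -[f z * G]subr0; apply: (csum_sqmod_le (has_psM fa xps z1)); exists 0%N => N _; rewrite subr0.
  under eq_bigr do rewrite mulrC.
  apply: (le_trans (weighted_CS (fun k => z ^+ k) (conv a x) N w0)).
  have -> : \sum_(k < N) sqmod (z ^+ k) / w k = S N.
    by apply: eq_bigr => k _; rewrite -normc_sq normcX exprAC normc_sq mulrC.
  apply: (le_trans (ler_wpM2l (S0 N) (aB x N))); rewrite xS mulrCA ler_wpM2l //.
  by rewrite expr2 ler_pM.
have G0 : 0 < normc G.
  by apply: lt_le_trans (SG 1%N); rewrite /S big_ord1 expr0 mulr1 invr_gt0.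
by move: h; rewrite sqmodM -[sqmod G]normc_sq ler_pM2r // exprn_gt0.
Qed.

Lemma tail_abel al a l (r : C) N :
  (1 - r) * \sum_(k < N.+1) tail al a l k * r ^+ k =
  al - \sum_(k < N.+1) a k * (l * r) ^+ k - tail al a l N * r ^+ N.+1.
Proof.
elim: N => [|N IH].
  by rewrite /tail !big_ord1 !expr0 expr1; ring.
rewrite big_ord_recr mulrDr IH [in RHS]big_ord_recr /= exprMn.
have -> : tail al a l N.+1 = tail al a l N - a N.+1 * l ^+ N.+1.
  by rewrite /tail [in LHS]big_ord_recr /=; ring.
by rewrite !exprS; ring.
Qed.

(* By Abel summation, [al] is the radial limit of f at l. *)
Lemma tail_radial f a al l (B M : R) : normc l = 1 -> has_ps f a ->
  (forall z, normc z < 1 -> sqmod (f z) <= B) ->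
  (forall N, \sum_(k < N) sqmod (tail al a l k) <= M) -> sqmod al <= B.
Proof.
move=> l1 fa fB hM; set t := tail al a l.
have M0 : 0 <= M by have := hM 0%N; rewrite big_ord0.
have B0 : 0 <= B by apply: le_trans (sqmod_ge0 _) (fB 0 _); rewrite normc0.
have tM k : sqmod (t k) <= M.
  by apply: le_trans (hM k.+1); rewrite big_ord_recr lerDr sumr_ge0 // => i _; exact: sqmod_ge0.
(* In [tail_abel], Cauchy-Schwarz bounds the squared main part by (1 - r) M. The last term is made
   equally small by taking N with r^(N + 1) <= 1 - r, and [sqmodD_le] doubles the sum. *)
have key (r : R) : 0 <= r -> r < 1 -> sqmod (f (l * r%:C%C) - al) <= 4 * (1 - r) * M.
  move=> r0 r1; have lr : normc (l * r%:C%C) < 1.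
    by rewrite normcM l1 mul1r normc_real ger0_norm.
  have e0 : 0 < 1 - r by rewrite subr_gt0.
  apply: (csum_sqmod_le (fa _ lr)).
  have /cvgrPdist_le /(_ _ e0) [N0 _ hN0] : r ^+ n @[n --> \oo] --> (0 : R).
    by apply: cvg_expr; rewrite ger0_norm.
  exists N0.+1 => -[//|N] N0N.
  have rN : r ^+ N.+1 <= 1 - r.
    have := hN0 N.+1 (leq_trans (leqnSn _) N0N); rewrite /= sub0r normrN ger0_norm //.
    exact: exprn_ge0.
  have -> : \sum_(k < N.+1) a k * (l * r%:C%C) ^+ k - al =
      - ((1 - r%:C%C) * \sum_(k < N.+1) t k * r%:C%C ^+ k + t N * r%:C%C ^+ N.+1).
    by rewrite tail_abel -/t; ring.
  rewrite -normc_sq normcN normc_sq (le_trans (sqmodD_le _ _)) //.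
  rewrite !sqmodM.
  have -> : sqmod (1 - r%:C%C) = (1 - r) ^+ 2 by rewrite /sqmod /= subr0 expr0n addr0.
  have -> : sqmod (r%:C%C ^+ N.+1) = (r ^+ N.+1) ^+ 2.
    by rewrite -normc_sq normcX normc_real ger0_norm.
  have h1 : (r ^+ N.+1) ^+ 2 <= 1 - r.
    rewrite expr2 (le_trans _ rN) // ler_piMl ?exprn_ge0 // (le_trans rN) //; lra.
  have h2 : sqmod (\sum_(k < N.+1) t k * r%:C%C ^+ k) <= M * (1 - r)^-1.
    under eq_bigr do rewrite mulrC.
    apply: (le_trans (weighted_CS (fun k => r%:C%C ^+ k) t N.+1 (fun=> ltr01))).
    rewrite mulrC; apply: ler_pM.
    - by apply: sumr_ge0 => k _; rewrite mul1r sqmod_ge0.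
    - by apply: sumr_ge0 => k _; rewrite divr1 sqmod_ge0.
    - by under eq_bigr do rewrite mul1r.
    - apply: le_trans (geom_bound N.+1 r0 r1); apply: ler_sum => k _.
      rewrite divr1 -normc_sq normcX normc_real ger0_norm // expr2 ler_piMl ?exprn_ge0 //.
      by rewrite exprn_ile1 // ltW.
  have h3 : (1 - r) ^+ 2 * sqmod (\sum_(k < N.+1) t k * r%:C%C ^+ k) <= (1 - r) * M.
    apply: (le_trans (ler_wpM2l (sqr_ge0 _) h2)); rewrite le_eqVlt; apply/orP; left; apply/eqP.
    by field; rewrite gt_eqF.
  have h4 : sqmod (t N) * (r ^+ N.+1) ^+ 2 <= M * (1 - r).
    by apply: ler_pM => //; [exact: sqmod_ge0|exact: sqr_ge0].
  lra.
rewrite -normc_sq -(sqr_sqrtr B0) ler_sqr ?nnegrE ?normc_ge0 ?sqrtr_ge0 //.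
apply/ler_addgt0Pr => e e0.
(* Chosen for 4 d M <= e^2 and 0 < d <= 1, with r = 1 - d. *)
pose d := e ^+ 2 / (4 * M + e ^+ 2 + 1).
have e2 : 0 < e ^+ 2 by rewrite exprn_gt0.
have q0 : 0 < 4 * M + e ^+ 2 + 1 by lra.
have d0 : 0 < d by rewrite divr_gt0.
have d1 : d <= 1 by rewrite /d ler_pdivrMr //; lra.
have dM : 4 * d * M <= e ^+ 2 by rewrite /d mulrAC [_ * (_ / _)]mulrA ler_pdivrMr //; nra.
have := key (1 - d) ltac:(lra) ltac:(lra); rewrite subKr => h.
have lr : normc (l * (1 - d)%:C%C) < 1.
  by rewrite normcM l1 mul1r normc_real ger0_norm; lra.
have h1 : normc (f (l * (1 - d)%:C%C) - al) <= e.
  by rewrite -ler_sqr ?nnegrE ?normc_ge0 ?(ltW e0) // normc_sq (le_trans h).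
have h2 : normc (f (l * (1 - d)%:C%C)) <= Num.sqrt B.
  by rewrite -ler_sqr ?nnegrE ?normc_ge0 ?sqrtr_ge0 // normc_sq sqr_sqrtr // fB.
have := normcD (f (l * (1 - d)%:C%C)) (al - f (l * (1 - d)%:C%C)).
rewrite addrCA subrr addr0 [normc (al - _)]normcB; lra.
Qed.

End MultiplierBounds.

(** * Products *)

Section LocalProduct.
Variable R : realType.
Local Notation C := R[i].
Implicit Types (a x : nat -> C) (f : C -> C) (l z : C).

Lemma conv_sum x y m : \sum_(k < m.+1) conv x y k =
  \sum_(i < m.+1) x i * \sum_(k < (m - i).+1) y k :> C.
Proof.
elim: m => [|m IH]; first by rewrite !big_ord1 /conv !big_ord1.
rewrite big_ord_recr /= IH [in RHS]big_ord_recr /= subnn big_ord1.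
rewrite /conv [X in _ + X]big_ord_recr /= subnn addrA; congr (_ + _).
rewrite -big_split /=; apply: eq_bigr => i _; rewrite -mulrDr; congr (_ * _).
by rewrite subSn -1?ltnS // [RHS]big_ord_recr.
Qed.

(* If f - al and g - al' are (z - l) times series with coefficients l^-(k+1) tail_k, then this is
   fg - al al' = f (g - al') + al' (f - al). *)
Lemma tail_conv al al' a a' l m : l != 0 ->
  tail (al * al') (conv a a') l m =
  l ^+ m.+1 * conv a (fun k => l ^- k.+1 * tail al' a' l k) m + al' * tail al a l m.
Proof.
move=> l0.
have cl k : conv a a' k * l ^+ k = conv (fun i => a i * l ^+ i) (fun i => a' i * l ^+ i) k.
  rewrite /conv mulr_suml; apply: eq_bigr => i _.
  have ik : (i <= k)%N by rewrite -ltnS.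
  by rewrite -[in l ^+ k](subnKC ik) exprD; ring.
have -> : l ^+ m.+1 * conv a (fun k => l ^- k.+1 * tail al' a' l k) m =
    \sum_(i < m.+1) (a i * l ^+ i) * tail al' a' l (m - i).
  rewrite /conv mulr_sumr; apply: eq_bigr => i _.
  have im : (i <= m)%N by rewrite -ltnS.
  rewrite (_ : l ^+ m.+1 = l ^+ i * l ^+ (m - i).+1); last by rewrite -exprD addnS subnKC.
  by field; rewrite expf_neq0.
rewrite {1}/tail; under eq_bigr do rewrite cl; rewrite conv_sum.
under [X in _ = X + _]eq_bigr do rewrite /tail mulrBr; rewrite sumrB -mulr_suml.
by rewrite /tail; ring.
Qed.

Variable j : nat.

(** The summand 1 keeps the weight positive for k < j, where the binomial vanishes. For k >= j the
    weight is at most twice the binomial, whence the factor 2 in [wnorm_tail]. *)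
Definition wght k : R := 1 + 'C(k, j)%:R.

Lemma wght_ge1 k : 1 <= wght k. Proof. by rewrite lerDl. Qed.

Lemma wght_gt0 k : 0 < wght k. Proof. exact: lt_le_trans (wght_ge1 k). Qed.

Let shift_sum (x : nat -> R) N :
  \sum_(k < N + j) 'C(k, j)%:R * x k = \sum_(k < N) 'C(k + j, j)%:R * x (k + j)%N.
Proof.
rewrite addnC big_split_ord /= big1 ?add0r => [|k _]; last by rewrite bin_small // mul0r.
by apply: eq_bigr => k _; rewrite addnC.
Qed.

(* The weight 'C(k, j) vanishes for [k < j]: these tails are bounded directly, uniformly in l. *)
Let tail_small a (B : R) : exists2 K, 0 <= K & forall al l, normc l = 1 -> sqmod al <= B ->
  \sum_(k < j) sqmod (tail al a l k) <= K.
Proof.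
exists (\sum_(k < j) 2 * (`|B| + (\sum_(i < k.+1) normc (a i)) ^+ 2)).
  by apply: sumr_ge0 => k _; rewrite mulr_ge0 // addr_ge0 // sqr_ge0.
move=> al l l1 alB; apply: ler_sum => k _; apply: (le_trans (sqmodD_le _ _)).
rewrite ler_pM2l //; apply: lerD; first exact: le_trans (ler_norm _).
rewrite -[leLHS]normc_sq normcN ler_sqr ?nnegrE ?normc_ge0 ?sumr_ge0 //; last first.
  by move=> i _; exact: normc_ge0.
apply: (le_trans (normc_sum _ _ _)); apply: ler_sum => i _.
by rewrite normcM normcX l1 expr1n mulr1.
Qed.

Let wnorm_tail al a l (K M : R) N : normc l = 1 ->
  \sum_(k < j) sqmod (tail al a l k) <= K ->
  (forall N, \sum_(k < N) 'C(k + j, j)%:R * sqmod (tail al a l (k + j)) <= M) ->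
  wnorm wght (tail al a l) N <= K + 2 * M.
Proof.
move=> l1 hK hM; apply: (le_trans (wnorm_homo wght_gt0 _ (leq_addr j N))).
rewrite /wnorm; under eq_bigr do rewrite mulrDl mul1r.
rewrite big_split /= (shift_sum (fun k => sqmod (tail al a l k))) (_ : 2 * M = M + M); last by ring.
rewrite addrA; apply: lerD => //.
rewrite addnC big_split_ord /=; apply: lerD => //.
apply: le_trans (hM N); apply: ler_sum => k _.
by rewrite addnC ler_peMl ?sqmod_ge0 // ler1n bin_gt0 leq_addl.
Qed.

(** The constants are fixed before l. B plays two roles: it bounds multiplication by f on (g - al')
    / (z - l), and it bounds the boundary value of f; likewise B' bounds that of g. *)
Lemma local_conv f g a a' (B B' : R) : has_ps f a -> has_ps g a' ->
  (forall x N, wnorm wght (conv a x) N <= B * wnorm wght x N) ->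
  (forall x N, wnorm wght (conv a' x) N <= B' * wnorm wght x N) ->
  exists K1 K2 K3 : R, forall l E E', normc l = 1 -> local_le j a l E -> local_le j a' l E' ->
    local_le j (conv a a') l (K1 + K2 * E + K3 * E').
Proof.
move=> fa ga' hB hB'; have [Ks Ks0 hKs] := tail_small a B; have [Ks' Ks'0 hKs'] := tail_small a' B'.
pose F : R := j`!%:R; have F0 : 0 < F by rewrite ltr0n fact_gt0.
(* The bound [hc] on the tails of the product, multiplied by the factor j! of [tail_local]. *)
exists (F * (2 * (B * Ks'))), (2 * B'), (4 * B) => l E E' l1 hE hE'.
have [al hal] := local_tail l1 hE; have [al' hal'] := local_tail l1 hE'.
have l0 : l != 0 by rewrite -normc_gt0 l1.
(* Boundary values are bounded by multiplier constants: [sup_bound] inside the disc, then the radial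
   limit. *)
have radial h b bl (Bb Eb : R) : has_ps h b ->
    (forall x N, wnorm wght (conv b x) N <= Bb * wnorm wght x N) ->
    (forall N, \sum_(k < N) 'C(k + j, j)%:R * sqmod (tail bl b l (k + j)) <= Eb) -> sqmod bl <= Bb.
  move=> hb hBb hEb.
  apply: (@tail_radial R h b bl l Bb (\sum_(k < j) sqmod (tail bl b l k) + 2 * Eb) l1 hb).
    by move=> z z1; exact: sup_bound wght_ge1 hb hBb z1.
  move=> N; apply: le_trans (wnorm_tail N l1 (lexx _) hEb).
  by apply: ler_sum => k _; rewrite ler_peMl ?sqmod_ge0 ?wght_ge1.
have alB := radial _ _ _ _ _ fa hB hal; have alB' := radial _ _ _ _ _ ga' hB' hal'.
have B0 : 0 <= B := le_trans (sqmod_ge0 _) alB.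
have B'0 : 0 <= B' := le_trans (sqmod_ge0 _) alB'.
(* The coefficients of (g - al') / (z - l). *)
pose y k := l ^- k.+1 * tail al' a' l k.
have sql n : sqmod (l ^+ n) = 1 by rewrite -normc_sq normcX l1 !expr1n.
have yt N : wnorm wght y N = wnorm wght (tail al' a' l) N.
  by apply: eq_bigr => k _; rewrite sqmodM -exprVn -normc_sq normcX normcV l1 invr1 !expr1n mul1r.
have hc N : \sum_(k < N) 'C(k + j, j)%:R * sqmod (tail (al * al') (conv a a') l (k + j)) <=
    2 * (B * (Ks' + 2 * (E' / F)) + B' * (E / F)).
  rewrite -(shift_sum (fun k => sqmod (tail (al * al') (conv a a') l k))).
  apply: (@le_trans _ _ (\sum_(k < N + j) 2 * (wght k * sqmod (conv a y k) +
      B' * ('C(k, j)%:R * sqmod (tail al a l k))))).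
    apply: ler_sum => k _; rewrite tail_conv // -/y.
    apply: (@le_trans _ _ ('C(k, j)%:R * (2 * (sqmod (conv a y k) + sqmod al' * sqmod (tail al a l k))))).
      apply: ler_wpM2l => //; apply: (le_trans (sqmodD_le _ _)).
      by rewrite !sqmodM sql mul1r.
    rewrite mulrCA ler_pM2l // mulrDr; apply: lerD.
      by rewrite ler_wpM2r ?sqmod_ge0 // lerDr.
    rewrite [leRHS]mulrCA; apply: ler_wpM2l => //; exact: ler_wpM2r (sqmod_ge0 _) _ _ _.
  rewrite -mulr_sumr ler_pM2l // big_split /= -mulr_sumr; apply: lerD; last first.
    by apply: ler_wpM2l => //; rewrite (shift_sum (fun k => sqmod (tail al a l k))).
  apply: (le_trans (hB y (N + j)%N)); apply: ler_wpM2l => //; rewrite yt.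
  exact: wnorm_tail (hKs' _ _ l1 alB') hal'.
have -> : F * (2 * (B * Ks')) + 2 * B' * E + 4 * B * E' =
  F * (2 * (B * (Ks' + 2 * (E' / F)) + B' * (E / F))) by field; exact: lt0r_neq0.
exact: tail_local l1 hc.
Qed.

End LocalProduct.

(** * From local inequalities to the integral against mu *)

Section EnergyTransfer.
Variable R : realType.
Local Notation C := R[i].
Local Notation mR := (measurableTypeR R).
Implicit Types (a : nat -> C) (l : C).

Lemma nneseries_leP (u : nat -> R) m (E : R) : (forall k, 0 <= u k) ->
  (\sum_(m <= k <oo) (u k)%:E <= E%:E)%E <-> forall N, \sum_(m <= k < N) u k <= E.
Proof.
move=> u0; split=> [h N|h].
  rewrite -lee_fin -sumEFin; apply: le_trans h; apply: nneseries_lim_ge => k _ _.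
  by rewrite lee_fin.
apply: lime_le; first by apply: is_cvg_nneseries => k _ _; rewrite lee_fin.
by apply: nearW => N; rewrite sumEFin lee_fin.
Qed.

Let local_term_ge0 j a l k : 0 <= sqmod (local_coef a j l k) * (k`!%:R / (k + j).+1`!%:R).
Proof. by rewrite mulr_ge0 ?sqmod_ge0 // divr_ge0. Qed.

Lemma local_energy_ge0 j a l : (0 <= local_energy a j l)%E.
Proof. by apply: nneseries_ge0 => k _ _; rewrite lee_fin. Qed.

Lemma local_leP j a l (E : R) : (local_energy a j.+1 l <= E%:E)%E <-> local_le j a l E.
Proof.
apply: (iff_trans (nneseries_leP 0 E (local_term_ge0 j.+1 a l))); split=> h N.
  by have := h N; rewrite big_mkord; under eq_bigr do rewrite mulrC.
by rewrite big_mkord; under eq_bigr do rewrite mulrC.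
Qed.

Lemma circle_normc (q : R * R) : circleR q -> normc (toC q) = 1.
Proof.
move=> q1; rewrite -[LHS](ger0_norm (normc_ge0 _)) -sqrtr_sqr normc_sq.
by rewrite /sqmod /= q1 sqrtr1.
Qed.

(** The coefficients |K| + 1 are strictly positive, so an infinite energy makes the right side
    infinite; otherwise E and E' are the energies themselves. *)
Lemma local_energy_transfer j a b c (K1 K2 K3 : R) l :
  (forall E E', local_le j a l E -> local_le j b l E' -> local_le j c l (K1 + K2 * E + K3 * E')) ->
  (local_energy c j.+1 l <= (`|K1| + 1)%:E + ((`|K2| + 1)%:E * local_energy a j.+1 l +
    (`|K3| + 1)%:E * local_energy b j.+1 l))%E.
Proof.
move=> h; have p (K : R) : 0 < `|K| + 1 by rewrite ltr_wpDl.
have := local_leP j a l; have := local_leP j b l.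
have := local_energy_ge0 j.+1 a l; have := local_energy_ge0 j.+1 b l.
case: (local_energy a _ _) => [E||//] => [|b0 _ _ _]; last first.
  rewrite gt0_muley ?lte_fin // addye ?addey ?leey //.
  by rewrite gt_eqF // (lt_le_trans ltNy0) // mule_ge0 // lee_fin ltW.
case: (local_energy b _ _) => [E'||//] => [E'0 E0 hb ha|_ _ _ _]; last first.
  by rewrite gt0_muley ?lte_fin // addey ?addey ?leey // -EFinM.
rewrite !lee_fin in E'0 E0; rewrite -!EFinM -!EFinD.
apply: le_trans ((local_leP j c l _).2 (h E E' ((ha E).1 (lexx _)) ((hb E').1 (lexx _)))) _.
have n1 := ler_norm K1; have n2 := ler_norm K2; have n3 := ler_norm K3.
rewrite lee_fin; nra.
Qed.

(** The common core of the closure properties under sums, scalars and products. Finiteness of mu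
    makes the constant K1 integrable. *)
Lemma Dmu_transfer (mu : {measure set (R * R)%type -> \bar R}) j f g h a b c (K1 K2 K3 : R) :
  (mu setT < +oo)%E -> has_ps f a -> has_ps g b -> has_ps h c ->
  (forall l E E', normc l = 1 -> local_le j a l E -> local_le j b l E' ->
     local_le j c l (K1 + K2 * E + K3 * E')) ->
  (Dmu mu j.+1 f < +oo -> Dmu mu j.+1 g < +oo -> Dmu mu j.+1 h < +oo)%E.
Proof.
move=> mufin fa gb hc hK; have [K K0 DE] := Dmu_local (ltn0Sn j) mufin.
have I0 x : (0 <= \int[mu]_(q in @circleR R) local_energy x j.+1 (toC q))%E.
  by apply: integral_ge0 => q _; exact: local_energy_ge0.
have fin x : (K%:E * \int[mu]_(q in @circleR R) local_energy x j.+1 (toC q) < +oo)%E <->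
    (\int[mu]_(q in @circleR R) local_energy x j.+1 (toC q) < +oo)%E.
  split => [|xoo]; last by apply: lte_mul_pinfty; rewrite ?lee_fin ?ltW.
  by case: (\int[mu]_(q in _) _)%E => [r||] //=; rewrite ?ltry // gt0_muley ?lte_fin.
rewrite (DE _ _ fa) (DE _ _ gb) (DE _ _ hc) => /fin Fa /fin Fb; apply/fin.
have mc := @measurable_circle R.
have me x : measurable_fun (@circleR R : set (mR * mR)) (fun q => local_energy x j.+1 (toC q)).
  by apply: measurable_funTS; exact: measurable_local_energy.
have p (x : R) : 0 <= `|x| + 1 by rewrite addr_ge0.
have ZE x (k : R) : (0 <= k)%R -> (\int[mu]_(q in @circleR R) (k%:E * local_energy x j.+1 (toC q)) =
    k%:E * \int[mu]_(q in @circleR R) local_energy x j.+1 (toC q))%E.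
  move=> k0; rewrite ge0_integralZl ?lee_fin //.
  - exact: me.
  - by move=> q _; exact: local_energy_ge0.
have ZF x (k : R) : 0 <= k -> (\int[mu]_(q in @circleR R) local_energy x j.+1 (toC q) < +oo)%E ->
    (\int[mu]_(q in @circleR R) (k%:E * local_energy x j.+1 (toC q)) < +oo)%E.
  by move=> k0 xoo; rewrite ZE //; apply: lte_mul_pinfty; rewrite ?lee_fin.
have me' x (k : R) : measurable_fun (@circleR R : set (mR * mR))
    (fun q => (k%:E * local_energy x j.+1 (toC q))%E) by exact: measurable_funeM.
have e0 x (k : R) q : 0 <= k -> (0 <= k%:E * local_energy x j.+1 (toC q))%E.
  by move=> k0; apply: mule_ge0; rewrite ?lee_fin ?local_energy_ge0.
apply: (@le_lt_trans _ _ (\int[mu]_(q in @circleR R) ((`|K1| + 1)%:E +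
    ((`|K2| + 1)%:E * local_energy a j.+1 (toC q) +
     (`|K3| + 1)%:E * local_energy b j.+1 (toC q)))))%E.
  apply: ge0_le_integral => //.
  - by move=> q _; exact: local_energy_ge0.
  - exact: me.
  - by apply: emeasurable_funD => //; apply: emeasurable_funD; exact: me'.
  - move=> q q1; apply: local_energy_transfer => E E'; apply: hK.
    exact: circle_normc.
rewrite ge0_integralD //; first last.
- by apply: emeasurable_funD; exact: me'.
- by move=> q _; rewrite adde_ge0 ?e0.
rewrite ge0_integralD //; first last.
- exact: me'.
- by move=> q _; rewrite e0.
- exact: me'.
- by move=> q _; rewrite e0.
apply: lte_add_pinfty; last by apply: lte_add_pinfty; apply: ZF.
rewrite integral_cst //; apply: lte_mul_pinfty; rewrite ?lee_fin //.
by apply: le_lt_trans mufin; apply: le_measure; rewrite ?inE.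
Qed.

End EnergyTransfer.

(** * Closure under the algebra operations *)

Section Algebra.
Variable R : realType.
Local Notation C := R[i].
Implicit Types (x : nat -> C) (f g h : C -> C).

Let sqmod0 : sqmod (0 : C) = 0. Proof. by rewrite /sqmod /= expr0n addr0. Qed.

Lemma wbounded_wght j x : (exists M : R, forall N, \sum_(k < N) 'C(k, j)%:R * sqmod (x k) <= M) <->
  wbounded (@wght R j) x.
Proof.
split=> [[M hM]|[M hM]]; last first.
  exists M => N; apply: le_trans (hM N); apply: ler_sum => k _.
  by rewrite ler_wpM2r ?sqmod_ge0 // lerDr.
(* The first j entries are not seen by the binomial weight; for the others the weight 1 is at most
   the binomial, which gives the second M. *)
exists (\sum_(k < j) sqmod (x k) + M + M) => N.
apply: (le_trans (wnorm_homo (@wght_gt0 R j) _ (leq_addl j N))).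
rewrite /wnorm; under eq_bigr do rewrite mulrDl mul1r.
rewrite big_split /=; apply: lerD; last exact: hM.
rewrite big_split_ord /=; apply: lerD => //.
apply: le_trans (hM (j + N)%N); rewrite big_split_ord /= ler_wpDl //.
  by apply: sumr_ge0 => k _; apply: mulr_ge0 => //; exact: sqmod_ge0.
by apply: ler_sum => k _; rewrite ler_peMl ?sqmod_ge0 // ler1n bin_gt0 leq_addr.
Qed.

Lemma HsigP j f : Hsig j f <-> holo f /\ wbounded (@wght R j) (coef f).
Proof.
pose u k : R := 'C(k, j)%:R * sqmod (coef f k).
have u0 k : 0 <= u k by apply: mulr_ge0 => //; exact: sqmod_ge0.
have ujE N : \sum_(k < N) u k = \sum_(j <= k < N) u k.
  rewrite -(big_mkord xpredT u); have [Nj|/ltnW jN] := leqP N j.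
    rewrite [RHS]big_geq // big_nat big1 // => k /andP[_ kN].
    by rewrite /u bin_small ?mul0r // (leq_trans kN).
  rewrite (big_cat_nat _ jN) //= big_nat big1 ?add0r // => k /andP[_ kj].
  by rewrite /u bin_small ?mul0r.
suff D : (Dsig j f < +oo)%E <-> wbounded (@wght R j) (coef f).
  by split=> -[fh] /D.
rewrite -wbounded_wght; split=> [foo|[M hM]].
  have D0 : (0 <= Dsig j f)%E by apply: nneseries_ge0 => k _ _; rewrite lee_fin u0.
  have fn : Dsig j f \is a fin_num by rewrite ge0_fin_numE.
  exists (fine (Dsig j f)) => N; rewrite ujE.
  by apply: (nneseries_leP j _ u0).1; rewrite fineK.
apply: (@le_lt_trans _ _ M%:E); last exact: ltry.
by apply: (nneseries_leP j _ u0).2 => N; rewrite -ujE.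
Qed.

Lemma wbounded_summable (w : nat -> R) x : (forall k, 1 <= w k) -> wbounded w x -> summable_ps x.
Proof.
move=> w1 [M hM] r r0 r1.
have w0 k : 0 < w k by exact: lt_le_trans (w1 k).
have M0 : 0 <= M := le_trans (wnorm_ge0 w0 _ _) (hM 0%N).
exists (Num.sqrt M * (1 - r)^-1) => N.
apply: (@le_trans _ _ (Num.sqrt M * \sum_(k < N) r ^+ k)); last first.
  by apply: ler_wpM2l; [exact: sqrtr_ge0|exact: geom_bound].
rewrite mulr_sumr; apply: ler_sum => k _; apply: ler_wpM2r; first exact: exprn_ge0.
rewrite -ler_sqr ?nnegrE ?normc_ge0 ?sqrtr_ge0 // normc_sq sqr_sqrtr //.
apply: le_trans (hM k.+1); rewrite /wnorm big_ord_recr /= -/(wnorm w x k).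
by apply: ler_wpDl; [exact: wnorm_ge0|rewrite ler_peMl ?sqmod_ge0].
Qed.

(** Every sequence of finite norm is the coefficient sequence of a function of the space, so the
    multiplier property becomes the hypothesis on sequences of [conv_uniform_bound]. *)
Lemma Mult_conv_wbounded j f x : Mult (Hsig j) f ->
  wbounded (@wght R j) x -> wbounded (@wght R j) (conv (coef f) x).
Proof.
move=> [fh fM] xb; have xps := psumP (wbounded_summable (@wght_ge1 R j) xb).
have xh := has_ps_holo xps; have cx := has_ps_coef xps.
have xH : Hsig j (psum x) by apply/HsigP; rewrite cx.
have [_] := (HsigP j _).1 (fM _ xH).
have cfx := has_ps_coef (has_psM (holo_has_ps fh) xps).
by rewrite cfx.
Qed.

Lemma Hsig1 j : Hsig j (fun=> 1 : C).
Proof.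
have ps1 := @has_ps_cst R 1; apply/HsigP; rewrite (has_ps_coef ps1); split.
  exact: has_ps_holo ps1.
by apply: (@wbounded_finite _ _ (@wght_gt0 R j) _ 1) => -[].
Qed.

Lemma HsigD j f g : Hsig j f -> Hsig j g -> Hsig j (fun z => f z + g z).
Proof.
move=> /HsigP[fh [M hM]] /HsigP[gh [M' hM']].
have ps := has_psD (holo_has_ps fh) (holo_has_ps gh).
apply/HsigP; rewrite (has_ps_coef ps); split; first exact: has_ps_holo ps.
exists (2 * (M + M')) => N; apply: le_trans (wnormD (@wght_gt0 R j) _ _ _) _.
by rewrite ler_pM2l // lerD.
Qed.

Lemma HsigZ j c f : Hsig j f -> Hsig j (fun z => c * f z).
Proof.
move=> /HsigP[fh [M hM]]; have ps := has_psZ c (holo_has_ps fh).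
apply/HsigP; rewrite (has_ps_coef ps); split; first exact: has_ps_holo ps.
by exists (sqmod c * M) => N; rewrite wnormZ; apply: ler_wpM2l (hM N); exact: sqmod_ge0.
Qed.

Lemma Hsig_H2 j f : Hsig j f -> H2 f.
Proof.
move=> /HsigP[fh [M hM]]; apply/HsigP; split=> //; apply/wbounded_wght.
exists M => N; apply: le_trans (hM N); apply: ler_sum => k _.
by rewrite bin0 ler_wpM2r ?sqmod_ge0 // wght_ge1.
Qed.

Lemma Mult_Hsig j f : Mult (@Hsig R j) f -> Hsig j f.
Proof. by move=> [_ /(_ _ (Hsig1 j))]; under eq_fun do rewrite mulr1. Qed.

Lemma Mult1 j : Mult (@Hsig R j) (fun=> 1).
Proof. by split=> [|f fH]; [exact: (Hsig1 j).1|under eq_fun do rewrite mul1r]. Qed.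

Lemma MultD j f g : Mult (@Hsig R j) f -> Mult (Hsig j) g -> Mult (Hsig j) (fun z => f z + g z).
Proof.
move=> mf mg; split=> [|h hH]; first exact: (HsigD (Mult_Hsig mf) (Mult_Hsig mg)).1.
under eq_fun do rewrite mulrDl; exact: HsigD (mf.2 h hH) (mg.2 h hH).
Qed.

Lemma MultZ j c f : Mult (@Hsig R j) f -> Mult (Hsig j) (fun z => c * f z).
Proof.
move=> mf; split=> [|h hH]; first exact: (HsigZ c (Mult_Hsig mf)).1.
by under eq_fun do rewrite -mulrA; apply: HsigZ (mf.2 h hH).
Qed.

Lemma MultM j f g : Mult (@Hsig R j) f -> Mult (Hsig j) g -> Mult (Hsig j) (fun z => f z * g z).
Proof.
move=> mf mg; split=> [|h hH]; first exact: (mf.2 g (Mult_Hsig mg)).1.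
by under eq_fun do rewrite -mulrA; apply: mf.2 (mg.2 h hH).
Qed.

Lemma local_coef_cst c n l k : local_coef (fun i => if i == 0%N then c else 0) n.+1 l k = 0 :> C.
Proof. by rewrite /local_coef big1 // => i _; rewrite addnS mul0rn mul0r. Qed.

Lemma local_coefD a b n l k : local_coef (fun i => a i + b i) n l k =
  local_coef a n l k + local_coef b n l k :> C.
Proof. by rewrite /local_coef -big_split; apply: eq_bigr => i _; rewrite mulrnDl mulrDl. Qed.

Lemma local_coefZ c a n l k : local_coef (fun i => c * a i) n l k = c * local_coef a n l k :> C.
Proof. by rewrite /local_coef mulr_sumr; apply: eq_bigr => i _; rewrite -mulrnAr mulrA. Qed.

Let weight_ge0 k j : 0 <= k`!%:R / (k + j.+1).+1`!%:R :> R. Proof. exact: divr_ge0. Qed.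

Variable mu : {measure set (R * R)%type -> \bar R}.
Hypothesis mu_fin : (mu setT < +oo)%E.

Lemma Dmu_cst j c : (Dmu mu j.+1 (fun=> c) < +oo)%E.
Proof.
have [K _ DE] := Dmu_local (ltn0Sn j) mu_fin; rewrite (DE _ _ (has_ps_cst c)).
rewrite integral0_eq ?mule0 ?ltry // => q _; rewrite /local_energy eseries0 // => k _ _.
by rewrite local_coef_cst sqmod0 mul0r.
Qed.

Lemma DmuD j f g : holo f -> holo g -> (Dmu mu j.+1 f < +oo)%E -> (Dmu mu j.+1 g < +oo)%E ->
  (Dmu mu j.+1 (fun z => f z + g z)%R < +oo)%E.
Proof.
move=> /holo_has_ps fa /holo_has_ps gb.
apply: (@Dmu_transfer R mu j f g _ _ _ _ 0 2 2 mu_fin fa gb (has_psD fa gb)) => l E E' _ hE hE' N.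
apply: (@le_trans _ _ (2 * (E + E'))); last by lra.
apply: le_trans (ler_wpM2l _ (lerD (hE N) (hE' N))) => //.
rewrite -big_split mulr_sumr; apply: ler_sum => k _ /=.
by rewrite -mulrDr mulrCA; rewrite ler_wpM2l ?weight_ge0 // local_coefD sqmodD_le.
Qed.

Lemma DmuZ j c f : holo f -> (Dmu mu j.+1 f < +oo)%E -> (Dmu mu j.+1 (fun z => c * f z)%R < +oo)%E.
Proof.
(* The transfer takes two functions; f serves as both, the second with coefficient 0. *)
move=> /holo_has_ps fa foo; move: (foo) (foo).
apply: (@Dmu_transfer R mu j f f _ _ _ _ 0 (sqmod c) 0 mu_fin fa fa (has_psZ c fa)) => l E E' _ hE _ N.
rewrite add0r mul0r addr0; apply: le_trans (ler_wpM2l (sqmod_ge0 _) (hE N)).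
by rewrite mulr_sumr; apply: ler_sum => k _; rewrite local_coefZ sqmodM mulrCA.
Qed.

Lemma DmuM j f g : Mult (Hsig j) f -> Mult (Hsig j) g ->
  (Dmu mu j.+1 f < +oo)%E -> (Dmu mu j.+1 g < +oo)%E -> (Dmu mu j.+1 (fun z => f z * g z)%R < +oo)%E.
Proof.
move=> mf mg; have fa := holo_has_ps mf.1; have ga := holo_has_ps mg.1.
have [B _ hB] := conv_uniform_bound (@wght_gt0 R j) (fun x => @Mult_conv_wbounded j f x mf).
have [B' _ hB'] := conv_uniform_bound (@wght_gt0 R j) (fun x => @Mult_conv_wbounded j g x mg).
have [K1 [K2 [K3 hK]]] := local_conv fa ga hB hB'.
exact: Dmu_transfer mu_fin fa ga (has_psM fa ga) hK.
Qed.

End Algebra.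

Theorem theorem1p2 (R : realType) (mu : {measure set (R * R)%type -> \bar R})
  (n : nat) :
  (0 < n)%N ->
  (mu setT < +oo)%E ->
  mu (~` @circleR R) = 0%E ->
  is_algebra (fun f => Hmu mu n f /\ Mult (Hsig n.-1) f).
Proof.
case: n => [//|j] _ mufin _ /=.
(* This settles mu = 0 for all four operations at once: the multipliers lie in H^2, and only the
   finiteness of [Dmu] for nonzero mu remains. *)
have HmuP f : Mult (Hsig j) f -> (~ mu_zero mu -> (Dmu mu j.+1 f < +oo)%E) ->
    Hmu mu j.+1 f /\ Mult (Hsig j) f.
  by move=> mf fD; split=> //; split; [exact: mf.1|split=> // _; exact: Hsig_H2 (Mult_Hsig mf)].
split; [|split; [|split]].
- by apply: HmuP => [|_]; [exact: Mult1|exact: Dmu_cst].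
- move=> f g [[fh [_ fD]] mf] [[gh [_ gD]] mg]; apply: HmuP => [|nz]; first exact: MultD.
  by apply: DmuD => //; [exact: fD|exact: gD].
- move=> c f [[fh [_ fD]] mf]; apply: HmuP => [|nz]; first exact: MultZ.
  by apply: DmuZ => //; exact: fD.
- move=> f g [[fh [_ fD]] mf] [[gh [_ gD]] mg]; apply: HmuP => [|nz]; first exact: MultM.
  by apply: DmuM => //; [exact: fD|exact: gD].
Qed.
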